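(* Let $\omega\subset\mathbb{W}\equiv\mathbb{R}^2$ be open. If $\phi\in Lip_{\mathbb{W}}(\omega)$, i.e. $\phi:\omega\to\mathbb{R}$ is intrinsic Lipschitz continuous, then $\phi$ is $\phi$-differentiable at $\mathcal{L}^2$-a.e. point of $\omega$.
   Context: The first Heisenberg group is $\mathbb{H}^1\equiv\mathbb{C}\times\mathbb{R}\equiv\mathbb{R}^3$, with points $[z,t]=[x+iy,t]=(x,y,t)$ and group law $[z,t]\cdot[z',t']=[z+z',\,t+t'-\frac12\mathrm{Im}(z\bar z')]$. Set $\mathbb{W}=\{(x,y,t)\in\mathbb{H}^1: x=0\}\equiv\mathbb{R}^2$, whose points are written $A=(y,t)$; the induced group law on $\mathbb{W}$ is $(y,t)\cdot(y',t')=(y+y',t+t')$, and $(y,t)^{-1}=(-y,-t)$. For $\phi:\omega\to\mathbb{R}$ and $A=(y,t),B=(y',t')\in\omega$, the graph quasidistance is \[ d_\phi(A,B)=|y-y'|+\left|t'-t-\tfrac12\big(\phi(A)+\phi(B)\big)(y'-y)\right|^{1/2}. \] Intrinsic Lipschitz: $\phi\in Lip_{\mathbb{W}}(\omega)$ if there is a constant $L>0$ such that $|\phi(A)-\phi(B)|\le L\,d_\phi(A,B)$ for all $A,B\in\omega$. (Such a $\phi$ is continuous.) $\mathbb{W}$-linear: a map $L:\mathbb{W}\to\mathbb{R}$ is $\mathbb{W}$-linear if it is a group homomorphism and $L(ry,r^2t)=rL(y,t)$ for all $r>0$, $(y,t)\in\mathbb{W}$ (equivalently, $L(y,t)=\hat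 w\,y$ for a unique $\hat w\in\mathbb{R}$). $\phi$-differentiability: for a continuous $\phi:\omega\to\mathbb{R}$, a function $\psi:\omega\to\mathbb{R}$ is $\phi$-differentiable at $A_0\in\omega$ if there is a $\mathbb{W}$-linear functional $L:\mathbb{W}\to\mathbb{R}$ such that \[ \lim_{A\to A_0}\frac{\psi(A)-\psi(A_0)-L(A_0^{-1}\cdot A)}{d_\phi(A_0,A)}=0 . \] In the statement this is applied with $\psi=\phi$. $\mathcal{L}^2$ is the Lebesgue measure on $\mathbb{R}^2$. *)

(* Defs.v *)
From mathcomp Require Export all_boot all_order all_algebra.
From mathcomp Require Export all_classical all_reals all_analysis.
From mathcomp Require Import ring.

Set Implicit Arguments.
Unset Strict Implicit.
Unset Printing Implicit Defensive.

Export Order.TTheory GRing.Theory Num.Theory.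
Export numFieldNormedType.Exports.

Local Open Scope classical_set_scope.
Local Open Scope ring_scope.

(* Heisenberg group law [z, t] . [z', t'] = [z + z', t + t' - Im(z conj(z')) / 2]
   in the real coordinates (x, y, t), z = x + iy; Im (z conj(z')) = y x' - x y'. *)
Definition heis_mul (R : realType) (p q : R * R * R) : R * R * R :=
  (p.1.1 + q.1.1, p.1.2 + q.1.2,
   p.2 + q.2 - 2^-1 * (p.1.2 * q.1.1 - p.1.1 * q.1.2)).

Definition W_embed (R : realType) (A : R * R) : R * R * R := (0, A.1, A.2).

(* The law induced on W = {x = 0}, in the coordinates A = (y, t), is the
   componentwise addition of R * R: below, A^-1 . B is written B - A. *)
Lemma heis_mul_W (R : realType) (A B : R * R) :
  heis_mul (W_embed A) (W_embed B) = W_embed (A + B).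
Proof.
rewrite /heis_mul /W_embed /=; congr (_, _, _); first by rewrite addr0.
by ring.
Qed.

Section intrinsic.
Variable R : realType.
Implicit Types (omega : set (R * R)) (phi psi L : R * R -> R).

Definition graph_dist phi (A B : R * R) : R :=
  `|A.1 - B.1| +
  Num.sqrt `|B.2 - A.2 - 2^-1 * (phi A + phi B) * (B.1 - A.1)|.

(* Functions on omega are represented by total functions, of which only the
   values on omega are ever used. *)
Definition intrinsic_lipschitz omega phi : Prop :=
  exists2 K : R, 0 < K &
    forall A B, omega A -> omega B ->
      `|phi A - phi B| <= K * graph_dist phi A B.

Definition W_linear L : Prop :=
  (forall A B, L (A + B) = L A + L B) /\
  (forall (r : R) (A : R * R), 0 < r -> L (r * A.1, r ^+ 2 * A.2) = r * L A).

(* graph_dist phi A0 A vanishes only at A = A0, which A0^' excludes. *)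
Definition graph_differentiable omega phi psi (A0 : R * R) : Prop :=
  exists2 L : R * R -> R, W_linear L &
    (psi A - psi A0 - L (A - A0)) / graph_dist phi A0 A
      @[A --> within omega A0^'] --> (0 : R).

End intrinsic.

(* Main.v *)
Require Import Defs.
From mathcomp Require Import measurable_realfun measurable_fun_approximation ring lra.

(* Where phi is smooth, it is intrinsic Lipschitz when w := phi_y + (phi^2 / 2)_t is
   bounded.  In general the flux T of (phi, phi^2 / 2) through the boundary of a
   region plays the role of the integral of w.  T is invariant under the Galilean
   change phi -> phi - c, and phi varies by O(rho) on a strip of width rho, height rho^2
   and slope phi; hence |T| <= C area on such strips, and by additivity on all strips.
   Therefore the energy sum T(Q)^2 / |Q| of a square grid is bounded, and for a grid of
   almost maximal energy the densities T(Q) / |Q| approximate T in total variation on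
   disjoint families of strips.  With a Vitali argument for strips adapted to phi this
   gives, at almost every point P, a limit w of T / area over the adapted strips near P.
   At such a P, applying T = w area + o(area) to thin strips above and below an Euler
   polygon of y |-> phi(y, .), where the quadratic flux term has a sign (as for the
   characteristics of the Burgers equation), shows that phi grows at rate w along the
   polygon.  Two polygons starting on the vertical line of P cannot cross, so phi is
   o(r) close to phi(P) at vertical distance r^2, and moving from a nearby point to
   that vertical line along a polygon gives the differential L(y, t) = w y. *)

Set Implicit Arguments.
Unset Strict Implicit.
Unset Printing Implicit Defensive.

Local Open Scope classical_set_scope.
Local Open Scope ring_scope.

(** * Primitives of continuous functions *)

(** Since [phi] is only Hoelder 1/2 in t, w is available only through its averages, and the averages
    that matter are over strips whose slopes are values of [phi], not over a fixed family of shapes.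
    The grid energy is a discrete substitute for Radon-Nikodym and L^2 martingale convergence: one
    grid, chosen before the strips, controls every disjoint family of them inside its cells, so the
    exceptional set can be made as small as desired. The strips are needed with height b^2 rho^2 for
    arbitrarily large b. A step of length rho predicts the increment of [phi] only up to rho C^2 /
    (2 b^2), the loss in completing the square, and this relative error does not shrink with rho. A
    large b makes it small; its price, of order K b rho, comes from replacing [phi] by its mean over
    the height of a strip, and is paid only at the two ends of a polygon. Hence b and the number of
    steps are fixed before the scale, and the limit w must hold for strips of every aspect constant
    M. *)

Section primitive.
Variable R : realType.
Implicit Types f g F G : R -> R.

Lemma exists_primitive_right f (a : R) : continuous f ->
  exists F, forall x : R, a < x -> is_derive x 1 F (f x).
Proof.
move=> cf.
exists (fun x => \int[@lebesgue_measure R]_(t in `[a, x]) f t)%R => x ax.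
have xu : x < x + 1 by rewrite ltrDl.
have [] := @continuous_FTC1_closed R f a x (x + 1) xu _ ax (cf x).
  apply: continuous_compact_integrable; first exact: segment_compact.
  exact: continuous_subspaceT.
by move=> dF <-; rewrite derive1E; apply: DeriveDef.
Qed.

Lemma is_derive_continuous F (df x : R) : is_derive x 1 F df -> {for x, continuous F}.
Proof.
move=> [dF _]; apply: differentiable_continuous.
exact/derivable1_diffP.
Qed.

Lemma MVT_le F (df : R -> R) (a b : R) : a <= b ->
  (forall x, a <= x <= b -> is_derive x 1 F (df x)) ->
  exists2 x, a <= x <= b & F b - F a = df x * (b - a).
Proof.
move=> ab dF.
have [||x xab E] := @MVT_segment R F df a b ab.
- by move=> x /subset_itv_oo_cc; rewrite in_itv => /dF.
- apply: continuous_in_subspaceT => x /set_mem /=.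
  by rewrite in_itv => /dF; exact: is_derive_continuous.
by exists x.
Qed.

(** Integrating from a base point gives a primitive only to the right of it. The primitives on the
    half-lines (-n, oo), normalized at 0, agree where both are valid because their difference has
    zero derivative between 0 and the point. *)
Lemma exists_primitive f : continuous f ->
  exists F, forall x : R, is_derive x 1 F (f x).
Proof.
move=> cf.
have /choice[F dF] : forall n : nat, exists G, forall x : R, - n%:R < x -> is_derive x 1 G (f x).
  by move=> n; exact: exists_primitive_right.
have glue m n x : - m.+1%:R < x -> - n.+1%:R < x ->
    F m.+1 x - F m.+1 0 = F n.+1 x - F n.+1 0.
  move=> mx nx.
  have d y : Num.min x 0 <= y -> is_derive y 1 (F m.+1 - F n.+1) 0.
    rewrite ge_min => xy.
    have my : - m.+1%:R < y.
      by case/orP: xy; apply: lt_le_trans; rewrite // oppr_lt0 ltr0n.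
    have ny : - n.+1%:R < y.
      by case/orP: xy; apply: lt_le_trans; rewrite // oppr_lt0 ltr0n.
    by rewrite -(subrr (f y)); apply: is_deriveB; exact: dF.
  have [x0|x0] := leP x 0.
    have [|y _] := @MVT_le (F m.+1 - F n.+1) (fun=> 0) x 0 x0.
      by move=> y /andP[xy _]; apply: d; rewrite ge_min xy.
    rewrite mul0r !fctE; lra.
  have [|y _] := @MVT_le (F m.+1 - F n.+1) (fun=> 0) 0 x (ltW x0).
      by move=> y /andP[xy _]; apply: d; rewrite ge_min xy orbT.
  rewrite mul0r !fctE; lra.
(* [F (k x)] is valid at x, and [F (k x).+1] on all of (x - 1, oo), so that one fixed primitive
   serves on a neighbourhood of x. *)
pose k (x : R) := (Num.truncn `|x|).+1.
have kx x : - (k x).+1%:R < x - 1.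
  have := truncnS_gt `|x|; rewrite -/(k x) -natr1.
  have := ler_normr x `|x|; have := ler_norm (- x); rewrite normrN; lra.
exists (fun x => F (k x) x - F (k x) 0) => x.
have d : is_derive x 1 (F (k x).+1 - cst (F (k x).+1 0)) (f x).
  rewrite -[f x]subr0; apply: is_deriveB.
  by apply: dF; have := kx x; lra.
have e : \forall y \near x, (F (k x).+1 - cst (F (k x).+1 0)) y = F (k y) y - F (k y) 0.
  have : \forall y \near x, x - 1 < y by apply: lt_nbhsr; lra.
  apply: filterS => y xy; rewrite /k.
  apply: (glue (k x)); first exact: lt_trans xy.
  have := truncnS_gt `|y|; have := ler_norm (- y); rewrite normrN; lra.
exact: near_eq_is_derive e d.
Qed.

(** A chosen primitive in place of an integral: only its increments are used, and they carry the
    orientation, so intervals may be traversed in either direction. *)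
Definition prim f : R -> R :=
  xget (fun=> 0) [set F | forall x : R, is_derive x 1 F (f x)].

Lemma is_derive_prim f (x : R) : continuous f -> is_derive x 1 (prim f) (f x).
Proof.
move=> cf; rewrite /prim; case: xgetP => [F _ /(_ x)//|].
by have [F dF] := exists_primitive cf => /(_ F).
Qed.

Definition between (a b x : R) : Prop := a <= x <= b \/ b <= x <= a.

Lemma between_add (a b x : R) : between a (a + b) x -> `|x - a| <= `|b|.
Proof.
by case=> /andP[h1 h2]; case: (ger0P b) => b0; case: (ger0P (x - a)) => x0; lra.
Qed.

Lemma prim_mvt f (a b : R) : continuous f ->
  exists2 x, between a b x & prim f b - prim f a = f x * (b - a).
Proof.
move=> cf; have [ab|/ltW ba] := leP a b.
  have [x xab ->] := MVT_le ab (fun x _ => is_derive_prim x cf).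
  by exists x => //; left.
have [x xab e] := MVT_le ba (fun x _ => is_derive_prim x cf).
by exists x; [right|rewrite -opprB e; ring].
Qed.

(** The mean value theorem for the difference yields one point common to both integrands;
    [euler_step] completes a square at that point. *)
Lemma prim_mvtB f g (a b : R) : continuous f -> continuous g ->
  exists2 x, between a b x &
    (prim f b - prim f a) - (prim g b - prim g a) = (f x - g x) * (b - a).
Proof.
move=> cf cg.
have d (x : R) : is_derive x 1 (prim f - prim g) (f x - g x).
  by apply: is_deriveB; exact: is_derive_prim.
have [ab|/ltW ba] := leP a b.
  have [x xab] := MVT_le ab (fun x _ => d x).
  rewrite !fctE => e; exists x; [by left|].
  rewrite -[RHS]e; ring.
have [x xab] := MVT_le ba (fun x _ => d x).
rewrite !fctE => e; exists x; [by right|].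
transitivity (- ((f x - g x) * (a - b))); last by ring.
rewrite -[in RHS]e; ring.
Qed.

End primitive.

(** * The flux of (phi, phi^2 / 2) through the boundary of a region between two lines *)

Section flux.
Variable R : realType.
Variable phi : R * R -> R.
Hypothesis cphi : continuous phi.

Definition line : Type := (R * R)%type.
Definition ev (l : line) (y : R) : R := l.1 + l.2 * y.
Definition through (p : R * R) (s : R) : line := (p.2 - s * p.1, s).
Definition hline (t : R) : line := (t, 0).
Definition shift (l : line) (h : R) : line := (l.1 + h, l.2).

Lemma ev_through p s y : ev (through p s) y = p.2 + s * (y - p.1).
Proof. by rewrite /ev /=; ring. Qed.

Lemma ev_hline t y : ev (hline t) y = t.
Proof. by rewrite /ev /=; ring. Qed.

Lemma ev_shift l h y : ev (shift l h) y = ev l y + h.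
Proof. by rewrite /ev /=; ring. Qed.

Definition vert (y : R) : R -> R := prim (fun t => phi (y, t)).

(** The integrand is the product of the field with the upward normal (-slope, 1) of the line. *)
Definition horz (l : line) : R -> R :=
  prim (fun y => phi (y, ev l y) ^+ 2 / 2 - l.2 * phi (y, ev l y)).

(* The outward flux of the field (phi, phi^2 / 2), in the coordinates (y, t),
   through the boundary of the region enclosed by the lines l and l' over
   [a, b]. *)
Definition flux (l l' : line) (a b : R) : R :=
  (vert b (ev l' b) - vert b (ev l b)) - (vert a (ev l' a) - vert a (ev l a))
  + (horz l' b - horz l' a) - (horz l b - horz l a).

Lemma flux_catx l l' a b c : flux l l' a c = flux l l' a b + flux l l' b c.
Proof. by rewrite /flux; ring. Qed.

Lemma flux_catt l l' l'' a b : flux l l'' a b = flux l l' a b + flux l' l'' a b.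
Proof. by rewrite /flux; ring. Qed.

Lemma continuous_vert y : continuous (fun t => phi (y, t)).
Proof.
move=> t; apply: (@continuous_comp _ _ _ (fun t => (y, t)) phi); last exact: cphi.
by exact: (cvg_pair (cvg_cst _) cvg_id).
Qed.

Lemma continuous_ev l : continuous (ev l).
Proof.
move=> y; rewrite /ev; apply: cvgD; first exact: cvg_cst.
by apply: cvgM; [exact: cvg_cst|exact: cvg_id].
Qed.

Lemma continuous_on_line l : continuous (fun y => phi (y, ev l y)).
Proof.
move=> y; apply: (@continuous_comp _ _ _ (fun y => (y, ev l y)) phi); last exact: cphi.
exact: (cvg_pair cvg_id (@continuous_ev l y)).
Qed.

Lemma continuous_horz l :
  continuous (fun y => phi (y, ev l y) ^+ 2 / 2 - l.2 * phi (y, ev l y)).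
Proof.
move=> y; have h := @continuous_on_line l y.
apply: cvgB; last by apply: cvgM => //; exact: cvg_cst.
by apply: cvgM; [rewrite expr2; exact: cvgM|exact: cvg_cst].
Qed.

(** Subtracting c from [phi] and from both slopes changes the four sides by constants that cancel
    around the closed boundary. So only the oscillation U of [phi] about c and the slopes relative
    to c enter, through a mean value point on each side. *)
Lemma flux_galilean l l' (a b c U : R) :
  (forall t, between (ev l b) (ev l' b) t -> `|phi (b, t) - c| <= U) ->
  (forall t, between (ev l a) (ev l' a) t -> `|phi (a, t) - c| <= U) ->
  (forall y, between a b y -> `|phi (y, ev l y) - c| <= U) ->
  (forall y, between a b y -> `|phi (y, ev l' y) - c| <= U) ->
  `|flux l l' a b| <= U * `|ev l' b - ev l b| + U * `|ev l' a - ev l a|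
    + `|b - a| * (U ^+ 2 + (`|l.2 - c| + `|l'.2 - c|) * U).
Proof.
move=> hb ha hl hl'.
have [tb /hb Ub eb] := prim_mvt (ev l b) (ev l' b) (@continuous_vert b).
have [ta /ha Ua ea] := prim_mvt (ev l a) (ev l' a) (@continuous_vert a).
have [y /hl Uy ey] := prim_mvt a b (@continuous_horz l).
have [y' /hl' Uy' ey'] := prim_mvt a b (@continuous_horz l').
have U0 : 0 <= U by exact: le_trans Uy.
pose u := phi (y, ev l y) - c; pose u' := phi (y', ev l' y') - c.
have -> : flux l l' a b = (phi (b, tb) - c) * (ev l' b - ev l b)
   - (phi (a, ta) - c) * (ev l' a - ev l a)
   + (b - a) * ((u' ^+ 2 / 2 - u ^+ 2 / 2) + ((l.2 - c) * u - (l'.2 - c) * u')).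
  by rewrite /flux /vert /horz eb ea ey ey' /u /u' /ev; field.
apply: (le_trans (ler_normD _ _)); apply: lerD.
  apply: (le_trans (ler_normB _ _)); rewrite !normrM.
  by apply: lerD; apply: ler_wpM2r.
rewrite normrM; apply: ler_wpM2l => //.
apply: (le_trans (ler_normD _ _)); apply: lerD.
  have hu : u ^+ 2 <= U ^+ 2 by rewrite -real_normK ?num_real// lerXn2r ?nnegrE.
  have hu' : u' ^+ 2 <= U ^+ 2 by rewrite -real_normK ?num_real// lerXn2r ?nnegrE.
  by have := sqr_ge0 u; have := sqr_ge0 u'; rewrite ler_norml; lra.
apply: (le_trans (ler_normB _ _)); rewrite !normrM mulrDl.
by apply: lerD; apply: ler_wpM2l.
Qed.

Variables (K F : R) (D : set (R * R)).
Hypothesis K0 : 0 < K.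
Hypothesis phiF : forall p, `|phi p| <= F.
Hypothesis phiK : forall A B, D A -> D B ->
  `|phi A - phi B| <= K * graph_dist phi A B.

Lemma bound_ge0 : 0 <= F.
Proof. exact: le_trans (phiF (0, 0)). Qed.

(** The quasidistance contains the mean of [phi A] and [phi B]. Using the slope [phi A] alone costs
    X r / 2 under the root, where X is the difference to be bounded; Young's inequality for K S r
    allows X to be absorbed on the left. *)
Lemma phi_near A B (r a : R) : D A -> D B -> 0 < r -> 0 <= a ->
  `|B.1 - A.1| <= r -> `|B.2 - A.2 - phi A * (B.1 - A.1)| <= a * r ^+ 2 ->
  `|phi B - phi A| <= (2 * K + K ^+ 2 + a) * r.
Proof.
move=> DA DB r0 a0 hy ht.
have := phiK DA DB; rewrite /graph_dist distrC [`|A.1 - B.1|]distrC.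
set X := `|phi B - phi A|; set S := Num.sqrt _ => hX.
have S0 : 0 <= S by exact: sqrtr_ge0.
have S2 : S ^+ 2 <= a * r ^+ 2 + X * r / 2.
  rewrite sqr_sqrtr ?normr_ge0//.
  have -> : B.2 - A.2 - 2^-1 * (phi A + phi B) * (B.1 - A.1) =
     (B.2 - A.2 - phi A * (B.1 - A.1)) - (phi B - phi A) * (B.1 - A.1) / 2 by field; rewrite ?pnatr_eq0.
  apply: (le_trans (ler_normB _ _)); apply: lerD => //.
  rewrite !normrM [`|2^-1|]ger0_norm ?ler_wpM2r//; try lra.
  by apply: ler_wpM2l.
have hK : K * S * r * 2 <= S ^+ 2 + K ^+ 2 * r ^+ 2.
  by have := sqr_ge0 (S - K * r); lra.
have h1 : X * r <= K * r * r + K * S * r.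
  rewrite -mulrDl ler_pM2r// -mulrDr; apply: (le_trans hX).
  by rewrite ler_pM2l// lerD2r.
rewrite -(ler_pM2r r0).
have : 0 <= K * r * r by rewrite !mulr_ge0// ltW.
have : 0 <= K ^+ 2 * r ^+ 2 by rewrite mulr_ge0// sqr_ge0.
have : 0 <= a * r ^+ 2 by rewrite mulr_ge0// sqr_ge0.
lra.
Qed.

Lemma phi_vert (y t t' : R) : D (y, t) -> D (y, t') ->
  `|phi (y, t') - phi (y, t)| <= K * Num.sqrt `|t' - t|.
Proof.
move=> h h'; have := phiK h h'; rewrite /graph_dist/= subrr normr0 add0r mulr0 subr0.
by rewrite distrC.
Qed.

End flux.

(** * The flux is bounded by the area *)

Section flux_lipschitz.
Variable R : realType.
Variables (phi : R * R -> R) (K F r0 : R) (ctr : R * R).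
Hypothesis cphi : continuous phi.

Definition box (c : R * R) (r : R) : set (R * R) :=
  [set p | `|p.1 - c.1| <= r /\ `|p.2 - c.2| <= r].

Hypothesis r0_gt0 : 0 < r0.
Hypothesis K0 : 0 < K.
Hypothesis phiF : forall p, `|phi p| <= F.
Hypothesis phiK : forall A B, box ctr (2 * r0) A -> box ctr (2 * r0) B ->
  `|phi A - phi B| <= K * graph_dist phi A B.

Let F0 : 0 <= F := bound_ge0 phiF.

Lemma box_near p q : box ctr r0 p -> `|q.1 - p.1| <= r0 -> `|q.2 - p.2| <= r0 ->
  box ctr (2 * r0) q.
Proof. by move=> [+ +] + +; rewrite /box/= !ler_norml; lra. Qed.

Definition charline (p : R * R) : line R := through p (phi p).

Lemma ev_charline p y : ev (charline p) y = p.2 + phi p * (y - p.1).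
Proof. exact: ev_through. Qed.

Definition cst_fan (L : R) : R :=
  4 * L * (2 * K + K ^+ 2 + 2 * L) + (2 * K + K ^+ 2 + 2 * L) ^+ 2.

(** A line of arbitrary slope is exchanged for the characteristic one through its left end. Over a
    width r^2 both stay within L r^2 of that end, so [phi] varies by O(r) and the triangle between
    them has flux O(r^3). Over about 1 / r^2 columns these errors add up to O(r) only. *)
Lemma flux_fan l (a L r : R) : F <= L -> `|l.2| <= L -> 0 < r -> r <= 1 ->
  box ctr r0 (a, ev l a) -> r ^+ 2 <= r0 -> L * r ^+ 2 <= r0 ->
  `|flux phi l (charline (a, ev l a)) a (a + r ^+ 2)| <= cst_fan L * r ^+ 3.
Proof.
move=> FL lL r_gt0 r_le1 inl hr hLr; set p := (a, ev l a); set m := charline p.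
have L0 : 0 <= L by exact: le_trans FL.
have phipL : `|phi p| <= L by exact: le_trans FL.
have r2_ge0 : 0 <= r ^+ 2 by exact: sqr_ge0.
set C := 2 * K + K ^+ 2 + 2 * L.
have C0 : 0 <= C by rewrite /C; have := sqr_ge0 K; have := K0; lra.
have evl y : `|y - a| <= r ^+ 2 -> `|ev l y - p.2| <= L * r ^+ 2.
  move=> hy; have -> : ev l y - p.2 = l.2 * (y - a) by rewrite /p /ev /=; ring.
  by rewrite normrM ler_pM.
have evm y : `|y - a| <= r ^+ 2 -> `|ev m y - p.2| <= L * r ^+ 2.
  move=> hy; have -> : ev m y - p.2 = phi p * (y - a).
    by rewrite ev_charline /p /=; ring.
  by rewrite normrM ler_pM.
have near y t : `|y - a| <= r ^+ 2 -> `|t - p.2| <= L * r ^+ 2 ->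
    `|phi (y, t) - phi p| <= C * r.
  move=> hy ht; rewrite /C.
  apply: (phi_near K0 phiK) => //.
  - by apply: (box_near inl); rewrite /= ?subrr ?normr0 ltW.
  - by apply: (box_near inl) => /=; [exact: le_trans hy _|exact: le_trans ht _].
  - by rewrite mulr_ge0.
  - by apply: le_trans hy _; rewrite expr2 ler_piMl// ltW.
  - apply: le_trans (ler_normB _ _) _ => /=; rewrite mulr_natl mulr2n mulrDl lerD//.
    by rewrite normrM ler_pM.
have ab : `|a + r ^+ 2 - a| = r ^+ 2 by rewrite addrAC subrr add0r ger0_norm.
have betw y t : `|y - a| <= r ^+ 2 -> between (ev l y) (ev m y) t -> `|t - p.2| <= L * r ^+ 2.
  move=> hy; have := evl y hy; have := evm y hy; rewrite !ler_norml.
  by move=> ? ? []/andP[? ?]; lra.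
have aa : `|a - a| <= r ^+ 2 by rewrite subrr normr0.
have inab y : between a (a + r ^+ 2) y -> `|y - a| <= r ^+ 2.
  by move/between_add; rewrite (ger0_norm r2_ge0).
have hfl := @flux_galilean R phi cphi l m a (a + r ^+ 2) (phi p) (C * r).
apply: (le_trans (hfl _ _ _ _)).
- by move=> t ht; apply: near; [rewrite ab|apply: betw ht; rewrite ab].
- by move=> t ht; apply: near => //; apply: betw ht.
- by move=> y /inab hy; apply: near => //; exact: evl.
- by move=> y /inab hy; apply: near => //; exact: evm.
have -> : ev m a - ev l a = 0 by rewrite ev_charline /p /=; ring.
have -> : m.2 - phi p = 0 by rewrite /m /charline /= subrr.
rewrite normr0 mulr0 addr0 ab addr0.
have h1 : `|ev m (a + r ^+ 2) - ev l (a + r ^+ 2)| <= 2 * L * r ^+ 2.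
  have := evl (a + r ^+ 2); have := evm (a + r ^+ 2); rewrite ab => /(_ (lexx _)) + /(_ (lexx _)).
  by rewrite !ler_norml; lra.
have h2 : `|l.2 - phi p| <= 2 * L by apply: le_trans (ler_normB _ _) _; lra.
have Cr0 : 0 <= C * r by rewrite mulr_ge0// ltW.
have h3 : C * r * `|ev m (a + r ^+ 2) - ev l (a + r ^+ 2)| <= C * r * (2 * L * r ^+ 2).
  exact: ler_wpM2l.
have h4 : r ^+ 2 * ((C * r) ^+ 2 + `|l.2 - phi p| * (C * r)) <=
          r ^+ 2 * (C ^+ 2 * r + 2 * L * (C * r)).
  apply: ler_wpM2l => //; apply: lerD; last exact: ler_wpM2r.
  by rewrite exprMn ler_wpM2l ?sqr_ge0// expr2 ler_piMl// ltW.
apply: le_trans (lerD h3 h4) _; rewrite /cst_fan -/C.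
by rewrite le_eqVlt; apply/orP; left; apply/eqP; ring.
Qed.

Definition cst_near : R := 2 * K + K ^+ 2 + 1.
Definition cst_flux : R := 8 * cst_near ^+ 2 + 4 * cst_near.

Lemma cst_near_ge0 : 0 <= cst_near.
Proof. by rewrite /cst_near; have := sqr_ge0 K; have := K0; lra. Qed.

Lemma cst_flux_ge0 : 0 <= cst_flux.
Proof. by rewrite /cst_flux; have := sqr_ge0 cst_near; have := cst_near_ge0; lra. Qed.

(** At the intrinsic scale, width rho and height at most rho^2, both slopes are within O(rho) of the
    values of [phi] on the strip. Every term of [flux_galilean] is then O(rho^3), the area of a
    strip of full height; adding the terms with U = 2 C1 rho gives [cst_flux]. *)
Lemma flux_step (a t t' rho : R) : 0 < rho -> box ctr r0 (a, t) -> box ctr r0 (a, t') ->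
  rho <= r0 -> F * rho <= r0 -> `|t' - t| <= rho ^+ 2 ->
  `|flux phi (charline (a, t)) (charline (a, t')) a (a + rho)| <= cst_flux * rho ^+ 3.
Proof.
move=> rho0 int int' rho_r0 Frho htt'; set p := (a, t); set p' := (a, t').
set m := charline p; set m' := charline p'; set C1 := cst_near.
have C10 : 0 <= C1 by exact: cst_near_ge0.
have Dp q : box ctr r0 q -> box ctr (2 * r0) q.
  by move=> inq; apply: (box_near inq); rewrite subrr normr0 ltW.
have slopes : `|phi p' - phi p| <= C1 * rho.
  apply: (@phi_near _ _ _ _ K0 phiK p p' rho 1) => //; [exact: Dp|exact: Dp| |].
  - by rewrite /= subrr normr0 ltW.
  - by rewrite /= subrr mulr0 subr0 mul1r.
have bnd q y : `|y - a| <= rho -> `|phi q * (y - a)| <= F * rho.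
  by move=> hy; rewrite normrM ler_pM.
have dist y : `|y - a| <= rho -> `|ev m' y - ev m y| <= (1 + C1) * rho ^+ 2.
  move=> hy; have -> : ev m' y - ev m y = (t' - t) + (phi p' - phi p) * (y - a).
    by rewrite !ev_charline /p' /p /=; ring.
  apply: le_trans (ler_normD _ _) _; rewrite [leRHS]mulrDl mul1r lerD//.
  by rewrite expr2 mulrA normrM ler_pM.
have near y s : `|y - a| <= rho -> between (ev m y) (ev m' y) s ->
    `|phi (y, s) - phi p| <= (2 * C1) * rho.
  move=> hy hs.
  have -> : 2 * C1 = 2 * K + K ^+ 2 + (1 + C1) by rewrite /C1 /cst_near; ring.
  apply: (phi_near K0 phiK) => //; first exact: Dp.
  - have := bnd p _ hy; have := bnd p' _ hy; move: hs int int'.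
    rewrite !ev_charline /p /p' /box/= !ler_norml => hs [? ?] [? ?] ? ?.
    move: hy; rewrite ler_norml => hy.
    by split; case: hs => /andP[? ?]; lra.
  - by rewrite addr_ge0.
  - apply: le_trans (dist y hy).
    rewrite /= -/p; move: hs; rewrite [ev m y]ev_charline /p /=.
    set A := phi (a, t) * (y - a); case=> /andP[h1 h2].
      by rewrite !ger0_norm; lra.
    by rewrite !ler0_norm; lra.
have ab : `|a + rho - a| = rho by rewrite addrAC subrr add0r gtr0_norm.
have aa : `|a - a| <= rho by rewrite subrr normr0 ltW.
have inab y : between a (a + rho) y -> `|y - a| <= rho.
  by move/between_add; rewrite (gtr0_norm rho0).
have le_ev (x y : R) : between x y x by rewrite /between !lexx/=; case: (leP x y) => // h; [left|right; rewrite ltW].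
have le_ev' (x y : R) : between x y y by rewrite /between !lexx !andbT; case: (leP x y) => // h; [left|right; rewrite ltW].
have hfl := @flux_galilean R phi cphi m m' a (a + rho) (phi p) (2 * C1 * rho).
apply: (le_trans (hfl _ _ _ _)).
- by move=> s hs; apply: near; rewrite ?ab.
- by move=> s hs; apply: near.
- by move=> y /inab hy; apply: near.
- by move=> y /inab hy; apply: near.
have hb : `|ev m' (a + rho) - ev m (a + rho)| <= (1 + C1) * rho ^+ 2.
  by apply: dist; rewrite ab.
have ha : `|ev m' a - ev m a| <= rho ^+ 2.
  have -> : ev m' a - ev m a = t' - t by rewrite !ev_charline /p' /p /=; ring.
  by [].
have -> : m.2 - phi p = 0 by rewrite /m /charline /= subrr.
rewrite normr0 add0r ab.
have U0 : 0 <= 2 * C1 * rho by rewrite !mulr_ge0// ltW.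
have h1 := ler_wpM2l U0 hb; have h2 := ler_wpM2l U0 ha.
have h3 : rho * ((2 * C1 * rho) ^+ 2 + `|m'.2 - phi p| * (2 * C1 * rho)) <=
          rho * ((2 * C1 * rho) ^+ 2 + C1 * rho * (2 * C1 * rho)).
  by rewrite ler_wpM2l ?(ltW rho0)// lerD// ler_wpM2r.
apply: le_trans (lerD (lerD h1 h2) h3) _; rewrite /cst_flux -/C1.
by rewrite le_eqVlt; apply/orP; left; apply/eqP; ring.
Qed.

(** The left side is cut into equal slices of height at most rho^2, with a characteristic line at
    each cut; the extra rho^3 comes from rounding the number of slices up. *)
Lemma flux_chain (a t t' rho : R) : 0 < rho -> box ctr r0 (a, t) -> box ctr r0 (a, t') ->
  rho <= r0 -> F * rho <= r0 ->
  `|flux phi (charline (a, t)) (charline (a, t')) a (a + rho)| <=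
  cst_flux * (rho * `|t' - t| + rho ^+ 3).
Proof.
move=> rho0 int int' rho_r0 Frho.
have chain n : forall t', box ctr r0 (a, t') -> `|t' - t| <= n%:R * rho ^+ 2 ->
    `|flux phi (charline (a, t)) (charline (a, t')) a (a + rho)| <=
    n%:R * (cst_flux * rho ^+ 3).
  elim: n => [|n IHn] {int'}t' int' htt'.
    have -> : t' = t.
      by apply/eqP; rewrite -subr_eq0 -normr_le0; rewrite mul0r in htt'.
    have -> : flux phi (charline (a, t)) (charline (a, t)) a (a + rho) = 0.
      by rewrite /flux; ring.
    by rewrite normr0 mul0r.
  pose q := n%:R / n.+1%:R : R; pose s := t + (t' - t) * q.
  have n1 : 0 < n.+1%:R :> R by rewrite ltr0n.
  have q0 : 0 <= q by rewrite divr_ge0.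
  have q1 : q <= 1 by rewrite ler_pdivrMr// mul1r ler_nat.
  have ins : box ctr r0 (a, s).
    move: int int'; rewrite /box/= => -[h1 h2] [_ h3]; split=> //.
    have -> : s - ctr.2 = (t - ctr.2) * (1 - q) + (t' - ctr.2) * q by rewrite /s; ring.
    have -> : r0 = r0 * (1 - q) + r0 * q by ring.
    apply: le_trans (ler_normD _ _) _; rewrite normrM [X in _ + X]normrM.
    rewrite (ger0_norm q0) (@ger0_norm _ (1 - q)) ?subr_ge0//.
    by rewrite lerD// ler_wpM2r// subr_ge0.
  have hs : `|s - t| <= n%:R * rho ^+ 2.
    have -> : s - t = (t' - t) * q by rewrite /s; ring.
    rewrite normrM (ger0_norm q0) mulrA ler_pdivrMr//.
    have := ler_wpM2l (ler0n R n) htt'; lra.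
  have hs' : `|t' - s| <= rho ^+ 2.
    have -> : t' - s = (t' - t) / n.+1%:R.
      by rewrite /s /q; field; apply: lt0r_neq0; have := ler0n R n; lra.
    rewrite normrM (@ger0_norm _ n.+1%:R^-1) ?invr_ge0 ?ler0n//.
    by rewrite ler_pdivrMr// mulrC.
  rewrite (flux_catt _ _ (charline (a, s))).
  apply: le_trans (ler_normD _ _) _.
  rewrite -natr1 mulrDl mul1r lerD//; first exact: IHn.
  exact: flux_step.
have rho2 : 0 < rho ^+ 2 by exact: exprn_gt0.
pose n := Num.truncn (`|t' - t| / rho ^+ 2).
have hn1 : `|t' - t| / rho ^+ 2 < n.+1%:R by exact: truncnS_gt.
have hn : n%:R <= `|t' - t| / rho ^+ 2 by rewrite truncn_le// divr_ge0// ltW.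
apply: le_trans (chain n.+1 _ int' _) _.
  by rewrite -ler_pdivrMr// ltW.
rewrite mulrCA ler_wpM2l ?cst_flux_ge0// -natr1 mulrDl mul1r lerD2r.
have -> : rho ^+ 3 = rho * rho ^+ 2 by ring.
by rewrite mulrCA ler_wpM2l ?(ltW rho0)// -ler_pdivlMr.
Qed.

(** From [l] to its characteristic line, across to that of [l'], and back to [l']: two fans of width
    r^2 and a chain with rho = r^2. *)
Lemma flux_column l l' (a L r h : R) : F <= L -> `|l.2| <= L -> `|l'.2| <= L ->
  0 < r -> r <= 1 -> r ^+ 2 <= r0 -> L * r ^+ 2 <= r0 ->
  box ctr r0 (a, ev l a) -> box ctr r0 (a, ev l' a) -> `|ev l' a - ev l a| <= h ->
  `|flux phi l l' a (a + r ^+ 2)| <=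
     r ^+ 2 * (cst_flux * h + (cst_flux + 2 * cst_fan L) * r).
Proof.
move=> FL lL l'L r_gt0 r_le1 hr hLr inl inl' hh.
rewrite (flux_catt _ _ (charline (a, ev l' a))) (flux_catt _ _ (charline (a, ev l a))).
have e : flux phi (charline (a, ev l' a)) l' a (a + r ^+ 2) =
    - flux phi l' (charline (a, ev l' a)) a (a + r ^+ 2) by rewrite /flux; ring.
have h1 := flux_fan FL lL r_gt0 r_le1 inl hr hLr.
have h2 := flux_fan FL l'L r_gt0 r_le1 inl' hr hLr.
have r2 : 0 < r ^+ 2 by exact: exprn_gt0.
have h3 := flux_chain r2 inl inl' hr (le_trans (ler_wpM2r (ltW r2) FL) hLr).
have h4 : cst_flux * (r ^+ 2 * `|ev l' a - ev l a| + (r ^+ 2) ^+ 3) <=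
    cst_flux * (r ^+ 2 * h + r ^+ 3).
  rewrite ler_wpM2l ?cst_flux_ge0// lerD ?ler_wpM2l ?(ltW r2)//.
  by rewrite -exprM ler_wiXn2l// ltW.
apply: le_trans (ler_normD _ _) _; rewrite e normrN.
apply: le_trans (lerD (ler_normD _ _) (lexx _)) _.
apply: le_trans (lerD (lerD h1 (le_trans h3 h4)) h2) _.
by rewrite le_eqVlt; apply/orP; left; apply/eqP; ring.
Qed.

Lemma flux_columns l l' (a L r h : R) n : F <= L -> `|l.2| <= L -> `|l'.2| <= L ->
  0 < r -> r <= 1 -> r ^+ 2 <= r0 -> L * r ^+ 2 <= r0 ->
  (forall y, a <= y <= a + n%:R * r ^+ 2 ->
     [/\ box ctr r0 (y, ev l y), box ctr r0 (y, ev l' y) & `|ev l' y - ev l y| <= h]) ->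
  `|flux phi l l' a (a + n%:R * r ^+ 2)| <=
     n%:R * (r ^+ 2 * (cst_flux * h + (cst_flux + 2 * cst_fan L) * r)).
Proof.
move=> FL lL l'L r_gt0 r_le1 hr hLr.
have r2 : 0 < r ^+ 2 by exact: exprn_gt0.
elim: n => [|n IHn] hyp.
  by rewrite mul0r addr0 mul0r (_ : flux _ _ _ _ _ = 0) ?normr0// /flux; ring.
rewrite (flux_catx _ _ _ _ (a + n%:R * r ^+ 2)).
have nS : n.+1%:R * r ^+ 2 = n%:R * r ^+ 2 + r ^+ 2 by rewrite -natr1; ring.
have [|i1 i2 i3] := hyp (a + n%:R * r ^+ 2).
  by rewrite lerDl mulr_ge0 ?(ltW r2)//= lerD2l nS lerDl ltW.
apply: le_trans (ler_normD _ _) _.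
rewrite -[n.+1%:R in leRHS]natr1 mulrDl mul1r nS addrA; apply: lerD.
  apply: IHn => y /andP[y1 y2]; apply: hyp; rewrite y1 /=.
  by apply: le_trans y2 _; rewrite nS lerD2l lerDl ltW.
exact: flux_column.
Qed.

(** The slopes of the two lines enter only the O(r) error of [flux_columns], which vanishes as r
    tends to 0. What remains is a constant depending on K alone, whatever the lines. *)
Lemma flux_lipschitz l l' (a b h : R) : a <= b ->
  (forall y, a <= y <= b ->
     [/\ box ctr r0 (y, ev l y), box ctr r0 (y, ev l' y) & `|ev l' y - ev l y| <= h]) ->
  `|flux phi l l' a b| <= cst_flux * (b - a) * h.
Proof.
rewrite le_eqVlt => /predU1P[<- _|ab hyp].
  by rewrite subrr mulr0 mul0r (_ : flux _ _ _ _ _ = 0) ?normr0// /flux; ring.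
pose L := Num.max F (Num.max `|l.2| `|l'.2|).
have FL : F <= L by rewrite le_max lexx.
have lL : `|l.2| <= L by rewrite !le_max lexx orbT.
have l'L : `|l'.2| <= L by rewrite !le_max lexx !orbT.
have L0 : 0 <= L by exact: le_trans FL.
set C5 := cst_flux + 2 * cst_fan L.
have C50 : 0 <= C5.
  rewrite /C5 addr_ge0 ?cst_flux_ge0// mulr_ge0// /cst_fan addr_ge0 ?sqr_ge0//.
  by rewrite !mulr_ge0// !addr_ge0 ?sqr_ge0 ?mulr_ge0// ltW.
have ba0 : 0 < b - a by rewrite subr_gt0.
apply/ler_addgt0Pr => e e0.
pose u := e / ((b - a) * C5 + 1).
have den0 : 0 < (b - a) * C5 + 1 by rewrite ltr_wpDl// mulr_ge0// ltW.
have u0 : 0 < u by rewrite divr_gt0.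
pose w := Num.min (Num.min 1 u) (r0 / (L + 1)).
have w0 : 0 < w.
  by rewrite !lt_min ltr01 u0 /= divr_gt0// ltr_wpDl.
have w1 : w <= 1 by rewrite !ge_min lexx.
have wu : w <= u by rewrite !ge_min lexx orbT.
have wL : w <= r0 / (L + 1) by rewrite ge_min lexx orbT.
pose n := Num.truncn ((b - a) / w ^+ 2).
have w2 : 0 < w ^+ 2 by exact: exprn_gt0.
have hn : (b - a) / w ^+ 2 < n.+1%:R by exact: truncnS_gt.
(* With this r, not larger than the target [w], exactly [n.+1] columns of width r^2 fill [a, b]. *)
pose r := Num.sqrt ((b - a) / n.+1%:R).
have n1 : 0 < n.+1%:R :> R by rewrite ltr0n.
have r2 : r ^+ 2 = (b - a) / n.+1%:R by rewrite sqr_sqrtr// divr_ge0// ltW.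
have r_gt0 : 0 < r by rewrite sqrtr_gt0 divr_gt0.
have r2w : r ^+ 2 <= w ^+ 2.
  by rewrite r2 ler_pdivrMr// mulrC -ler_pdivrMr// ltW.
have rw : r <= w by rewrite -(@ler_pXn2r _ 2)// nnegrE ltW.
have w2w : w ^+ 2 <= w by rewrite expr2 ler_piMl// ltW.
have hwL : w * (L + 1) <= r0 by rewrite -ler_pdivlMr// ltr_wpDl.
have nr2 : n.+1%:R * r ^+ 2 = b - a by rewrite r2 mulrC divfK// gt_eqF.
have := @flux_columns l l' a L r h n.+1 FL lL l'L r_gt0 (le_trans rw w1).
have abr : a + n.+1%:R * r ^+ 2 = b by rewrite nr2; ring.
rewrite abr mulrA nr2 => H.
have L1 : 0 <= L * r ^+ 2 by rewrite mulr_ge0// sqr_ge0.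
have L2 : 0 <= L * w by rewrite mulr_ge0// ltW.
have L3 : L * r ^+ 2 <= L * w by rewrite ler_wpM2l// (le_trans r2w).
apply: le_trans (H _ _ hyp) _; [lra|lra|].
have hr : (b - a) * C5 * r <= e.
  apply: le_trans (_ : ((b - a) * C5 + 1) * u <= e); last first.
    by rewrite mulrC divfK// gt_eqF.
  apply: ler_pM; rewrite ?(ltW r_gt0)//; last exact: le_trans wu.
  - by rewrite mulr_ge0// ltW.
  - by rewrite lerDl.
by rewrite -/C5; lra.
Qed.

End flux_lipschitz.

(** * Strips and grids *)

Section grid.
Variable R : realType.
Variables (A0 B0 S : R).
Hypothesis S_gt0 : 0 < S.

Definition in_square (y t : R) : Prop := A0 <= y <= A0 + S /\ B0 <= t <= B0 + S.

(** Abstracted from the flux, because the approximation by grid cells is applied to the flux minus a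
    multiple of the area. *)
Definition lipschitz_functional (C : R) (T : line R -> line R -> R -> R -> R) : Prop :=
  [/\ forall l l' a b c, T l l' a c = T l l' a b + T l l' b c,
      forall l l' l'' a b, T l l'' a b = T l l' a b + T l' l'' a b &
      forall l l' a b h, a <= b ->
        (forall y, a <= y <= b ->
          [/\ in_square y (ev l y), in_square y (ev l' y) & `|ev l' y - ev l y| <= h]) ->
        `|T l l' a b| <= C * (b - a) * h].

Definition grid_x (n j : nat) : R := A0 + j%:R * (S / n%:R).
Definition grid_t (n k : nat) : R := B0 + k%:R * (S / n%:R).

Definition grid_cell (T : line R -> line R -> R -> R -> R) (n j k : nat) : R :=
  T (hline (grid_t n k)) (hline (grid_t n k.+1)) (grid_x n j) (grid_x n j.+1).

(** Containment of the square with lower left corner (x, t) and side d; its corners decide, as the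
    strip is bounded by straight lines. *)
Definition in_strip (l : line R) (h a b x t d : R) : bool :=
  [&& a <= x, x + d <= b, ev l x <= t, ev l (x + d) <= t,
      t + d <= ev l x + h & t + d <= ev l (x + d) + h].

Lemma grid_xS n j : grid_x n j.+1 = grid_x n j + S / n%:R.
Proof. by rewrite /grid_x -natr1; ring. Qed.

Lemma grid_tS n j : grid_t n j.+1 = grid_t n j + S / n%:R.
Proof. by rewrite /grid_t -natr1; ring. Qed.

Lemma ev_itv (l : line R) (x y d : R) : x <= y <= x + d ->
  Num.min (ev l x) (ev l (x + d)) <= ev l y <= Num.max (ev l x) (ev l (x + d)).
Proof.
move=> /andP[xy yd]; rewrite ge_min le_max /ev.
have [l0|l0] := leP 0 l.2.
  by rewrite !lerD2l (ler_wpM2l l0 xy) (ler_wpM2l l0 yd) orbT.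
rewrite !lerD2l !(ler_nM2l l0) xy yd.
by rewrite orbT.
Qed.

(** Between the first grid row [k0] above [l] and the last row [k1] below the upper line, T is a sum
    of full cells. Each of the two slanted remainders has height at most (1 + |slope|) d, which is
    the error term. *)
Lemma column_approx C T (n : nat) l h (x : R) : lipschitz_functional C T ->
  0 <= C -> (0 < n)%N -> 0 <= h ->
  A0 <= x -> x + S / n%:R <= A0 + S ->
  (forall y, x <= y <= x + S / n%:R -> B0 <= ev l y /\ ev l y + h <= B0 + S) ->
  `|T l (shift l h) x (x + S / n%:R)| <=
    \sum_(0 <= k < n | in_strip l h x (x + S / n%:R) x (grid_t n k) (S / n%:R))
      `|T (hline (grid_t n k)) (hline (grid_t n k.+1)) x (x + S / n%:R)|
    + 2 * C * (1 + `|l.2|) * (S / n%:R) ^+ 2.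
Proof.
move=> [Tx Tt TC] C0 n0 h0; set d := S / n%:R => hx hx' hl.
have n1 : 0 < n%:R :> R by rewrite ltr0n.
have d0 : 0 < d by rewrite divr_gt0.
have nd : n%:R * d = S by rewrite /d mulrC divfK// gt_eqF.
set mi := Num.min (ev l x) (ev l (x + d)); set ma := Num.max (ev l x) (ev l (x + d)).
have lx := hl x; have lx' := hl (x + d).
rewrite !lexx !lerDl (ltW d0) /= in lx lx'.
have {lx} [lx1 lx2] := lx isT; have {lx'} [lx1' lx2'] := lx' isT.
have miB : B0 <= mi by rewrite le_min lx1.
have maS : ma + h <= B0 + S by rewrite -lerBrDr ge_max !lerBrDr lx2.
have mima : ma <= mi + `|l.2| * d.
  have e : ev l (x + d) = ev l x + l.2 * d by rewrite /ev; ring.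
  have : `|l.2 * d| = `|l.2| * d by rewrite normrM (gtr0_norm d0).
  have := ler_norm (l.2 * d); have := ler_norm (- (l.2 * d)); rewrite normrN.
  rewrite /ma /mi e; case: (leP (ev l x) (ev l x + l.2 * d)); lra.
have mimale : mi <= ma by rewrite /mi /ma ge_min le_max lexx.
have inl y : x <= y <= x + d -> mi <= ev l y <= ma by exact: ev_itv.
have d2 : d ^+ 2 = d * d by rewrite expr2.
pose k0 := (Num.truncn ((ma - B0) / d)).+1; pose k1 := Num.truncn ((mi + h - B0) / d).
have k0a : ma < grid_t n k0.
  have := truncnS_gt ((ma - B0) / d); rewrite ltr_pdivrMr// -/k0 /grid_t -/d; lra.
have k0b : grid_t n k0 <= ma + d.
  have : (Num.truncn ((ma - B0) / d))%:R <= (ma - B0) / d.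
    by rewrite truncn_le// divr_ge0 ?(ltW d0)// subr_ge0 (le_trans miB).
  by rewrite ler_pdivlMr// /grid_t /k0 -/d -natr1; lra.
have k1a : grid_t n k1 <= mi + h.
  have : k1%:R <= (mi + h - B0) / d.
    by rewrite truncn_le// divr_ge0 ?(ltW d0)// subr_ge0; lra.
  by rewrite ler_pdivlMr// /grid_t -/d; lra.
have k1b : mi + h < grid_t n k1 + d.
  have := truncnS_gt ((mi + h - B0) / d); rewrite -/k1 ltr_pdivrMr// /grid_t -/d -natr1; lra.
have TCd l1 l2 hh : (forall y, x <= y <= x + d ->
     [/\ in_square y (ev l1 y), in_square y (ev l2 y) & `|ev l2 y - ev l1 y| <= hh]) ->
    `|T l1 l2 x (x + d)| <= C * d * hh.
  move=> H; have := TC l1 l2 x (x + d) hh _ H; rewrite addrAC subrr add0r.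
  by apply; rewrite lerDl ltW.
set sm := \sum_(0 <= k < n | _) _.
have sm0 : 0 <= sm by rewrite sumr_ge0.
have l20 : 0 <= `|l.2| by [].
have insq y t : x <= y <= x + d -> B0 <= t <= B0 + S -> in_square y t.
  move=> /andP[y1 y2] ?; split=> //.
  by move: hx hx' y1 y2; clear=> *; apply/andP; split; lra.
(* If k1 < k0 the whole strip has height at most (1 + |slope|) d and is itself an error term. *)
have [k01|k10] := leqP k0 k1; last first.
  have hd : h <= (1 + `|l.2|) * d.
    have : grid_t n k1.+1 <= grid_t n k0 by rewrite /grid_t -/d lerD2l ler_wpM2r ?(ltW d0)// ler_nat.
    by rewrite grid_tS -/d; lra.
  apply: le_trans (_ : C * d * h <= _).
    apply: TCd => y hy.
    have /andP[y1 y2] := inl y hy.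
    rewrite ev_shift [X in `|X|]addrC addKr (ger0_norm h0).
    by split=> //; apply: insq => //; move: y1 y2 miB maS h0; clear=> *; apply/andP; split; lra.
  have Cd : 0 <= C * d by rewrite mulr_ge0// ltW.
  have := ler_wpM2l Cd hd.
  have : 0 <= C * d * ((1 + `|l.2|) * d) by apply: mulr_ge0 => //; apply: mulr_ge0; [exact: addr_ge0|exact: ltW].
  by rewrite d2; move: sm0; clear=> *; lra.
rewrite (Tt _ (hline (grid_t n k0))) (Tt (hline (grid_t n k0)) (hline (grid_t n k1))).
have T0 l1 : T l1 l1 x (x + d) = 0.
  by have := Tt l1 l1 l1 x (x + d) => /eqP; rewrite -subr_eq0 opprD addNKr oppr_eq0 => /eqP.
have tele k : (k0 <= k)%N -> T (hline (grid_t n k0)) (hline (grid_t n k)) x (x + d) =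
   \sum_(k0 <= i < k) T (hline (grid_t n i)) (hline (grid_t n i.+1)) x (x + d).
  elim: k => [|k IHk]; first by rewrite leqn0.
  rewrite leq_eqVlt => /predU1P[<-|k0k]; first by rewrite big_geq.
  by rewrite big_nat_recr//= -IHk// -Tt.
have gtle i j : (i <= j)%N -> grid_t n i <= grid_t n j.
  by move=> ij; rewrite /grid_t -/d lerD2l ler_wpM2r ?(ltW d0)// ler_nat.
have k0k1 := gtle _ _ k01.
have k1n : (k1 <= n)%N.
  rewrite -(ler_nat R) -(ler_pM2r d0) nd; move: k1a; rewrite /grid_t -/d; lra.
have b1 : `|T l (hline (grid_t n k0)) x (x + d)| <= C * d * ((1 + `|l.2|) * d).
  apply: TCd => y hy; have /andP[y1 y2] := inl y hy; rewrite ev_hline.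
  split; [apply: insq => //; move: y1 y2 miB maS h0 k0a k1a k0k1 mimale; clear=> *;
    apply/andP; split; lra..|].
  by move: y1 y2 k0a k0b mima; clear=> *; rewrite ger0_norm; lra.
have b2 : `|T (hline (grid_t n k1)) (shift l h) x (x + d)| <= C * d * ((1 + `|l.2|) * d).
  apply: TCd => y hy; have /andP[y1 y2] := inl y hy; rewrite ev_hline ev_shift.
  split; [apply: insq => //; move: y1 y2 miB maS h0 k0a k1a k0k1 mimale; clear=> *;
    apply/andP; split; lra..|].
  by move: y1 y2 k1a k1b mima; clear=> *; rewrite ger0_norm; lra.
have b3 : `|T (hline (grid_t n k0)) (hline (grid_t n k1)) x (x + d)| <= sm.
  rewrite tele//; apply: (le_trans (ler_norm_sum _ _ _)).
  rewrite /sm [leRHS](@big_cat_nat _ _ _ k0) ?(leq_trans k01 k1n)//=.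
  rewrite [X in _ <= _ + X](@big_cat_nat _ _ _ k1)//=.
  rewrite addrCA -[leLHS]addr0; apply: lerD; last first.
    by rewrite addr_ge0// sumr_ge0.
  rewrite big_nat [leRHS]big_nat_cond.
  rewrite le_eqVlt; apply/orP; left; apply/eqP; apply: eq_bigl => k.
  case: (boolP (k0 <= k < k1)%N) => //= /andP[kk0 kk1].
  have g1 := gtle _ _ kk0; have := gtle _ _ kk1; rewrite grid_tS -/d => g2.
  apply/esym; rewrite /in_strip !lexx /=.
  have /andP[? x2] : mi <= ev l x <= ma by apply: inl; rewrite lexx lerDl ltW.
  have /andP[? x3] : mi <= ev l (x + d) <= ma by apply: inl; rewrite lexx lerDl ltW.
  by apply/and4P; split; lra.
apply: le_trans (ler_normD _ _) _.
apply: le_trans (lerD (lexx _) (ler_normD _ _)) _.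
by rewrite d2; move: b1 b2 b3; clear=> *; lra.
Qed.

Lemma indicator_mono (a x y : R) : x <= y ->
  0 <= (a < y)%R%:R - (a < x)%R%:R :> R.
Proof.
move=> xy; have [ax|_] := ltP a x; last by rewrite subr0 ler0n.
by rewrite (lt_le_trans ax xy) subrr.
Qed.

(** Full columns are handled by [column_approx]. Only the columns containing a and b are incomplete,
    and each of them costs at most C d h. *)
Lemma strip_approx C T (n : nat) l h (a b : R) : lipschitz_functional C T ->
  0 <= C -> (0 < n)%N -> 0 <= h -> A0 <= a -> a <= b -> b <= A0 + S ->
  (forall y, a <= y <= b -> B0 <= ev l y /\ ev l y + h <= B0 + S) ->
  `|T l (shift l h) a b| <=
    \sum_(0 <= j < n) \sum_(0 <= k < n | in_strip l h a b (grid_x n j) (grid_t n k) (S / n%:R))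
      `|grid_cell T n j k|
    + (2 * C * (1 + `|l.2|) * S + 2 * C * h) * (S / n%:R).
Proof.
move=> LT C0 n0 h0; set d := S / n%:R => hA ab hB hl.
have [Tx Tt TC] := LT.
have n1 : 0 < n%:R :> R by rewrite ltr0n.
have d0 : 0 < d by rewrite divr_gt0.
have nd : n%:R * d = S by rewrite /d mulrC divfK// gt_eqF.
pose c j := Num.max a (Num.min b (grid_x n j)).
have cmin j : a <= c j by rewrite /c le_max lexx.
have cmax j : c j <= b by rewrite /c ge_max ab ge_min lexx.
have gxd j : grid_x n j.+1 = grid_x n j + d by rewrite grid_xS.
have cle j : c j <= c j.+1.
  rewrite /c ge_max le_max lexx /= le_max le_min !ge_min lexx /=.
  by rewrite gxd lerDl (ltW d0) !orbT.
have cd j : c j.+1 <= c j + d.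
  rewrite /c gxd ge_max; apply/andP; split.
    by rewrite -[leLHS]addr0 lerD ?le_max ?lexx// ltW.
  apply: le_trans (_ : Num.min b (grid_x n j) + d <= _); last by rewrite lerD2r le_max lexx orbT.
  by rewrite addr_minl le_min !ge_min lexx orbT lerDl (ltW d0).
(* The increments of [ia] and [ib] mark the columns containing a and b; their sums over j telescope
   to at most 1 each. *)
pose ia j : R := (a < grid_x n j)%R%:R; pose ib j : R := (b < grid_x n j)%R%:R.
have ia0 j : 0 <= ia j.+1 - ia j by apply: indicator_mono; rewrite gxd lerDl ltW.
have ib0 j : 0 <= ib j.+1 - ib j by apply: indicator_mono; rewrite gxd lerDl ltW.
pose e j := 2 * C * (1 + `|l.2|) * d ^+ 2 +
            C * d * h * ((ia j.+1 - ia j) + (ib j.+1 - ib j)).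
have e0 : 0 <= 2 * C * (1 + `|l.2|) * d ^+ 2.
  by rewrite mulr_ge0 ?sqr_ge0// mulr_ge0 ?addr_ge0// mulr_ge0.
have col j : (j < n)%N -> `|T l (shift l h) (c j) (c j.+1)| <=
    \sum_(0 <= k < n | in_strip l h a b (grid_x n j) (grid_t n k) d) `|grid_cell T n j k| + e j.
  move=> jn.
  have hjA : A0 <= grid_x n j by rewrite /grid_x lerDl mulr_ge0// ltW.
  have hjB : grid_x n j + d <= A0 + S.
    by rewrite -gxd /grid_x lerD2l -/d -nd ler_wpM2r ?(ltW d0)// ler_nat.
  have [/andP[aj jb]|nfull] := boolP ((a <= grid_x n j) && (grid_x n j + d <= b)).
    have jb' : grid_x n j <= b by apply: le_trans jb; rewrite lerDl ltW.
    have aj' : a <= grid_x n j + d by apply: le_trans aj _; rewrite lerDl ltW.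
    have -> : c j = grid_x n j by rewrite /c (min_idPr jb') (max_idPr aj).
    have -> : c j.+1 = grid_x n j + d by rewrite /c gxd (min_idPr jb) (max_idPr aj').
    have := column_approx (x := grid_x n j) (l := l) LT C0 n0 h0 hjA hjB.
    rewrite -/d => /(_ _)/le_trans; apply.
      move=> y /andP[y1 y2]; apply: hl.
      by rewrite (le_trans aj y1) (le_trans y2 jb).
    apply: lerD; last first.
      by rewrite /e lerDl; apply: mulr_ge0; [apply: mulr_ge0 => //; apply: mulr_ge0 => //; exact: ltW|exact: addr_ge0].
    rewrite le_eqVlt; apply/orP; left; apply/eqP; rewrite /grid_cell gxd.
    by apply: eq_bigl => k; rewrite /in_strip aj jb !lexx.
  apply: le_trans (_ : e j <= _); last by rewrite lerDr sumr_ge0.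
  have hc : c j.+1 - c j <= d * ((ia j.+1 - ia j) + (ib j.+1 - ib j)).
    have out : c j = c j.+1 -> c j.+1 - c j <= d * ((ia j.+1 - ia j) + (ib j.+1 - ib j)).
      by move=> <-; rewrite subrr; apply: mulr_ge0; [exact: ltW|exact: addr_ge0].
    have jump : 1 <= (ia j.+1 - ia j) + (ib j.+1 - ib j) ->
        c j.+1 - c j <= d * ((ia j.+1 - ia j) + (ib j.+1 - ib j)).
      by move=> h1; rewrite lerBlDl (le_trans (cd j))// lerD2l ler_peMr// ltW.
    move: nfull; rewrite negb_and -!ltNge => /orP[xa|bx].
      have [ax|xa'] := ltP a (grid_x n j + d).
        apply: jump; rewrite -[leLHS]addr0 lerD//.
        by rewrite /ia gxd ax ltNge (ltW xa) subr0.
      apply: out; rewrite /c gxd !(@max_idPl _ _ a _ _)// ge_min ?(ltW xa) ?xa' orbT//.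
    have [bx'|xb] := ltP b (grid_x n j).
      by apply: out; rewrite /c gxd (min_idPl (ltW bx)) (min_idPl (ltW bx')).
    apply: jump; rewrite -[leLHS]add0r lerD//.
    by rewrite /ib gxd bx ltNge xb subr0.
  apply: le_trans (_ : C * (c j.+1 - c j) * h <= _).
    apply: TC => // y /andP[y1 y2].
    have yab : a <= y <= b by rewrite (le_trans (cmin j) y1) (le_trans y2 (cmax _)).
    have [l1 l2] := hl y yab; move/andP: yab => [ya yb].
    rewrite ev_shift [X in `|X|]addrC addKr (ger0_norm h0).
    by move: l1 l2 ya yb hA hB h0; clear=> *; split=> //; split; apply/andP; split; lra.
  by have := ler_wpM2r h0 (ler_wpM2l C0 hc); rewrite /e; move: e0; clear=> *; lra.
have tele m : T l (shift l h) (c 0%N) (c m) = \sum_(0 <= j < m) T l (shift l h) (c j) (c j.+1).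
  elim: m => [|m IHm]; last by rewrite big_nat_recr//= -IHm -Tx.
  rewrite big_geq//; have := Tx l (shift l h) (c 0%N) (c 0%N) (c 0%N) => /eqP.
  by rewrite -subr_eq0 opprD addNKr oppr_eq0 => /eqP.
have ca : c 0%N = a.
  by rewrite /c /grid_x mul0r addr0; apply/max_idPl; rewrite ge_min hA orbT.
have cb : c n = b.
  rewrite /c /grid_x -/d nd; have /min_idPl -> := hB; exact/max_idPr.
rewrite -{1}ca -{1}cb tele; apply: (le_trans (ler_norm_sum _ _ _)).
apply: (@le_trans _ _ (\sum_(0 <= j < n)
  (\sum_(0 <= k < n | in_strip l h a b (grid_x n j) (grid_t n k) d) `|grid_cell T n j k| + e j))).
  by rewrite big_nat [leRHS]big_nat; apply: ler_sum => j /andP[_ jn]; exact: col.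
rewrite big_split/= lerD2l.
have -> : \sum_(0 <= j < n) e j = \sum_(0 <= j < n) (2 * C * (1 + `|l.2|) * d ^+ 2) +
    C * d * h * (\sum_(0 <= j < n) (ia j.+1 - ia j) + \sum_(0 <= j < n) (ib j.+1 - ib j)).
  by rewrite -big_split/= mulr_sumr -big_split.
rewrite !telescope_sumr//.
rewrite sumr_const_nat subn0 -[X in X + _]mulr_natl.
have iale : ia n - ia 0%N <= 1.
  by rewrite /ia; clear; do 2 case: (_ < _) => /=; lra.
have ible : ib n - ib 0%N <= 1.
  by rewrite /ib; clear; do 2 case: (_ < _) => /=; lra.
have Cdh : 0 <= C * d * h by apply: mulr_ge0 => //; apply: mulr_ge0 => //; exact: ltW.
have := ler_wpM2l Cdh (lerD iale ible).
have -> : n%:R * (2 * C * (1 + `|l.2|) * d ^+ 2) = 2 * C * (1 + `|l.2|) * S * d.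
  by rewrite -nd; ring.
lra.
Qed.

End grid.

(** * The energy of a grid *)

Section sums.
Variable R : realType.

Lemma sum_block (n q : nat) (f : nat -> R) :
  \sum_(0 <= j < n * q) f j = \sum_(0 <= i < n) \sum_(0 <= j < q) f (i * q + j)%N.
Proof.
elim: n => [|n IHn]; first by rewrite mul0n !big_geq.
rewrite big_nat_recr//= -IHn mulSn addnC (@big_cat_nat _ _ _ (n * q)%N) ?leq_addr//=.
congr (_ + _); rewrite -{1}[(n * q)%N]add0n big_addn addKn.
by apply: eq_bigr => i _; rewrite addnC.
Qed.

Lemma sum_block2 (n q : nat) (f : nat -> nat -> R) :
  \sum_(0 <= j < n * q) \sum_(0 <= k < n * q) f j k =
  \sum_(0 <= i < n) \sum_(0 <= l < n)
    \sum_(0 <= j < q) \sum_(0 <= k < q) f (i * q + j)%N (l * q + k)%N.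
Proof.
rewrite sum_block; apply: eq_bigr => i _.
under eq_bigr do rewrite sum_block.
by rewrite exchange_big.
Qed.

(** The variance identity, X / q^2 being the mean of the q^2 entries. *)
Lemma sum_sqr_dev (q : nat) (f : nat -> nat -> R) : (0 < q)%N ->
  let X := \sum_(0 <= j < q) \sum_(0 <= k < q) f j k in
  \sum_(0 <= j < q) \sum_(0 <= k < q) (f j k - X / q%:R ^+ 2) ^+ 2 =
  \sum_(0 <= j < q) \sum_(0 <= k < q) f j k ^+ 2 - X ^+ 2 / q%:R ^+ 2.
Proof.
move=> q0 X; have q1 : q%:R != 0 :> R by rewrite pnatr_eq0 -lt0n.
set m := X / _.
have -> : \sum_(0 <= j < q) \sum_(0 <= k < q) (f j k - m) ^+ 2 =
    \sum_(0 <= j < q) \sum_(0 <= k < q) f j k ^+ 2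
    - (2 * m) * X + \sum_(0 <= j < q) \sum_(0 <= k < q) m ^+ 2.
  rewrite /X mulr_sumr -sumrB -big_split; apply: eq_bigr => j _ /=.
  rewrite mulr_sumr -sumrB -big_split; apply: eq_bigr => k _ /=; ring.
rewrite !sumr_const_nat subn0 -[_ *+ q *+ q]mulr_natl -[_ *+ q]mulr_natl.
by rewrite /m; field.
Qed.

Lemma sum_le_unique (I : eqType) (D : seq I) (P : pred I) (y : R) : uniq D -> 0 <= y ->
  (forall i j, i \in D -> j \in D -> P i -> P j -> i = j) ->
  \sum_(i <- D | P i) y <= y.
Proof.
move=> uD y0 uP; rewrite big_const_seq iter_addr_0.
suff : (count P D <= 1)%N by case: (count P D) => [|[|//]] _; rewrite ?mulr0n ?mulr1n.
rewrite -size_filter.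
have : uniq (seq.filter P D) by exact: filter_uniq.
have : {in seq.filter P D &, forall i j, i = j}.
  by move=> i j; rewrite !mem_filter => /andP[? ?] /andP[? ?]; exact: uP.
case: (seq.filter P D) => [|i [|j s]]//= H /andP[].
by rewrite (H i j) ?inE ?eqxx ?orbT.
Qed.

End sums.

Section energy.
Variable R : realType.
Variables (A0 B0 S C : R) (T : line R -> line R -> R -> R -> R).
Hypothesis S_gt0 : 0 < S.
Hypothesis C0 : 0 <= C.
Hypothesis LT : lipschitz_functional A0 B0 S C T.

Local Notation gx := (grid_x A0 S).
Local Notation gt := (grid_t B0 S).
Local Notation cell := (grid_cell A0 B0 S T).

Lemma functional_sumx l l' (x : nat -> R) m :
  T l l' (x 0%N) (x m) = \sum_(0 <= j < m) T l l' (x j) (x j.+1).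
Proof.
have [Tx _ _] := LT.
elim: m => [|m IHm]; last by rewrite big_nat_recr//= -IHm -Tx.
rewrite big_geq//; have := Tx l l' (x 0%N) (x 0%N) (x 0%N) => /eqP.
by rewrite -subr_eq0 opprD addNKr oppr_eq0 => /eqP.
Qed.

Lemma functional_sumt (t : nat -> line R) m a b :
  T (t 0%N) (t m) a b = \sum_(0 <= j < m) T (t j) (t j.+1) a b.
Proof.
have [_ Tt _] := LT.
elim: m => [|m IHm]; last by rewrite big_nat_recr//= -IHm -Tt.
rewrite big_geq//; have := Tt (t 0%N) (t 0%N) (t 0%N) a b => /eqP.
by rewrite -subr_eq0 opprD addNKr oppr_eq0 => /eqP.
Qed.

Lemma gx_refine n q j : (0 < q)%N -> gx (n * q) (j * q) = gx n j.
Proof.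
move=> q0; rewrite /grid_x; congr (_ + _); rewrite !natrM invfM.
rewrite -mulrA [q%:R * _]mulrC -!mulrA mulVf ?mulr1//.
by rewrite pnatr_eq0 -lt0n.
Qed.

Lemma gt_refine n q j : (0 < q)%N -> gt (n * q) (j * q) = gt n j.
Proof.
move=> q0; rewrite /grid_t; congr (_ + _); rewrite !natrM invfM.
rewrite -mulrA [q%:R * _]mulrC -!mulrA mulVf ?mulr1//.
by rewrite pnatr_eq0 -lt0n.
Qed.

Lemma cell_refine n q j k : (0 < q)%N ->
  cell n j k = \sum_(0 <= i < q) \sum_(0 <= l < q) cell (n * q) (j * q + i) (k * q + l).
Proof.
move=> q0; rewrite /grid_cell.
rewrite -(gx_refine n j q0) -(gx_refine n j.+1 q0) -(gt_refine n k q0) -(gt_refine n k.+1 q0).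
have := functional_sumx (hline (gt (n * q) (k * q))) (hline (gt (n * q) (k.+1 * q)))
   (fun i => gx (n * q) (j * q + i)) q.
rewrite addn0 [(j * q + q)%N]addnC -mulSn => ->.
apply: eq_bigr => i _; rewrite addnS.
have := functional_sumt (fun l => hline (gt (n * q) (k * q + l))) q.
rewrite addn0 [(k * q + q)%N]addnC -mulSn => ->.
by apply: eq_bigr => l _; rewrite addnS.
Qed.

Lemma cell_bound n j k : (j < n)%N -> (k < n)%N -> `|cell n j k| <= C * (S / n%:R) ^+ 2.
Proof.
move=> jn kn; have n0 : (0 < n)%N by exact: leq_ltn_trans jn.
have n1 : 0 < n%:R :> R by rewrite ltr0n.
have d0 : 0 < S / n%:R by rewrite divr_gt0.
have nd : n%:R * (S / n%:R) = S by rewrite mulrC divfK// gt_eqF.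
have bnd i : (i <= n)%N -> 0 <= i%:R * (S / n%:R) <= S.
  move=> i_n; rewrite mulr_ge0 ?(ltW d0)//= -[leRHS]nd.
  by rewrite ler_wpM2r ?(ltW d0)// ler_nat.
have [_ _ TC] := LT; rewrite /grid_cell grid_xS.
set d := S / n%:R in d0 nd bnd *.
have -> : C * d ^+ 2 = C * (gx n j + d - gx n j) * d by ring.
apply: TC => [|y /andP[y1 y2]]; first by rewrite lerDl ltW.
have /andP[] := bnd _ (ltnW jn); have /andP[] := bnd _ jn.
have /andP[] := bnd _ (ltnW kn); have /andP[] := bnd _ kn.
move: y1 y2; rewrite !ev_hline /in_square /grid_x /grid_t -/d -!natr1 => *.
split; [by split; apply/andP; split; lra..|].
by rewrite ler_norml; apply/andP; split; lra.
Qed.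

Definition grid_energy (n : nat) : R :=
  n%:R ^+ 2 / S ^+ 2 * \sum_(0 <= j < n) \sum_(0 <= k < n) cell n j k ^+ 2.

Lemma energy_le n : (0 < n)%N -> grid_energy n <= C ^+ 2 * S ^+ 2.
Proof.
move=> n0; have n1 : 0 < n%:R :> R by rewrite ltr0n.
have S2 : 0 < S ^+ 2 by exact: exprn_gt0.
apply: le_trans (_ : n%:R ^+ 2 / S ^+ 2 *
  \sum_(0 <= j < n) \sum_(0 <= k < n) (C * (S / n%:R) ^+ 2) ^+ 2 <= _).
  rewrite /grid_energy ler_wpM2l ?divr_ge0 ?sqr_ge0//.
  rewrite big_nat [leRHS]big_nat; apply: ler_sum => j /andP[_ jn].
  rewrite big_nat [leRHS]big_nat; apply: ler_sum => k /andP[_ kn].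
  rewrite -real_normK ?num_real// lerXn2r ?nnegrE//; last exact: cell_bound.
  by rewrite mulr_ge0 ?sqr_ge0.
rewrite !sumr_const_nat subn0 -[_ *+ n *+ n]mulr_natl -[_ *+ n]mulr_natl.
rewrite le_eqVlt; apply/orP; left; apply/eqP; field.
by rewrite !gt_eqF.
Qed.

Definition fluct (n q J K : nat) : R :=
  cell (n * q) J K - cell n (J %/ q) (K %/ q) / q%:R ^+ 2.

(** Pythagoras, as for L^2 martingales: by additivity the mean of the fine cell values inside a
    coarse cell is its value over q^2, so refining adds exactly the squared deviations from these
    means. *)
Lemma energy_refine n q : (0 < n)%N -> (0 < q)%N ->
  grid_energy (n * q) - grid_energy n = (n * q)%:R ^+ 2 / S ^+ 2 *
    \sum_(0 <= J < n * q) \sum_(0 <= K < n * q) fluct n q J K ^+ 2.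
Proof.
move=> n0 q0.
have q1 : q%:R != 0 :> R by rewrite pnatr_eq0 -lt0n.
have -> : grid_energy n = (n * q)%:R ^+ 2 / S ^+ 2 *
    \sum_(0 <= j < n) \sum_(0 <= k < n) (cell n j k ^+ 2 / q%:R ^+ 2).
  rewrite /grid_energy natrM.
  under [X in _ = _ * X]eq_bigr do rewrite -mulr_suml.
  rewrite -mulr_suml; field.
  by rewrite q1 gt_eqF.
rewrite /grid_energy -mulrBr; congr (_ * _); rewrite !sum_block2 -sumrB.
apply: eq_bigr => j _; rewrite -sumrB; apply: eq_bigr => k _.
have /= := @sum_sqr_dev R q (fun i l => cell (n * q) (j * q + i) (k * q + l)) q0.
rewrite -cell_refine// => <-.
rewrite big_nat [RHS]big_nat; apply: eq_bigr => i /andP[_ iq].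
rewrite big_nat [RHS]big_nat; apply: eq_bigr => l /andP[_ lq].
by rewrite /fluct !divnMDl// !divn_small// !addn0.
Qed.

(** The supremum is taken over all grids at once, so every refinement of the chosen grid is itself a
    competitor. *)
Lemma exists_energy_almost_max (eta : R) : 0 < eta ->
  exists2 n, (0 < n)%N & forall q, (0 < q)%N -> grid_energy (n * q) - grid_energy n <= eta.
Proof.
move=> eta0.
pose E := [set grid_energy n | n in [set n | (0 < n)%N]].
have hE : has_sup E.
  split; first by exists (grid_energy 1), 1%N.
  by exists (C ^+ 2 * S ^+ 2) => _ [n n0 <-]; exact: energy_le.
have [_ [n n0 <-] hn] := sup_adherent eta0 hE.
exists n => // q q0; rewrite lerBlDr -lerBlDl; apply: le_trans (ltW hn).
rewrite lerB//; apply: sup_upper_bound => //.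
by exists (n * q)%N => //=; rewrite muln_gt0 n0.
Qed.

Lemma sum_fluct_le (eta : R) n q : 0 < eta -> (0 < n)%N -> (0 < q)%N ->
  grid_energy (n * q) - grid_energy n <= eta ^+ 2 ->
  \sum_(0 <= J < n * q) \sum_(0 <= K < n * q) `|fluct n q J K| <= S * eta.
Proof.
move=> eta0 n0 q0; rewrite energy_refine//.
set m := (n * q)%N; set V := \sum_(0 <= J < m) \sum_(0 <= K < m) _ => hV.
have m1 : 0 < m%:R :> R by rewrite ltr0n muln_gt0 n0.
have S0' : S != 0 by rewrite gt_eqF.
have m0' : m%:R != 0 :> R by rewrite gt_eqF.
(* Cauchy-Schwarz over the m^2 cells, written as Young's inequality: this [th] balances its two
   halves, the bound on [V] being (m th)^2. *)
pose th := eta * S / m%:R ^+ 2.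
have th0 : 0 < th by rewrite !divr_gt0 ?mulr_gt0// exprn_gt0.
have young (x : R) : `|x| <= x ^+ 2 / (2 * th) + th / 2.
  rewrite -(ler_pM2r (_ : 0 < 2 * th)); last by rewrite mulr_gt0.
  have -> : (x ^+ 2 / (2 * th) + th / 2) * (2 * th) = x ^+ 2 + th ^+ 2.
    by field; rewrite gt_eqF.
  rewrite -[x ^+ 2]real_normK ?num_real//.
  by have := sqr_ge0 (`|x| - th); lra.
apply: le_trans (_ : \sum_(0 <= J < m) \sum_(0 <= K < m)
    (fluct n q J K ^+ 2 / (2 * th) + th / 2) <= _).
  by apply: ler_sum => J _; apply: ler_sum => K _.
have -> : \sum_(0 <= J < m) \sum_(0 <= K < m) (fluct n q J K ^+ 2 / (2 * th) + th / 2) =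
    V / (2 * th) + m%:R ^+ 2 * (th / 2).
  under eq_bigr do rewrite big_split/= -mulr_suml.
  rewrite big_split/= -mulr_suml; congr (_ + _).
  by rewrite !sumr_const_nat subn0 -[_ *+ m *+ m]mulr_natl -[_ *+ m]mulr_natl; ring.
have hV' : V <= eta ^+ 2 * S ^+ 2 / m%:R ^+ 2.
  rewrite ler_pdivlMr ?exprn_gt0// -ler_pdivrMr ?exprn_gt0//.
  by apply: le_trans hV; rewrite le_eqVlt; apply/orP; left; apply/eqP; ring.
apply: le_trans (lerD (ler_wpM2r _ hV') (lexx _)) _.
  by rewrite invr_ge0 mulr_ge0// ltW.
rewrite le_eqVlt; apply/orP; left; apply/eqP; rewrite /th; field.
by rewrite S0' m0' !gt_eqF.
Qed.

End energy.

(** * Packings of strips *)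

Section packing.
Variable R : realType.
Variables (A0 B0 S C : R) (T : line R -> line R -> R -> R -> R).
Hypothesis S_gt0 : 0 < S.
Hypothesis C0 : 0 <= C.
Hypothesis LT : lipschitz_functional A0 B0 S C T.

Local Notation gx := (grid_x A0 S).
Local Notation gt := (grid_t B0 S).
Local Notation cell := (grid_cell A0 B0 S T).

Definition area (l l' : line R) (a b : R) : R :=
  ((ev l' a - ev l a) + (ev l' b - ev l b)) / 2 * (b - a).

Definition grid_density (n j k : nat) : R := cell n j k / (S / n%:R) ^+ 2.

Lemma density_le n j k : (j < n)%N -> (k < n)%N -> `|grid_density n j k| <= C.
Proof.
move=> jn kn; have n1 : 0 < n%:R :> R by rewrite ltr0n (leq_ltn_trans _ jn).
have d2 : 0 < (S / n%:R) ^+ 2 by rewrite exprn_gt0// divr_gt0.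
rewrite /grid_density normrM (@ger0_norm _ _^-1) ?invr_ge0 ?(ltW d2)//.
by rewrite ler_pdivrMr//; exact: cell_bound.
Qed.

(** With w the density of a coarse cell, the value of this functional on a fine cell inside it is
    [fluct]; [density_le] supplies the bound on w. *)
Lemma lipschitz_functional_area (w : R) : `|w| <= C ->
  lipschitz_functional A0 B0 S (2 * C) (fun l l' a b => T l l' a b - w * area l l' a b).
Proof.
have [Tx Tt TC] := LT; move=> wC; split.
- by move=> l l' a b c; rewrite (Tx _ _ a b c) /area /ev; field.
- by move=> l l' l'' a b; rewrite (Tt l l' l'') /area; ring.
- move=> l l' a b h ab H; apply: le_trans (ler_normB _ _) _.
  have := TC _ _ _ _ _ ab H => h1.
  have [_ _ ha] := H a (introT andP (conj (lexx a) ab)).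
  have [_ _ hb] := H b (introT andP (conj ab (lexx b))).
  have h2 : `|area l l' a b| <= (b - a) * h.
    rewrite /area normrM [`|b - a|]ger0_norm ?subr_ge0// mulrC ler_wpM2l ?subr_ge0//.
    by move: ha hb; rewrite !ler_norml => /andP[? ?] /andP[? ?]; apply/andP; split; lra.
  have := ler_pM (normr_ge0 w) (normr_ge0 (area l l' a b)) wC h2.
  by rewrite -normrM; lra.
Qed.

Definition in_region (l : line R) (h a b y t : R) : Prop :=
  a <= y <= b /\ ev l y <= t <= ev l y + h.

Definition in_cell (n j k : nat) (l : line R) (h a b : R) : Prop :=
  [/\ (j < n)%N, (k < n)%N, gx n j <= a, b <= gx n j.+1 &
    forall y, a <= y <= b -> gt n k <= ev l y /\ ev l y + h <= gt n k.+1].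

Lemma in_cell_square n j k l h a b : in_cell n j k l h a b ->
  [/\ A0 <= a, b <= A0 + S & forall y, a <= y <= b -> B0 <= ev l y /\ ev l y + h <= B0 + S].
Proof.
move=> [jn kn ja jb H]; have n0 : (0 < n)%N by exact: leq_ltn_trans jn.
have n1 : 0 < n%:R :> R by rewrite ltr0n.
have d0 : 0 < S / n%:R by rewrite divr_gt0.
have nd : n%:R * (S / n%:R) = S by rewrite mulrC divfK// gt_eqF.
have bnd i : (i <= n)%N -> 0 <= i%:R * (S / n%:R) <= S.
  move=> i_n; rewrite mulr_ge0 ?(ltW d0)//= -[leRHS]nd.
  by rewrite ler_wpM2r ?(ltW d0)// ler_nat.
have /andP[? ?] := bnd _ jn; have /andP[? ?] := bnd _ (ltnW jn).
have /andP[? ?] := bnd _ kn; have /andP[? ?] := bnd _ (ltnW kn).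
move: ja jb H; rewrite /grid_x /grid_t => ja jb H; split; [lra|lra|].
by move=> y /H []; split; lra.
Qed.

(** Used for both coordinates: it identifies the coarse cell to which [fluct] compares a fine cell
    contained in a strip. *)
Lemma fine_index n q (o : R) j J x x' : (0 < n)%N -> (0 < q)%N ->
  o + j%:R * (S / n%:R) <= x -> x <= o + J%:R * (S / (n * q)%:R) ->
  o + J%:R * (S / (n * q)%:R) + S / (n * q)%:R <= x' -> x' <= o + j.+1%:R * (S / n%:R) ->
  (J %/ q = j)%N.
Proof.
move=> n0 q0 h1 h2 h3 h4.
have n1 : 0 < n%:R :> R by rewrite ltr0n.
have q1 : 0 < q%:R :> R by rewrite ltr0n.
have d0 : 0 < S / (n * q)%:R by rewrite divr_gt0// ltr0n muln_gt0 n0.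
have dq : S / n%:R = q%:R * (S / (n * q)%:R).
  by rewrite natrM; field; rewrite !gt_eqF.
move: h1 h4; rewrite dq => h1 h4.
apply/eqP; rewrite eqn_leq; apply/andP; split.
  rewrite -ltnS ltn_divLR// -(ltr_nat R) -(ltr_pM2r d0) natrM; lra.
rewrite leq_divRL// -(ler_nat R) -(ler_pM2r d0) natrM; lra.
Qed.

Lemma strip_approx_cell n q j k l h a b : (0 < n)%N -> (0 < q)%N -> 0 <= h -> a <= b ->
  in_cell n j k l h a b ->
  `|T l (shift l h) a b - grid_density n j k * (h * (b - a))| <=
    \sum_(0 <= J < n * q) \sum_(0 <= K < n * q |
        in_strip l h a b (gx (n * q) J) (gt (n * q) K) (S / (n * q)%:R))
      `|fluct A0 B0 S T n q J K|
    + (4 * C * (1 + `|l.2|) * S + 4 * C * h) * (S / (n * q)%:R).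
Proof.
move=> n0 q0 h0 ab inc; have [hA hB hl] := in_cell_square inc.
have [jn kn ja jb H] := inc.
have nq0 : (0 < n * q)%N by rewrite muln_gt0 n0.
have := strip_approx S_gt0 (lipschitz_functional_area (density_le jn kn)) _ nq0 h0 hA ab hB hl.
have C2 : 0 <= 2 * C by rewrite mulr_ge0.
have -> : area l (shift l h) a b = h * (b - a) by rewrite /area !ev_shift; field.
move=> /(_ C2) HH; apply: le_trans HH _; apply: lerD; last first.
  by rewrite le_eqVlt; apply/orP; left; apply/eqP; ring.
apply: ler_sum => J _; apply: ler_sum => K.
case/and5P => s1 s2 s3 _ /andP[s4 _].
have JQ : (J %/ q = j)%N.
  exact: (fine_index n0 q0 ja s1 s2 jb).
have [t1 t2] : gt n k <= ev l (gx (n * q) J) /\ ev l (gx (n * q) J) + h <= gt n k.+1.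
  apply: H; rewrite s1 (le_trans _ s2)// lerDl ltW// divr_gt0// ltr0n//.
have KQ : (K %/ q = k)%N.
  exact: (fine_index n0 q0 t1 s3 s4 t2).
rewrite le_eqVlt; apply/orP; left; apply/eqP; congr (`|_|).
rewrite /fluct JQ KQ {1}/grid_cell -/(cell (n * q) J K); congr (_ - _).
rewrite /area !ev_hline grid_xS grid_tS /grid_density natrM; field.
by rewrite !gt_eqF// ltr0n.
Qed.

(** A fine cell lies in at most one of the disjoint strips, so the total fluctuation bounds the sum
    however many strips there are. The boundary errors depend on the slopes and heights of the
    strips, but they vanish as q grows while n and eta stay fixed. *)
Lemma packing (eta : R) n : 0 < eta -> (0 < n)%N ->
  (forall q, (0 < q)%N -> grid_energy A0 B0 S T (n * q) - grid_energy A0 B0 S T n <= eta ^+ 2) ->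
  forall (I : eqType) (D : seq I) (l : I -> line R) (h a b : I -> R) (cj ck : I -> nat),
  uniq D ->
  (forall i, i \in D -> [/\ 0 <= h i, a i <= b i &
     in_cell n (cj i) (ck i) (l i) (h i) (a i) (b i)]) ->
  (forall i j y t, i \in D -> j \in D -> in_region (l i) (h i) (a i) (b i) y t ->
     in_region (l j) (h j) (a j) (b j) y t -> i = j) ->
  \sum_(i <- D) `|T (l i) (shift (l i) (h i)) (a i) (b i) -
                  grid_density n (cj i) (ck i) * (h i * (b i - a i))| <= S * eta.
Proof.
move=> eta0 n0 hE I D l h a b cj ck uD hD disj.
apply/ler_addgt0Pr => e e0.
pose M := \sum_(i <- D) (4 * C * (1 + `|(l i).2|) * S + 4 * C * h i).
have M0 : 0 <= M.
  rewrite /M big_seq sumr_ge0// => i /hD[h0 _ _].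
  apply: addr_ge0; last by rewrite !mulr_ge0.
  by apply: mulr_ge0; [apply: mulr_ge0; [exact: mulr_ge0|exact: addr_ge0]|exact: ltW].
have n1 : 0 < n%:R :> R by rewrite ltr0n.
pose q := (Num.truncn (M * S / n%:R / e)).+1.
have q0 : (0 < q)%N by [].
have q1 : 0 < q%:R :> R by rewrite ltr0n.
have hq : M * (S / (n * q)%:R) <= e.
  have /ltW : M * S / n%:R / e < q%:R by exact: truncnS_gt.
  rewrite ler_pdivrMr// => hMe.
  have -> : M * (S / (n * q)%:R) = (M * S / n%:R) / q%:R.
    by rewrite natrM; field; rewrite !gt_eqF.
  by rewrite ler_pdivrMr// [leRHS]mulrC.
apply: le_trans (_ : \sum_(i <- D) (\sum_(0 <= J < n * q) \sum_(0 <= K < n * q |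
        in_strip (l i) (h i) (a i) (b i) (gx (n * q) J) (gt (n * q) K) (S / (n * q)%:R))
      `|fluct A0 B0 S T n q J K|
    + (4 * C * (1 + `|(l i).2|) * S + 4 * C * h i) * (S / (n * q)%:R)) <= _).
  rewrite big_seq [leRHS]big_seq; apply: ler_sum => i /hD[h0 ab inc].
  exact: strip_approx_cell.
rewrite big_split/= -mulr_suml -/M; apply: lerD => //.
apply: (le_trans _ (sum_fluct_le S_gt0 LT eta0 n0 q0 (hE _ q0))).
rewrite exchange_big/=; apply: ler_sum => J _.
rewrite (exchange_big_dep xpredT)//=; apply: ler_sum => K _.
apply: sum_le_unique => // i j iD jD /and5P[s1 s2 s3 _ /andP[s4 _]] /and5P[r1 r2 r3 _ /andP[r4 _]].
have d0 : 0 <= S / (n * q)%:R by rewrite divr_ge0// ltW.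
apply: (disj i j (gx (n * q) J) (gt (n * q) K)) => //.
  by split; apply/andP; split=> //; [apply: le_trans s2|apply: le_trans s4]; rewrite lerDl.
by split; apply/andP; split=> //; [apply: le_trans r2|apply: le_trans r4]; rewrite lerDl.
Qed.

End packing.

(** * Plane measure *)

Section plane_measure.
Variable R : realType.

Local Notation plane := (measurableTypeR R * measurableTypeR R)%type.
Local Notation plane_measure := (@lebesgue_measure R \x @lebesgue_measure R)%E.

Definition slanted (p : R * R) (s c1 c2 : R) : set plane :=
  [set A | `|A.1 - p.1| <= c1 /\ `|A.2 - p.2 - s * (A.1 - p.1)| <= c2].

Lemma measurable_slanted p s c1 c2 : measurable (slanted p s c1 c2).
Proof.
have m1 : measurable_fun [set: plane] (fun A : plane => A.1 - p.1).
  exact: measurable_funB.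
have -> : slanted p s c1 c2 =
  (setT `&` [set A : plane | `|A.1 - p.1| <= c1]) `&`
  (setT `&` [set A : plane | `|A.2 - p.2 - s * (A.1 - p.1)| <= c2]).
  by apply/seteqP; split=> [A [? ?]|A [[_ ?] [_ ?]]].
apply: measurableI; apply: measurable_fun_le => //.
  exact: measurableT_comp.
apply: measurableT_comp => //; apply: measurable_funB.
  exact: measurable_funB.
exact: measurable_funM.
Qed.

Lemma plane_measure_slanted p s c1 c2 : 0 <= c1 -> 0 <= c2 ->
  (plane_measure (slanted p s c1 c2) <= (4 * c1 * c2)%:E)%E.
Proof.
move=> c10 c20; rewrite /product_measure1/=.
have itvE (a b : R) : a <= b -> @lebesgue_measure R `[a, b] = (b - a)%:E.
  rewrite lebesgue_measure_itv/= lte_fin EFinB.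
  by case: ltgtP => // -> _; rewrite subee.
rewrite (eq_integral (fun x : measurableTypeR R => (2 * c2)%:E * (\1_(`[p.1 - c1, p.1 + c1]%classic) x)%:E)%E); last first.
  move=> x _; rewrite /= indicE; case: (boolP (x \in _)) => hx.
    move: hx; rewrite inE/= in_itv/= => /andP[h1 h2].
    have -> : xsection (slanted p s c1 c2) x =
      `[p.2 + s * (x - p.1) - c2, p.2 + s * (x - p.1) + c2]%classic.
      apply/seteqP; split=> t; rewrite /xsection/= inE /slanted/= in_itv/= !ler_norml.
        by move=> [_ /andP[? ?]]; apply/andP; split; lra.
      by move=> /andP[? ?]; split; apply/andP; split; lra.
    by rewrite itvE; [rewrite mule1; congr (_%:E); ring|lra].
  rewrite mule0; have -> : xsection (slanted p s c1 c2) x = set0.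
    apply/seteqP; split=> t //; rewrite /xsection/= inE /slanted/= => -[h _].
    move/negP: hx; apply; rewrite inE/= in_itv/=.
    by move: h; rewrite ler_norml => /andP[? ?]; apply/andP; split; lra.
  by rewrite measure0.
rewrite ge0_integralZl//; last 2 first.
- exact: measurableT_comp.
- by rewrite lee_fin mulr_ge0.
have e : p.1 - c1 <= p.1 + c1 by lra.
rewrite integral_indic// setIT [X in (_ * X)%E](itvE _ _ e).
by rewrite -EFinM lee_fin le_eqVlt; apply/orP; left; apply/eqP; ring.
Qed.

Lemma vline_null (x : R) : plane_measure.-negligible [set A : plane | A.1 = x].
Proof.
exists ([set x] `*` setT); split; first exact: measurableX.
  rewrite product_measure1E//.
  by rewrite [X in (X * _)%E]lebesgue_measure_set1 mul0e.
by move=> A /= ->.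
Qed.

Lemma hline_null (t : R) : plane_measure.-negligible [set A : plane | A.2 = t].
Proof.
exists (setT `*` [set t]); split; first exact: measurableX.
  rewrite product_measure1E//.
  by rewrite [X in (_ * X)%E]lebesgue_measure_set1 mule0.
by move=> A /= ->.
Qed.

Lemma negligible_small_cover (E : set plane) :
  (forall e : R, 0 < e -> exists Z, [/\ measurable Z, E `<=` Z & (plane_measure Z <= e%:E)%E]) ->
  plane_measure.-negligible E.
Proof.
move=> H.
have /choice[Z HZ] : forall n : nat, exists Z, [/\ measurable Z, E `<=` Z &
    (plane_measure Z <= (n.+1%:R^-1)%:E)%E].
  by move=> n; apply: H; rewrite invr_gt0 ltr0n.
exists (\bigcap_n Z n); split.
- by apply: bigcap_measurable => // n _; have [] := HZ n.
- apply/eqP; rewrite eq_le measure_ge0 andbT.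
  apply/lee_addgt0Pr => e e0; rewrite add0e.
  have h : (Num.truncn e^-1).+1%:R^-1 <= e.
    rewrite -[leRHS]invrK lef_pV2 ?posrE ?ltr0n ?invr_gt0//.
    exact/ltW/truncnS_gt.
  have [mZ _ hZ] := HZ (Num.truncn e^-1).
  apply: (@le_trans _ _ (plane_measure (Z (Num.truncn e^-1)))).
    apply: le_measure; rewrite ?inE//; last exact: bigcap_inf.
    by apply: bigcap_measurable => // n _; have [] := HZ n.
  by apply: (le_trans hZ); rewrite lee_fin.
- by move=> A EA n _; have [_ + _] := HZ n; exact.
Qed.

Lemma plane_measure_bigcup_le (Z : nat -> set plane) (e : \bar R) :
  (forall n, measurable (Z n)) ->
  (forall n, (plane_measure (\big[setU/set0]_(i < n) Z i) <= e)%E) ->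
  (plane_measure (\bigcup_n Z n) <= e)%E.
Proof.
move=> mZ H.
pose F n := \big[setU/set0]_(i < n) Z i.
have FE : \bigcup_n Z n = \bigcup_n F n.
  apply/seteqP; split=> A [n _ hn].
    by exists n.+1 => //; rewrite /F big_ord_recr/=; right.
  by move: hn; rewrite /F -bigcup_mkord => -[i _ ?]; exists i.
have mF n : measurable (F n) by apply: bigsetU_measurable => i _; exact: mZ.
have ndF : nondecreasing_seq F by move=> m n mn; exact/subsetPset/subset_bigsetU.
have cv := nondecreasing_cvg_mu (mu := plane_measure) mF (bigcupT_measurable _ mF) ndF.
rewrite FE; by apply: (cvge_to_le cv); exact: nearW.
Qed.

End plane_measure.

(** * Covering lemmas *)

Section coverings.

(** Greedy choice: keep an element with largest r, discard all that meet it, and recurse on the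
    rest. A discarded element thus meets a kept one at least as large. *)
Lemma finite_vitali (R : realType) (I : eqType) (r : I -> R) (meet : I -> I -> Prop) (s : seq I) :
  (forall i, i \in s -> meet i i) -> (forall i j, meet i j -> meet j i) ->
  exists D : seq I, [/\ uniq D, {subset D <= s},
    forall i j, i \in D -> j \in D -> meet i j -> i = j &
    forall i, i \in s -> exists2 j, j \in D & meet i j /\ r i <= r j].
Proof.
move=> + sym; have [m] := ubnP (size s); elim: m s => // m IHm s sm refl.
case: s sm refl => [|x0 s0] sm refl.
  by exists [::]; split=> // i; rewrite in_nil.
set s := x0 :: s0 in sm refl *.
have [x xs xmax] : exists2 x, x \in s & forall i, i \in s -> r i <= r x.
  have nz : (0 < size s)%N by [].
  pose f (i : 'I_(size s)) := r (nth x0 s i).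
  have [i _ hi] := @arg_maxP _ _ _ (Ordinal nz) xpredT f isT.
  exists (nth x0 s i); first exact: mem_nth.
  move=> j js; have jlt : (index j s < size s)%N by rewrite index_mem.
  by have := hi (Ordinal jlt) isT; rewrite /f /= nth_index.
pose s' := [seq i <- s | ~~ `[< meet x i >]].
have s's : {subset s' <= s} by move=> i; rewrite mem_filter => /andP[].
have [||D [uD Ds disj cov]] := IHm s'.
- rewrite -ltnS; apply: (leq_trans _ sm); rewrite ltnS size_filter.
  rewrite -[X in (_ < X)%N](count_predC (fun i => `[< meet x i >]) s) addnC -addn1 leq_add2l.
  by rewrite -has_count; apply/hasP; exists x => //; apply/asboolP; exact: refl.
- by move=> i /s's; exact: refl.
have nx i : i \in D -> ~ meet x i.
  by move=> /Ds; rewrite mem_filter => /andP[/asboolP].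
exists (x :: D); split.
- by rewrite /= uD andbT; apply/negP => /nx; apply; exact: refl.
- by move=> i; rewrite inE => /predU1P[->//|/Ds/s's].
- move=> i j; rewrite !inE => /predU1P[->|iD] /predU1P[->|jD]//.
  + by move=> /(nx _ jD).
  + by move=> /sym/(nx _ iD).
  + exact: disj.
- move=> i i_s; have [mi|nmi] := pselect (meet x i).
    by exists x; rewrite ?mem_head//; split; [exact: sym|exact: xmax].
  have : i \in s' by rewrite mem_filter i_s andbT; apply/asboolP.
  by move=> /cov[j jD ?]; exists j => //; rewrite inE jD orbT.
Qed.

(* Lindelof: a union of open sets is covered by countably many of them, picked
   among those containing a given rational square. *)
Lemma lindelof_plane (R : realType) (I : Type) (P : I -> Prop) (O : I -> set (R * R)) :
  (forall i A, P i -> O i A -> exists2 e : R, 0 < e &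
     forall B, `|B.1 - A.1| < e -> `|B.2 - A.2| < e -> O i B) ->
  exists f : nat -> option I, (forall n i, f n = Some i -> P i) /\
    (forall i A, P i -> O i A -> exists n j, f n = Some j /\ O j A).
Proof.
move=> op.
pose sq (c : rat * rat * rat) : set (R * R) :=
  [set B | `|B.1 - ratr c.1.1| < ratr c.2 /\ `|B.2 - ratr c.1.2| < ratr c.2].
have /choice[g Hg] : forall c, exists o : option I,
   (forall i, o = Some i -> P i /\ sq c `<=` O i) /\
   ((exists i, P i /\ sq c `<=` O i) -> exists i, o = Some i).
  move=> c; have [[i Pi]|h] := pselect (exists i, P i /\ sq c `<=` O i).
    by exists (Some i); split=> [j [<-]//|_]; exists i.
  by exists None; split=> // /h.
exists (fun n => obind g (unpickle n)); split=> [n i|i A Pi OA].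
  by case: (unpickle n) => //= c /(Hg c).1[].
have [e e0 He] := op i A Pi OA.
have [w] := @rat_in_itvoo R (e / 4) (e / 2) ltac:(lra).
have [u] := @rat_in_itvoo R (A.1 - e / 4) (A.1 + e / 4) ltac:(lra).
have [v] := @rat_in_itvoo R (A.2 - e / 4) (A.2 + e / 4) ltac:(lra).
rewrite !in_itv/= => /andP[v1 v2] /andP[u1 u2] /andP[w1 w2].
have sub : sq (u, v, w) `<=` O i.
  move=> B [] /=; rewrite !ltr_norml => /andP[? ?] /andP[? ?].
  by apply: He; rewrite ltr_norml; apply/andP; split; lra.
have [j gj] := (Hg (u, v, w)).2 (ex_intro _ i (conj Pi sub)).
exists (pickle (u, v, w)), j; rewrite pickleK /= gj; split=> //.
apply: ((Hg (u, v, w)).1 j gj).2.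
by split; rewrite /= ltr_norml; apply/andP; split; lra.
Qed.

End coverings.

(** * Intrinsic pieces *)

Section pieces.
Variable R : realType.
Variables (phi : R * R -> R) (K F r0 : R) (ctr : R * R).
Hypothesis cphi : continuous phi.
Hypothesis r0_gt0 : 0 < r0.
Hypothesis K0 : 0 < K.
Hypothesis phiF : forall p, `|phi p| <= F.
Hypothesis phiK : forall A B, box ctr (2 * r0) A -> box ctr (2 * r0) B ->
  `|phi A - phi B| <= K * graph_dist phi A B.

Local Notation plane := (measurableTypeR R * measurableTypeR R)%type.
Local Notation plane_measure := (@lebesgue_measure R \x @lebesgue_measure R)%E.
Local Notation A0 := (ctr.1 - r0).
Local Notation B0 := (ctr.2 - r0).
Local Notation S := (2 * r0).

Let F0 : 0 <= F := bound_ge0 phiF.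

Lemma in_square_box y t : in_square A0 B0 S y t <-> box ctr r0 (y, t).
Proof.
rewrite /in_square /box/= !ler_norml; split=> -[/andP[? ?] /andP[? ?]];
  by split; apply/andP; split; lra.
Qed.

Lemma flux_lipschitz_functional :
  lipschitz_functional A0 B0 S (cst_flux K) (flux phi).
Proof.
split=> [l l' a b c|l l' l'' a b|l l' a b h ab H].
- exact: flux_catx.
- exact: flux_catt.
- apply: (flux_lipschitz cphi r0_gt0 K0 phiF phiK ab) => y yab.
  by have [/in_square_box ? /in_square_box ? ?] := H y yab.
Qed.

Definition piece : Type := (R * R * R * R)%type.
Definition pbase (x : piece) : R * R := x.1.1.
Definition prho (x : piece) : R := x.1.2.
Definition peps (x : piece) : R := x.2.
Definition pline (x : piece) : line R := charline phi (pbase x).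

(** Reversing the sign of the width or of the height reverses both the flux and the product, so this
    is the flux per area of the unoriented strip. *)
Definition ratio (x : piece) : R :=
  flux phi (pline x) (shift (pline x) (peps x)) (pbase x).1 ((pbase x).1 + prho x)
  / (prho x * peps x).

(** The lower bound on the height makes the area at least |rho|^3, the order of the measure of the
    dilates; the upper bound keeps a piece within intrinsic size |rho|, as [engulf] requires. *)
Definition admissible (M : R) (x : piece) : Prop :=
  [/\ prho x != 0, prho x ^+ 2 <= `|peps x| & `|peps x| <= M * prho x ^+ 2].

(** Open, for the Lindelof argument; the closed variant [pclosed] serves in the measure
    estimates. *)
Definition near_piece (M : R) (x : piece) (A : R * R) : Prop :=
  `|A.1 - (pbase x).1| < M * `|prho x| /\
  `|A.2 - (pbase x).2 - phi (pbase x) * (A.1 - (pbase x).1)| < M * prho x ^+ 2.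

Definition pclosed (M : R) (x : piece) : set plane :=
  slanted (pbase x) (phi (pbase x)) (M * `|prho x|) (M * prho x ^+ 2).

(* rho and eps carry signs; the four numbers below describe the same region as a strip
   with its lower line and its left end listed first. *)
Definition plow (x : piece) : line R :=
  if 0 < peps x then pline x else shift (pline x) (peps x).
Definition pheight (x : piece) : R := `|peps x|.
Definition pleft (x : piece) : R := Num.min (pbase x).1 ((pbase x).1 + prho x).
Definition pright (x : piece) : R := Num.max (pbase x).1 ((pbase x).1 + prho x).

Lemma pleft_right x : pleft x <= pright x.
Proof. by rewrite ge_min le_max lexx. Qed.

Lemma pwidth x : pright x - pleft x = `|prho x|.
Proof.
rewrite /pright /pleft; have [h|h] := leP (pbase x).1 ((pbase x).1 + prho x).
  by rewrite addrAC subrr add0r ger0_norm//; lra.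
by rewrite ltr0_norm; lra.
Qed.

Lemma flux_normalized x v :
  `|flux phi (plow x) (shift (plow x) (pheight x)) (pleft x) (pright x)
    - v * (pheight x * (pright x - pleft x))| =
  `|flux phi (pline x) (shift (pline x) (peps x)) (pbase x).1 ((pbase x).1 + prho x)
    - v * (prho x * peps x)|.
Proof.
have swapx l l' a b : flux phi l l' b a = - flux phi l l' a b by rewrite /flux; ring.
have swapt l l' a b : flux phi l' l a b = - flux phi l l' a b by rewrite /flux; ring.
have sh l e : shift (shift l e) (- e) = l :> line R.
  by case: l => c s; rewrite /shift/= addrK.
rewrite pwidth /plow /pheight /pleft /pright.
have [he|he] := ltP 0 (peps x); have [hr|hr] := leP (pbase x).1 ((pbase x).1 + prho x).
- have hr0 : 0 <= prho x by lra.
  by rewrite (gtr0_norm he) (ger0_norm hr0) [peps x * _]mulrC.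
- have hr0 : prho x < 0 by lra.
  rewrite (gtr0_norm he) (ltr0_norm hr0) swapx -[LHS]normrN; congr (`|_|); ring.
- have hr0 : 0 <= prho x by lra.
  rewrite (ler0_norm he) (ger0_norm hr0) sh swapt -[LHS]normrN; congr (`|_|); ring.
- have hr0 : prho x < 0 by lra.
  rewrite (ler0_norm he) (ltr0_norm hr0) sh swapt swapx; congr (`|_|); ring.
Qed.

Definition pregion (x : piece) (y t : R) : Prop :=
  in_region (plow x) (pheight x) (pleft x) (pright x) y t.

Lemma pregion_near x y t : pregion x y t ->
  `|y - (pbase x).1| <= `|prho x| /\
  `|t - (pbase x).2 - phi (pbase x) * (y - (pbase x).1)| <= `|peps x|.
Proof.
move=> [/andP[h1 h2] /andP[h3 h4]]; split.
  move: h1 h2; rewrite /pleft /pright.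
  have [hr|hr] := leP (pbase x).1 ((pbase x).1 + prho x) => h1 h2.
    by rewrite !ger0_norm; lra.
  by rewrite (@ltr0_norm _ (prho x)) ?ler_norml; lra.
have -> : t - (pbase x).2 - phi (pbase x) * (y - (pbase x).1) = t - ev (pline x) y.
  by rewrite ev_charline; ring.
move: h3 h4; rewrite /plow /pheight; case: ltP => he; last rewrite ev_shift.
  by rewrite (gtr0_norm he) => h3 h4; rewrite ler_norml; apply/andP; split; lra.
by rewrite (ler0_norm he) => h3 h4; rewrite ler_norml; apply/andP; split; lra.
Qed.

Lemma pregion_base x : pregion x (pbase x).1 (pbase x).2.
Proof.
have e : ev (pline x) (pbase x).1 = (pbase x).2 by rewrite ev_charline; ring.
split; first by rewrite ge_min le_max lexx.
rewrite /plow /pheight; case: ltP => he; rewrite ?ev_shift e.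
  by rewrite lexx lerDl /=.
by rewrite (ler0_norm he) addrK lexx andbT gerDl.
Qed.

Definition cst_engulf (M : R) : R := 3 * M + 2 + 2 * (2 * K + K ^+ 2 + M) * (M + 1).

Lemma cst_engulf_gt0 M : 0 <= M -> 0 < cst_engulf M.
Proof.
move=> M0; rewrite /cst_engulf; have k := K0.
have : 0 <= 2 * (2 * K + K ^+ 2 + M) * (M + 1).
  apply: mulr_ge0; last by lra.
  by have := sqr_ge0 K; lra.
lra.
Qed.

(** The engulfing property behind Vitali's lemma. Both slopes are within c r of [phi q] at the
    common point q, so they differ by at most 2 c r, which shears A by at most 2 c (M + 1) r^2. The
    3 M in [cst_engulf] collects the vertical offsets of A from y, of q from y and of q from x. *)
Lemma engulf M x y q A : 0 <= M -> admissible M x -> admissible M y ->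
  box ctr (2 * r0) (pbase x) -> box ctr (2 * r0) (pbase y) -> box ctr (2 * r0) q ->
  pregion x q.1 q.2 -> pregion y q.1 q.2 -> `|prho y| <= `|prho x| ->
  pclosed M y A -> pclosed (cst_engulf M) x A.
Proof.
move=> M0 [x0 _ xe] [y0 _ ye] Dx Dy Dq /pregion_near[qx1 qx2] /pregion_near[qy1 qy2] yx.
have rx0 : 0 < `|prho x| by rewrite normr_gt0.
have ry0 : 0 < `|prho y| by rewrite normr_gt0.
have sx : prho x ^+ 2 = `|prho x| ^+ 2 by rewrite real_normK ?num_real.
have sy : prho y ^+ 2 = `|prho y| ^+ 2 by rewrite real_normK ?num_real.
have cx := phi_near K0 phiK Dx Dq rx0 M0 qx1.
have cy := phi_near K0 phiK Dy Dq ry0 M0 qy1.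
rewrite /pclosed /slanted/=.
rewrite sx in xe *; rewrite sy in ye *.
have {}cx := cx (le_trans qx2 xe); have {}cy := cy (le_trans qy2 ye).
move: (phi (pbase x)) (phi (pbase y)) (phi q) qx1 qx2 qy1 qy2 cx cy.
move: xe ye yx rx0 ry0; set r := `|prho x|; set s := `|prho y|.
move=> xe ye sr r_gt0 s_gt0 fx fy fq qx1 qx2 qy1 qy2 cx cy [a1 a2].
set c := 2 * K + K ^+ 2 + M in cx cy.
have c0 : 0 <= c by rewrite /c; have := sqr_ge0 K; have := K0; lra.
have s2 : s ^+ 2 <= r ^+ 2 by rewrite lerXn2r ?nnegrE// ltW.
have Msr : M * s <= M * r by exact: ler_wpM2l.
have Ms2 : M * s ^+ 2 <= M * r ^+ 2 by exact: ler_wpM2l.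
have csr : c * s <= c * r by exact: ler_wpM2l.
have extra : 0 <= 2 * c * (M + 1) by rewrite !mulr_ge0// addr_ge0.
have Mr : 0 <= M * r by rewrite mulr_ge0// ltW.
have eM : cst_engulf M = 3 * M + 2 + 2 * c * (M + 1) by [].
have Aq : `|A.1 - q.1| <= (M + 1) * r.
  have -> : A.1 - q.1 = (A.1 - (pbase y).1) - (q.1 - (pbase y).1) by ring.
  apply: le_trans (ler_normB _ _) _; lra.
split.
  have -> : A.1 - (pbase x).1 = (A.1 - q.1) + (q.1 - (pbase x).1) by ring.
  apply: le_trans (ler_normD _ _) _.
  have h : 0 <= 2 * c * (M + 1) * r by rewrite mulr_ge0// ltW.
  rewrite eM; have := r_gt0; lra.
have -> : A.2 - (pbase x).2 - fx * (A.1 - (pbase x).1) =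
  (A.2 - (pbase y).2 - fy * (A.1 - (pbase y).1))
  - (q.2 - (pbase y).2 - fy * (q.1 - (pbase y).1))
  + (q.2 - (pbase x).2 - fx * (q.1 - (pbase x).1))
  + ((fq - fx) - (fq - fy)) * (A.1 - q.1) by ring.
have d : `|(fq - fx) - (fq - fy)| <= 2 * c * r.
  by apply: le_trans (ler_normB _ _) _; lra.
have := ler_pM (normr_ge0 _) (normr_ge0 _) d Aq; rewrite -normrM => dA.
apply: le_trans (ler_normD _ _) _.
apply: le_trans (lerD (ler_normD _ _) dA) _.
apply: le_trans (lerD (lerD (ler_normB _ _) (lexx _)) (lexx _)) _.
have r2 : 0 <= r ^+ 2 by exact: sqr_ge0.
rewrite eM; lra.
Qed.

End pieces.

(** * Points where the ratios of the pieces have no limit *)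

Section bad_set.
Variable R : realType.
Variables (phi : R * R -> R) (K F r0 : R) (ctr : R * R).
Hypothesis cphi : continuous phi.
Hypothesis r0_gt0 : 0 < r0.
Hypothesis K0 : 0 < K.
Hypothesis phiF : forall p, `|phi p| <= F.
Hypothesis phiK : forall A B, box ctr (2 * r0) A -> box ctr (2 * r0) B ->
  `|phi A - phi B| <= K * graph_dist phi A B.
Variables (M delta : R).
Hypothesis M1 : 1 <= M.
Hypothesis delta0 : 0 < delta.

Local Notation plane := (measurableTypeR R * measurableTypeR R)%type.
Local Notation plane_measure := (@lebesgue_measure R \x @lebesgue_measure R)%E.
Local Notation A0 := (ctr.1 - r0).
Local Notation B0 := (ctr.2 - r0).
Local Notation S := (2 * r0).
Local Notation gx := (grid_x A0 S).
Local Notation gt := (grid_t B0 S).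
Local Notation density := (grid_density A0 B0 S (flux phi)).
Local Notation energy := (grid_energy A0 B0 S (flux phi)).

Let F0 : 0 <= F := bound_ge0 phiF.
Let S_gt0 : 0 < S.
Proof. by have := r0_gt0; lra. Qed.
Let M0 : 0 <= M.
Proof. exact: le_trans M1. Qed.
Let LT := flux_lipschitz_functional cphi r0_gt0 K0 phiF phiK.

Definition good_at (A : R * R) : Prop :=
  exists v, exists2 d : R, 0 < d & forall x, admissible M x -> `|prho x| < d ->
    near_piece phi M x A -> `|ratio phi x - v| <= delta.

Definition bad_piece (n : nat) (x : piece R) : Prop :=
  admissible M x /\ exists jk : nat * nat,
    in_cell A0 B0 S n jk.1 jk.2 (plow phi x) (pheight x) (pleft x) (pright x) /\
    delta < `|ratio phi x - density n jk.1 jk.2|.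

Lemma measure_bigsetU_seq_le (I : Type) (s : seq I) (G : I -> set plane) :
  (forall i, measurable (G i)) ->
  (plane_measure (\big[setU/set0]_(i <- s) G i) <= \sum_(i <- s) plane_measure (G i))%E.
Proof.
move=> mG; elim: s => [|i s IHs]; first by rewrite !big_nil measure0.
rewrite !big_cons; apply: (le_trans (measureU2 _ _ _)) => //.
  exact: bigsetU_measurable.
exact: leeD2l.
Qed.

(** Chebyshev after Vitali: each selected piece adds at least delta |rho|^3 to the sum bounded by
    [packing], while its enlarged dilate has measure at most 4 M'^2 |rho|^3. The bound is uniform in
    the length of the list. *)
Lemma bad_pieces_measure (eta : R) n (s : seq (piece R)) : 0 < eta -> (0 < n)%N ->
  (forall q, (0 < q)%N -> energy (n * q) - energy n <= eta ^+ 2) ->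
  (forall x, x \in s -> bad_piece n x) ->
  (plane_measure (\big[setU/set0]_(x <- s) pclosed phi M x)
     <= (4 * cst_engulf K M ^+ 2 * (S * eta / delta))%:E)%E.
Proof.
move=> eta0 n0 hE bad; set M' := cst_engulf K M.
have M'0 : 0 < M' by exact: cst_engulf_gt0.
pose meet x y := exists q : R * R, pregion phi x q.1 q.2 /\ pregion phi y q.1 q.2.
have [|x y [q [? ?]]|D [uD Ds disj cov]] :=
    @finite_vitali R (piece R) (fun x => `|prho x|) meet s.
- by move=> x _; exists (pbase x); split; exact: pregion_base.
- by exists q.
have inbox x y t : x \in s -> pregion phi x y t -> box ctr (2 * r0) (y, t).
  move=> xs [yx /andP[t1 t2]].
  have [_ [jk [/(in_cell_square S_gt0)[a1 a2 H] _]]] := bad x xs.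
  have [h1 h2] := H y yx; move/andP: yx => [y1 y2].
  rewrite /box/= !ler_norml; split; apply/andP; split; have := r0_gt0; lra.
have sub : \big[setU/set0]_(x <- s) pclosed phi M x `<=`
           \big[setU/set0]_(x <- D) pclosed phi M' x.
  rewrite -!bigcup_seq => A [x /= xs xA].
  have [y yD [[q [qx qy]] rxy]] := cov x xs.
  exists y => //=.
  have [adx _] := bad x xs; have [ady _] := bad y (Ds y yD).
  apply: (@engulf R phi K r0 ctr K0 phiK M y x q A) => //.
  - by have := inbox y _ _ (Ds y yD) (pregion_base phi y); case: (pbase y).
  - by have := inbox x _ _ xs (pregion_base phi x); case: (pbase x).
  - by have := inbox x _ _ xs qx; case: (q).
have mcl L x : measurable (pclosed phi L x) by exact: measurable_slanted.
apply: le_trans (_ : plane_measure (\big[setU/set0]_(x <- D) pclosed phi M' x) <= _)%E.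
  by apply: le_measure; rewrite ?inE//; apply: bigsetU_measurable.
apply: (le_trans (measure_bigsetU_seq_le _ _)) => //.
apply: le_trans (_ : \sum_(x <- D) (4 * M' ^+ 2 * `|prho x| ^+ 3)%:E <= _)%E.
  apply: lee_sum => x _; apply: (le_trans (plane_measure_slanted _ _ _ _)).
  - by rewrite mulr_ge0// ltW.
  - by rewrite mulr_ge0 ?sqr_ge0// ltW.
  rewrite lee_fin -[prho x ^+ 2]real_normK ?num_real// le_eqVlt.
  by apply/orP; left; apply/eqP; ring.
rewrite sumEFin lee_fin -mulr_sumr ler_wpM2l ?mulr_ge0 ?(ltW M'0)//.
rewrite ler_pdivlMr//.
have /choice[jk Hjk] : forall x, exists jk : nat * nat, x \in D ->
    in_cell A0 B0 S n jk.1 jk.2 (plow phi x) (pheight x) (pleft x) (pright x) /\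
    delta < `|ratio phi x - density n jk.1 jk.2|.
  move=> x; have [xD|xD] := boolP (x \in D); last by exists (0%N, 0%N).
  by have [_ [jk H]] := bad x (Ds x xD); exists jk.
have PK := @packing _ _ _ _ _ _ S_gt0 (cst_flux_ge0 K0) LT eta n eta0 n0 hE _ D (plow phi)
  (@pheight R) (@pleft R) (@pright R) (fun x => (jk x).1) (fun x => (jk x).2) uD.
apply: (le_trans _ (PK _ _)); last 2 first.
- move=> x xD; split; [exact: normr_ge0|exact: pleft_right|].
  by have [] := Hjk x xD.
- by move=> x y u t xD yD hx hy; apply: (disj x y xD yD); exists (u, t).
rewrite mulr_suml big_seq [leRHS]big_seq; apply: ler_sum => x xD.
have [_ hd] := Hjk x xD; have [[rx0 re _] _] := bad x (Ds x xD).
rewrite flux_normalized.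
have rx : 0 < `|prho x| by rewrite normr_gt0.
have e0 : 0 < `|peps x|.
  by apply: lt_le_trans re; rewrite -real_normK ?num_real// exprn_gt0.
have re0 : prho x * peps x != 0 by rewrite mulf_neq0// -normr_gt0.
have -> : flux phi (pline phi x) (shift (pline phi x) (peps x)) (pbase x).1
     ((pbase x).1 + prho x) - density n (jk x).1 (jk x).2 * (prho x * peps x) =
   (ratio phi x - density n (jk x).1 (jk x).2) * (prho x * peps x).
  by rewrite /ratio mulrBl divfK.
rewrite normrM mulrC normrM; apply: ler_pM; rewrite ?exprn_ge0//; first exact: ltW.
  exact: ltW.
by rewrite exprS ler_wpM2l// real_normK ?num_real.
Qed.

Lemma near_piece_open x A : near_piece phi M x A -> exists2 e : R, 0 < e &
  forall B, `|B.1 - A.1| < e -> `|B.2 - A.2| < e -> near_piece phi M x B.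
Proof.
move=> [h1 h2]; set s := phi (pbase x) in h2.
have s0 : 0 <= `|s| by [].
set a := `|_ - _| in h1; set b := `|_ - _ - _| in h2.
pose e1 := M * `|prho x| - a; pose e2 := (M * prho x ^+ 2 - b) / (1 + `|s|).
have e10 : 0 < e1 by rewrite subr_gt0.
have s1 : 0 < 1 + `|s| by lra.
have e20 : 0 < e2 by rewrite divr_gt0// subr_gt0.
exists (Num.min e1 e2); first by rewrite lt_min e10.
move=> B; rewrite !lt_min => /andP[x1 x2] /andP[t1 t2]; split.
  have -> : B.1 - (pbase x).1 = (A.1 - (pbase x).1) + (B.1 - A.1) by ring.
  apply: le_lt_trans (ler_normD _ _) _; move: x1; rewrite /e1 /a; lra.
have -> : B.2 - (pbase x).2 - phi (pbase x) * (B.1 - (pbase x).1) =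
  (A.2 - (pbase x).2 - s * (A.1 - (pbase x).1)) + ((B.2 - A.2) - s * (B.1 - A.1)).
  by rewrite /s; ring.
apply: le_lt_trans (ler_normD _ _) _; rewrite -/b.
have : `|B.2 - A.2 - s * (B.1 - A.1)| < e2 * (1 + `|s|).
  apply: le_lt_trans (ler_normB _ _) _; rewrite normrM.
  have := ler_wpM2l s0 (ltW x2); lra.
by rewrite /e2 divfK ?gt_eqF//; lra.
Qed.

Lemma pregion_location x A y t : admissible M x -> `|prho x| <= 1 ->
  near_piece phi M x A -> pregion phi x y t ->
  `|y - A.1| <= ((M + 1) * (F + 1) + 2 * M) * `|prho x| /\
  `|t - A.2| <= ((M + 1) * (F + 1) + 2 * M) * `|prho x|.
Proof.
move=> [_ _ xe] x1 [n1 n2] /pregion_near[r1 r2].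
have x2 : prho x ^+ 2 <= `|prho x|.
  by rewrite -real_normK ?num_real// expr2 ler_piMl.
have Mx2 := ler_wpM2l M0 x2.
have x0 : 0 <= `|prho x| by [].
have Fx : 0 <= F * `|prho x| by exact: mulr_ge0.
have FMx : 0 <= F * (M * `|prho x|) by apply: mulr_ge0 => //; exact: mulr_ge0.
have Mx : 0 <= M * `|prho x| by exact: mulr_ge0.
have yA : `|y - A.1| <= (M + 1) * `|prho x|.
  have -> : y - A.1 = (y - (pbase x).1) - (A.1 - (pbase x).1) by ring.
  apply: le_trans (ler_normB _ _) _; lra.
split; first by apply: (le_trans yA); lra.
have -> : t - A.2 = (t - (pbase x).2 - phi (pbase x) * (y - (pbase x).1))
  - (A.2 - (pbase x).2 - phi (pbase x) * (A.1 - (pbase x).1))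
  + phi (pbase x) * (y - A.1) by ring.
apply: le_trans (ler_normD _ _) _; rewrite normrM.
apply: le_trans (lerD (ler_normB _ _) (ler_pM _ _ (phiF _) yA)) _ => //.
lra.
Qed.

Lemma grid_index (o u : R) n : (0 < n)%N -> o < u < o + S ->
  (forall j, u != o + j%:R * (S / n%:R)) ->
  exists2 j, (j < n)%N & o + j%:R * (S / n%:R) < u < o + j.+1%:R * (S / n%:R).
Proof.
move=> n0 /andP[ou uo] hj; have n1 : 0 < n%:R :> R by rewrite ltr0n.
set d := S / n%:R in hj *; have d0 : 0 < d by rewrite divr_gt0.
have nd : n%:R * d = S by rewrite /d mulrC divfK// gt_eqF.
pose j := Num.truncn ((u - o) / d).
have j1 : (u - o) / d < j.+1%:R by exact: truncnS_gt.
have j2 : j%:R <= (u - o) / d by rewrite truncn_le// divr_ge0 ?(ltW d0)//; lra.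
move: j1 j2; rewrite ltr_pdivrMr// ler_pdivlMr// => j1 j2.
exists j.
  by rewrite -(ltr_nat R) -(ltr_pM2r d0) nd; lra.
by apply/andP; split; [rewrite lt_neqAle eq_sym hj /=|]; lra.
Qed.

(** The density of the open cell containing A is tried as the limit value. Small pieces near A stay
    inside this cell, so the failure of [good_at] exhibits a bad one; points on the grid lines are
    set aside because pieces near them may straddle cells. *)
Lemma bad_point_piece n A : (0 < n)%N ->
  `|A.1 - ctr.1| < r0 -> `|A.2 - ctr.2| < r0 ->
  (forall j, A.1 != gx n j) -> (forall k, A.2 != gt n k) ->
  ~ good_at A -> exists x, bad_piece n x /\ near_piece phi M x A.
Proof.
move=> n0; rewrite !ltr_norml => /andP[a1 a2] /andP[b1 b2] hx ht bad.
have [|j jn /andP[j1 j2]] := @grid_index A0 A.1 n n0 _ hx.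
  by apply/andP; split; lra.
have [|k kn /andP[k1 k2]] := @grid_index B0 A.2 n n0 _ ht.
  by apply/andP; split; lra.
apply: contrapT => H; apply: bad; exists (density n j k).
pose c := (M + 1) * (F + 1) + 2 * M.
have c0 : 0 < c.
  rewrite /c; have m := M0; have : 0 <= (M + 1) * (F + 1) by rewrite mulr_ge0// addr_ge0.
  by have := M1; lra.
pose g := Num.min (Num.min (A.1 - gx n j) (gx n j.+1 - A.1))
                  (Num.min (A.2 - gt n k) (gt n k.+1 - A.2)).
have g0 : 0 < g by rewrite !lt_min !subr_gt0 j1 j2 k1.
have [g1 g2 g3 g4] : [/\ g <= A.1 - gx n j, g <= gx n j.+1 - A.1,
   g <= A.2 - gt n k & g <= gt n k.+1 - A.2].
  by split; rewrite !ge_min lexx ?orbT.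
exists (Num.min 1 (g / c)); first by rewrite lt_min ltr01 divr_gt0.
move=> x adm; rewrite lt_min => /andP[x1 xg] nearx; rewrite leNgt; apply/negP => hd.
apply: H; exists x; split=> //; split=> //; exists (j, k); split=> //=.
have cg : c * `|prho x| < g by rewrite mulrC -ltr_pdivlMr.
have loc y t : pregion phi x y t -> `|y - A.1| < g /\ `|t - A.2| < g.
  move=> /(pregion_location adm (ltW x1) nearx)[l1 l2].
  by split; exact: le_lt_trans cg.
have h0 : 0 <= pheight x by exact: normr_ge0.
have lo y : pleft x <= y <= pright x -> pregion phi x y (ev (plow phi x) y).
  by move=> yx; split=> //; rewrite lexx lerDl.
have hi y : pleft x <= y <= pright x -> pregion phi x y (ev (plow phi x) y + pheight x).
  by move=> yx; split=> //; rewrite lexx lerDl h0.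
have lr := pleft_right x.
split=> //.
- have pl : pleft x <= pleft x <= pright x by rewrite lexx.
  by have [+ _] := loc _ _ (lo _ pl); rewrite ltr_norml => /andP[? ?]; lra.
- have pr : pleft x <= pright x <= pright x by rewrite lexx lr.
  by have [+ _] := loc _ _ (lo _ pr); rewrite ltr_norml => /andP[? ?]; lra.
- move=> y yx; have [_ +] := loc _ _ (lo y yx); have [_ +] := loc _ _ (hi y yx).
  by rewrite !ltr_norml => /andP[? ?] /andP[? ?]; split; lra.
Qed.

Lemma bad_negligible : plane_measure.-negligible
  [set A : plane | `|A.1 - ctr.1| < r0 /\ `|A.2 - ctr.2| < r0 /\ ~ good_at A].
Proof.
apply: negligible_small_cover => e e0; set M' := cst_engulf K M.
have M'0 : 0 < M' by exact: cst_engulf_gt0.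
have M'2 : 0 < M' ^+ 2 by exact: exprn_gt0.
(* Makes the bound of [bad_pieces_measure] equal to e. *)
pose eta := e * delta / (4 * M' ^+ 2 * S).
have eta0 : 0 < eta by rewrite divr_gt0 ?mulr_gt0.
have [n n0 hE] := exists_energy_almost_max S_gt0 (cst_flux_ge0 K0) LT (exprn_gt0 2 eta0).
have [f [fP fcov]] := @lindelof_plane R (piece R) (bad_piece n) (near_piece phi M)
   (fun x A _ => @near_piece_open x A).
have [Nx [mNx Nx0 hNx]] : plane_measure.-negligible
    (\bigcup_j [set A : plane | A.1 = gx n j]).
  by apply: negligible_bigcup => j; exact: vline_null.
have [Nt [mNt Nt0 hNt]] : plane_measure.-negligible
    (\bigcup_k [set A : plane | A.2 = gt n k]).
  by apply: negligible_bigcup => k; exact: hline_null.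
pose Z i : set plane := if f i is Some x then pclosed phi M x else set0.
have mZ i : measurable (Z i) by rewrite /Z; case: (f i) => // x; exact: measurable_slanted.
have mUZ : measurable (\bigcup_i Z i) by exact: bigcupT_measurable.
have hZ : (plane_measure (\bigcup_i Z i) <= e%:E)%E.
  apply: plane_measure_bigcup_le => // m.
  have -> : \big[setU/set0]_(i < m) Z i =
      \big[setU/set0]_(x <- pmap f (iota 0 m)) pclosed phi M x.
    rewrite -bigcup_mkord -bigcup_seq; apply/seteqP; split=> A.
      move=> [i /= im]; rewrite /Z; case E: (f i) => [x|//] xA; exists x => //=.
      rewrite mem_pmap; apply/mapP; exists i => //.
      by rewrite mem_iota.
    move=> [x /=]; rewrite mem_pmap => /mapP[i]; rewrite mem_iota => /= im E xA.
    by exists i => //; rewrite /Z -E.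
  apply: (le_trans (bad_pieces_measure eta0 n0 hE _)).
    by move=> x; rewrite mem_pmap => /mapP[i _ E]; apply: (fP i).
  rewrite lee_fin -/M' /eta le_eqVlt; apply/orP; left; apply/eqP; field.
  by rewrite !gt_eqF.
exists (Nx `|` Nt `|` \bigcup_i Z i); split.
- by apply: measurableU => //; exact: measurableU.
- move=> A [A1 [A2 bad]].
  have [[j jA]|hx] := pselect (exists j, A.1 = gx n j).
    by left; left; apply: hNx; exists j.
  have [[k kA]|ht] := pselect (exists k, A.2 = gt n k).
    by left; right; apply: hNt; exists k.
  have [||x [bx nx]] := @bad_point_piece n A n0 A1 A2 _ _ bad.
  - by move=> j; apply/eqP => jA; apply: hx; exists j.
  - by move=> k; apply/eqP => kA; apply: ht; exists k.
  have [i [y [fi [y1 y2]]]] := fcov x A bx nx.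
  by right; exists i => //; rewrite /Z fi; split; exact: ltW.
- apply: (le_trans (measureU2 _ _ _)) => //; first exact: measurableU.
  rewrite -[leRHS]add0e; apply: leeD => //.
  by apply: (le_trans (measureU2 _ _ _)) => //; rewrite [X in (X + _)%E]Nx0 [X in (_ + X)%E]Nt0 adde0.
Qed.

End bad_set.

(** * Euler polygons *)

Section euler.
Variable R : realType.
Variables (phi : R * R -> R) (K F r0 : R) (ctr : R * R).
Hypothesis cphi : continuous phi.
Hypothesis r0_gt0 : 0 < r0.
Hypothesis K0 : 0 < K.
Hypothesis phiF : forall p, `|phi p| <= F.
Hypothesis phiK : forall A B, box ctr (2 * r0) A -> box ctr (2 * r0) B ->
  `|phi A - phi B| <= K * graph_dist phi A B.
Variable P : R * R.
Hypothesis boxP : box ctr r0 P.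

Let F0 : 0 <= F := bound_ge0 phiF.

(** The scale d may depend on M; [euler_path] takes M according to the number of steps and to b. *)
Definition limit_ratio (w : R) : Prop :=
  forall M delta : R, 0 < delta -> exists2 d : R, 0 < d &
    forall x, admissible M x -> `|prho x| < d -> near_piece phi M x P ->
      `|ratio phi x - w| <= delta.

(** A small piece based at P with height rho^2 is admissible for every M >= 1, so any two of the
    intervals of radius 1 / (k + 1) about [v k] meet. The supremum of their left ends lies in all of
    them. *)
Lemma exists_limit_ratio :
  (forall k : nat, good_at phi k.+1%:R k.+1%:R^-1 P) -> exists w, limit_ratio w.
Proof.
move=> /choice[v Hv].
have kpos (k : nat) : 0 < k.+1%:R :> R by rewrite ltr0n.
have close k l : v k - k.+1%:R^-1 <= v l + l.+1%:R^-1.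
  have [d d0 Hd] := Hv k; have [d' d'0 Hd'] := Hv l.
  pose r := Num.min d d' / 2.
  have r_gt0 : 0 < r by rewrite divr_gt0// lt_min d0.
  have rd : r < d.
    have : Num.min d d' <= d by rewrite ge_min lexx.
    by rewrite /r; lra.
  have rd' : r < d'.
    have : Num.min d d' <= d' by rewrite ge_min lexx orbT.
    by rewrite /r; lra.
  have r2 : 0 < r ^+ 2 by exact: exprn_gt0.
  pose x : piece R := (P, r, r ^+ 2).
  have adm (j : nat) : admissible j.+1%:R x.
    split; rewrite /prho /peps /= ?gt_eqF// (gtr0_norm r2)// ler_peMl ?(ltW r2)//.
    by rewrite ler1n.
  have nr (j : nat) : near_piece phi j.+1%:R x P.
    rewrite /near_piece /pbase /prho /= !subrr mulr0 subr0 normr0.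
    by split; apply: mulr_gt0 => //; rewrite normr_gt0 gt_eqF.
  have := Hd x (adm k) _ (nr k); have := Hd' x (adm l) _ (nr l).
  rewrite /prho/= (gtr0_norm r_gt0) => /(_ rd') + /(_ rd).
  move: (k.+1%:R^-1) (l.+1%:R^-1) => ik il.
  by rewrite !ler_norml => /andP[? ?] /andP[? ?]; lra.
pose E := [set v k - k.+1%:R^-1 | k in [set: nat]].
have hE : has_sup E.
  split; first by exists (v 0%N - 1%:R^-1), 0%N.
  by exists (v 0%N + 1%:R^-1) => _ [k _ <-]; exact: close.
exists (sup E) => M delta delta0.
have up k : v k - k.+1%:R^-1 <= sup E by apply: sup_upper_bound => //; exists k.
have lo k : sup E <= v k + k.+1%:R^-1.
  by apply: sup_le_ub; [case: hE|move=> _ [l _ <-]; exact: close].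
pose k := Num.truncn (Num.max M (2 / delta)).
have hk : Num.max M (2 / delta) < k.+1%:R by exact: truncnS_gt.
move: hk; rewrite gt_max => /andP[Mk dk].
have dk' : k.+1%:R^-1 <= delta / 2.
  rewrite -[leRHS]invrK lef_pV2 ?posrE ?invr_gt0 ?divr_gt0//.
  by rewrite invf_div ltW.
have [d d0 Hd] := Hv k; exists d => // x [x0 x1 x2] xd [n1 n2].
have : `|ratio phi x - v k| <= k.+1%:R^-1.
  apply: Hd => //.
    by split=> //; apply: (le_trans x2); rewrite ler_wpM2r ?sqr_ge0// ltW.
  split; first by apply: (lt_le_trans n1); rewrite ler_wpM2r ?normr_ge0// ltW.
  by apply: (lt_le_trans n2); rewrite ler_wpM2r ?sqr_ge0// ltW.
have := up k; have := lo k; move: dk'; move: (k.+1%:R^-1) => ik ?; rewrite !ler_norml => ? ? /andP[? ?].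
by apply/andP; split; lra.
Qed.

Definition estep (rho : R) (p : R * R) : R * R := (p.1 + rho, p.2 + phi p * rho).

(** The average of [phi] on the vertical segment of signed length e from p: the flux sees the
    vertical sides of a strip only through such averages. *)
Definition mean (p : R * R) (e : R) : R :=
  (vert phi p.1 (p.2 + e) - vert phi p.1 p.2) / e.

Definition cst_char : R := 2 * K + K ^+ 2.

Lemma cst_char_ge0 : 0 <= cst_char.
Proof. by rewrite /cst_char; have := sqr_ge0 K; have := K0; lra. Qed.

Lemma phi_char p (y rho : R) : box ctr (2 * r0) p ->
  box ctr (2 * r0) (y, p.2 + phi p * (y - p.1)) -> 0 < rho -> `|y - p.1| <= rho ->
  `|phi (y, p.2 + phi p * (y - p.1)) - phi p| <= cst_char * rho.
Proof.
move=> Dp Dq rho0 hy; rewrite /cst_char -[_ + K ^+ 2]addr0.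
apply: (@phi_near _ _ _ _ K0 phiK p _ rho 0) => //=.
by rewrite mul0r [X in `|X|](_ : _ = 0) ?normr0//; ring.
Qed.

Lemma mean_approx p e : e != 0 ->
  (forall t, between p.2 (p.2 + e) t -> box ctr (2 * r0) (p.1, t)) ->
  `|mean p e - phi p| <= K * Num.sqrt `|e|.
Proof.
move=> e0 H; rewrite /mean /vert.
have [t ht ->] := prim_mvt p.2 (p.2 + e) (continuous_vert cphi (y := p.1)).
rewrite addrAC subrr add0r mulfK//.
have Dp : box ctr (2 * r0) (p.1, p.2).
  apply: H; rewrite /between !lexx/= lerDl gerDl.
  by case: (leP 0 e) => h; [left|right; rewrite ltW].
rewrite [in X in _ - X](surjective_pairing p).
apply: le_trans (phi_vert phiK Dp (H t ht)) _.
by rewrite ler_wpM2l ?(ltW K0)// ler_wsqrtr// between_add.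
Qed.

Variables (b : R).
Hypothesis b1 : 1 <= b.

Local Ltac forget := clear - cphi r0_gt0 K0 phiF phiK boxP F0 b1.

(* Completing the square: with e := phi p - phi (y, l y), the difference of the integrands
   of horz on the two sides of the strip is d^2 / 2 - e d >= - e^2 / 2. *)
Lemma euler_step (s rho : R) p : `|s| = 1 -> rho != 0 ->
  (forall q, `|q.1 - p.1| <= `|rho| ->
     `|q.2 - p.2| <= F * `|rho| + b ^+ 2 * rho ^+ 2 -> box ctr (2 * r0) q) ->
  0 <= s * rho * (ratio phi (p, rho, s * b ^+ 2 * rho ^+ 2) * rho
       - (mean (estep rho p) (s * b ^+ 2 * rho ^+ 2) - mean p (s * b ^+ 2 * rho ^+ 2)))
       + rho ^+ 2 * (cst_char ^+ 2 / (2 * b ^+ 2)).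
Proof.
move=> s1 rho0 H; set e := s * b ^+ 2 * rho ^+ 2; pose x : piece R := (p, rho, e).
rewrite -/x; set m := pline phi x.
have b0 : 0 < b by exact: lt_le_trans b1.
have b2 : 0 < b ^+ 2 by exact: exprn_gt0.
have rho2 : 0 < rho ^+ 2 by rewrite -real_normK ?num_real// exprn_gt0// normr_gt0.
have arho : 0 < `|rho| by rewrite normr_gt0.
have ss : s * s = 1 by rewrite -expr2 -real_normK ?num_real// s1 expr1n.
have s0 : s != 0 by rewrite -normr_gt0 s1.
have e0 : e != 0 by rewrite /e !mulf_neq0// gt_eqF.
have cm := @continuous_horz R phi cphi m; have cm' := @continuous_horz R phi cphi (shift m e).
have [y hy] := prim_mvtB p.1 (p.1 + rho) cm' cm.
rewrite -/(horz phi (shift m e)) -/(horz phi m) ev_shift.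
set u := phi (y, ev m y + e); set v := phi (y, ev m y).
have -> : p.1 + rho - p.1 = rho by ring.
have -> : (shift m e).2 = m.2 by [].
have em z : ev m z = p.2 + phi p * (z - p.1) by rewrite /m ev_charline.
move=> hh.
have hE : flux phi m (shift m e) p.1 (p.1 + rho) =
   e * (mean (estep rho p) e - mean p e)
   + ((u ^+ 2 / 2 - m.2 * u) - (v ^+ 2 / 2 - m.2 * v)) * rho.
  rewrite -hh /flux /mean /estep /= !ev_shift !em.
  have -> : p.2 + phi p * (p.1 + rho - p.1) = p.2 + phi p * rho by ring.
  have -> : p.2 + phi p * (p.1 - p.1) = p.2 by ring.
  by rewrite mulrBr !mulrA ![e * _]mulrC !mulfK//; ring.
have m2 : m.2 = phi p by [].
have hr : ratio phi x * rho = flux phi m (shift m e) p.1 (p.1 + rho) / e.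
  by rewrite /ratio -/m /pbase /prho -/e /=; field; rewrite e0 rho0.
have yr : `|y - p.1| <= `|rho| by exact: between_add hy.
have Fr : 0 <= F * `|rho| by rewrite mulr_ge0.
have br : 0 <= b ^+ 2 * rho ^+ 2 by rewrite mulr_ge0// ltW.
have Dp : box ctr (2 * r0) p by apply: H; rewrite subrr normr0// addr_ge0.
have hv : `|v - phi p| <= cst_char * `|rho|.
  rewrite /v em; apply: phi_char => //; apply: H => //=.
  rewrite addrAC subrr add0r normrM -[leLHS]addr0 lerD// ler_pM//.
have hv2 : (v - phi p) ^+ 2 <= cst_char ^+ 2 * rho ^+ 2.
  rewrite -[rho ^+ 2]real_normK ?num_real// -exprMn -[leLHS]real_normK ?num_real//.
  by rewrite lerXn2r ?nnegrE ?mulr_ge0 ?cst_char_ge0.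
have ve : e = s * b ^+ 2 * rho ^+ 2 by [].
have -> : s * rho * (ratio phi x * rho - (mean (estep rho p) e - mean p e)) =
   ((u - v) ^+ 2 / 2 - (phi p - v) * (u - v)) / b ^+ 2.
  rewrite hr hE m2.
  have -> : (e * (mean (estep rho p) e - mean p e) +
    (u ^+ 2 / 2 - phi p * u - (v ^+ 2 / 2 - phi p * v)) * rho) / e -
    (mean (estep rho p) e - mean p e) =
    (u ^+ 2 / 2 - phi p * u - (v ^+ 2 / 2 - phi p * v)) * rho / e by field.
  rewrite ve; field.
  by rewrite s0 rho0 gt_eqF.
have h3 : 0 <= (u - v) ^+ 2 / 2 - (phi p - v) * (u - v) + cst_char ^+ 2 * rho ^+ 2 / 2.
  by have := sqr_ge0 ((u - v) - (phi p - v)); lra.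
have -> : rho ^+ 2 * (cst_char ^+ 2 / (2 * b ^+ 2)) =
   (cst_char ^+ 2 * rho ^+ 2 / 2) / b ^+ 2 by field; rewrite gt_eqF.
by rewrite -mulrDl divr_ge0// ltW.
Qed.

Definition epath (rho : R) (p : R * R) (n : nat) : R * R := iter n (estep rho) p.

(** Signed height of P above the characteristic line through p, that is the intrinsic second
    coordinate of P seen from p. *)
Definition defect (p : R * R) : R := P.2 - p.2 - phi p * (P.1 - p.1).

Lemma epath1 rho p n : (epath rho p n).1 = p.1 + n%:R * rho.
Proof.
elim: n => [|n IHn]; first by rewrite mul0r addr0.
by rewrite /epath iterS /estep /= -/(epath rho p n) IHn -natr1; ring.
Qed.

Lemma epath2 rho p n : `|(epath rho p n).2 - p.2| <= n%:R * (F * `|rho|).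
Proof.
elim: n => [|n IHn]; first by rewrite subrr normr0 mul0r.
rewrite /epath iterS /estep /= -/(epath rho p n).
set q := epath rho p n in IHn *.
have -> : q.2 + phi q * rho - p.2 = (q.2 - p.2) + phi q * rho by ring.
apply: le_trans (ler_normD _ _) _; rewrite -natr1 mulrDl mul1r lerD// normrM.
by rewrite ler_wpM2r.
Qed.

(** A step follows the characteristic line, so only the change of slope matters, times the
    horizontal distance left to P. The change is therefore of second order, and zero for a step
    ending on the vertical line of P. *)
Lemma defect_estep rho p :
  defect (estep rho p) = defect p - (phi (estep rho p) - phi p) * (P.1 - (estep rho p).1).
Proof. by rewrite /defect; case: p => y t; rewrite /estep /=; ring. Qed.

(** Summing [euler_step] over strips above (s = 1) and below (s = -1) the polygon bounds the
    increment of the means from both sides. Each step contributes delta + C^2 / (2 b^2), and passing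
    from the means back to [phi] costs K b at each end, all in units of |rho|. *)
Lemma euler_path w : limit_ratio w -> forall (N : nat) (X Y delta : R),
  0 <= X -> 0 <= Y -> 0 < delta ->
  exists2 d : R, 0 < d & forall rho p, rho != 0 -> `|rho| < d ->
    `|P.1 - p.1| <= X * `|rho| -> `|defect p| <= Y * rho ^+ 2 ->
    forall n, (n <= N)%N ->
    [/\ forall q, `|q.1 - (epath rho p n).1| <= `|rho| ->
           `|q.2 - (epath rho p n).2| <= F * `|rho| + b ^+ 2 * rho ^+ 2 -> box ctr (2 * r0) q,
        `|defect (epath rho p n)| <= (Y + n%:R * (cst_char * (X + N%:R))) * rho ^+ 2 &
        `|phi (epath rho p n) - phi p - n%:R * rho * w| <=
          `|rho| * (n%:R * (delta + cst_char ^+ 2 / (2 * b ^+ 2)) + 2 * K * b)].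
Proof.
move=> Hw N X Y delta X0 Y0 delta0.
have b0 : 0 < b by exact: lt_le_trans b1.
have b2 : 1 <= b ^+ 2 by rewrite expr_ge1// ltW.
have N0 : 0 <= N%:R :> R by [].
have c0 := cst_char_ge0.
have cXN : 0 <= cst_char * (X + N%:R) by rewrite mulr_ge0// addr_ge0.
have NcXN : 0 <= N%:R * (cst_char * (X + N%:R)) by rewrite mulr_ge0.
have FX : 0 <= F * X by rewrite mulr_ge0.
have FN : 0 <= N%:R * F by rewrite mulr_ge0.
(* Dominates the horizontal offset, the defect and the height b^2 at every vertex, so that a single
   d works for all strips along the polygon. *)
pose M := X + N%:R + Y + N%:R * (cst_char * (X + N%:R)) + b ^+ 2 + 1.
have [d1 d10 Hd1] := Hw M delta delta0.
(* G |rho| bounds the displacement from P in both coordinates and keeps the strips in the box. *)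
pose G := (X + N%:R + 1) + (Y + F * X + N%:R * F + F + b ^+ 2).
have G0 : 0 < G by rewrite /G; have := F0; lra.
exists (Num.min d1 (Num.min 1 (r0 / G))); first by rewrite !lt_min d10 ltr01 divr_gt0.
move=> rho p rho0; rewrite !lt_min => /and3P[rd rho1 rG] hX hY.
have arho : 0 < `|rho| by rewrite normr_gt0.
have rhoE : rho ^+ 2 = `|rho| ^+ 2 by rewrite real_normK ?num_real.
have rho2 : 0 < rho ^+ 2 by rewrite rhoE exprn_gt0.
have rho2le : rho ^+ 2 <= `|rho| by rewrite rhoE expr2 ler_piMl// ltW.
have Grho : G * `|rho| < r0 by rewrite mulrC -ltr_pdivlMr.
have nN n : (n <= N)%N -> n%:R <= N%:R :> R by rewrite ler_nat.
have pos1 n : (n <= N)%N -> `|P.1 - (epath rho p n).1| <= (X + N%:R) * `|rho|.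
  move=> /nN nN'; rewrite epath1.
  have -> : P.1 - (p.1 + n%:R * rho) = (P.1 - p.1) - n%:R * rho by ring.
  apply: le_trans (ler_normB _ _) _; rewrite normrM normr_nat mulrDl lerD//.
  by rewrite ler_wpM2r.
have hp2 : `|p.2 - P.2| <= (Y + F * X) * `|rho|.
  have -> : p.2 - P.2 = - defect p - phi p * (P.1 - p.1) by rewrite /defect; ring.
  apply: le_trans (ler_normB _ _) _; rewrite normrN normrM mulrDl lerD//.
    by apply: (le_trans hY); rewrite ler_wpM2l.
  by rewrite -mulrA ler_pM.
have inbox n : (n <= N)%N -> forall q, `|q.1 - (epath rho p n).1| <= `|rho| ->
    `|q.2 - (epath rho p n).2| <= F * `|rho| + b ^+ 2 * rho ^+ 2 -> box ctr (2 * r0) q.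
  move=> n_N q q1 q2; apply: (box_near boxP).
    have -> : q.1 - P.1 = (q.1 - (epath rho p n).1) - (P.1 - (epath rho p n).1) by ring.
    apply: le_trans (ler_normB _ _) _; have := pos1 n n_N.
    have : 0 <= (Y + F * X + N%:R * F + F + b ^+ 2) * `|rho|.
      by rewrite mulr_ge0 ?(ltW arho)//; have := F0; lra.
    move: Grho; rewrite /G; lra.
  have -> : q.2 - P.2 = (q.2 - (epath rho p n).2) + ((epath rho p n).2 - p.2) + (p.2 - P.2)
    by ring.
  apply: le_trans (ler_normD _ _) _; apply: le_trans (lerD (ler_normD _ _) hp2) _.
  have e2 : `|(epath rho p n).2 - p.2| <= N%:R * (F * `|rho|).
    by apply: (le_trans (epath2 _ _ _)); rewrite ler_wpM2r ?mulr_ge0// nN.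
  have b2r : b ^+ 2 * rho ^+ 2 <= b ^+ 2 * `|rho| by rewrite ler_wpM2l ?sqr_ge0.
  have : 0 <= (X + N%:R + 1) * `|rho| by rewrite mulr_ge0 ?addr_ge0.
  move: Grho; rewrite /G; lra.
have selfbox n : (n <= N)%N -> box ctr (2 * r0) (epath rho p n).
  move=> n_N; apply: (inbox n n_N); rewrite subrr normr0//.
  by rewrite addr_ge0// mulr_ge0 ?sqr_ge0.
have step n : (n < N)%N -> `|phi (epath rho p n.+1) - phi (epath rho p n)| <= cst_char * `|rho|.
  move=> n_N; set q := epath rho p n.
  have qS : epath rho p n.+1 = (q.1 + rho, q.2 + phi q * (q.1 + rho - q.1)).
    by rewrite /epath iterS -/(epath rho p n) -/q /estep; congr (_, _ + _ * _); ring.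
  rewrite qS; apply: phi_char => //; first exact: selfbox (ltnW n_N).
    by rewrite -qS; exact: selfbox.
  by rewrite addrAC subrr add0r.
have hdef n : (n <= N)%N ->
    `|defect (epath rho p n)| <= (Y + n%:R * (cst_char * (X + N%:R))) * rho ^+ 2.
  elim: n => [_|n IHn n_N]; first by rewrite mul0r addr0.
  have := IHn (ltnW n_N); have := step n n_N; have := pos1 n.+1 n_N.
  rewrite /epath iterS -/(epath rho p n) => h1 h2 h3.
  rewrite defect_estep; apply: le_trans (ler_normB _ _) _.
  have := ler_pM (normr_ge0 _) (normr_ge0 _) h2 h1; rewrite -normrM.
  have -> : cst_char * `|rho| * ((X + N%:R) * `|rho|) = cst_char * (X + N%:R) * rho ^+ 2.
    by rewrite rhoE; ring.
  rewrite -natr1; lra.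
have hdefN n : (n <= N)%N -> `|defect (epath rho p n)| < M * rho ^+ 2.
  move=> n_N; apply: (le_lt_trans (hdef n n_N)); rewrite ltr_pM2r//.
  have := ler_wpM2r cXN (nN n n_N); rewrite /M; have := b2; lra.
have absE s : `|s| = 1 -> `|s * b ^+ 2 * rho ^+ 2| = b ^+ 2 * rho ^+ 2.
  by move=> s1; rewrite -mulrA normrM s1 mul1r ger0_norm// mulr_ge0 ?sqr_ge0.
have rat s n : `|s| = 1 -> (n <= N)%N ->
    `|ratio phi (epath rho p n, rho, s * b ^+ 2 * rho ^+ 2) - w| <= delta.
  move=> s1 n_N; apply: Hd1 => //.
    rewrite /admissible /prho /peps /= absE//; split=> //.
      by rewrite ler_peMl// ltW.
    rewrite ler_wpM2r ?sqr_ge0// /M; move: X0 N0 Y0 NcXN; forget=> *; lra.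
  split; last exact: hdefN.
  apply: le_lt_trans (pos1 n n_N) _; rewrite ltr_pM2r// /M.
  by move: b2 Y0 NcXN; forget=> *; lra.
have sume s n : `|s| = 1 -> (n <= N)%N ->
    s * rho * (mean (epath rho p n) (s * b ^+ 2 * rho ^+ 2) - mean p (s * b ^+ 2 * rho ^+ 2)
               - n%:R * rho * w)
    <= rho ^+ 2 * (n%:R * (delta + cst_char ^+ 2 / (2 * b ^+ 2))).
  move=> s1; elim: n => [_|n IHn n_N].
    by rewrite /epath /= subrr !mul0r subrr !mulr0.
  have := IHn (ltnW n_N).
  have := @euler_step s rho (epath rho p n) s1 rho0 (inbox n (ltnW n_N)).
  have := rat s n s1 (ltnW n_N).
  rewrite (_ : epath rho p n.+1 = estep rho (epath rho p n))//.
  set rr := ratio _ _; set m1 := mean (estep _ _) _; set m := mean (epath _ _ _) _.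
  set m0 := mean p _ => h1 h2 h3.
  have h4 : s * rho ^+ 2 * (rr - w) <= rho ^+ 2 * delta.
    apply: (le_trans (ler_norm _)); rewrite normrM (normrM s) s1 mul1r (gtr0_norm rho2).
    by rewrite ler_pM2l.
  by rewrite -natr1; move: h1 h2 h3 h4; forget=> *; lra.
move=> n n_N; split; [exact: inbox|exact: hdef|].
have app s k : `|s| = 1 -> (k <= N)%N ->
    `|mean (epath rho p k) (s * b ^+ 2 * rho ^+ 2) - phi (epath rho p k)| <= K * b * `|rho|.
  move=> s1 k_N.
  have ae : `|s * b ^+ 2 * rho ^+ 2| = (b * `|rho|) ^+ 2.
    by rewrite absE// exprMn -rhoE.
  apply: le_trans (mean_approx _ _) _.
  - by rewrite -normr_gt0 ae exprn_gt0// mulr_gt0.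
  - move=> t /between_add ht; apply: (inbox k k_N) => /=; first by rewrite subrr normr0.
    apply: (le_trans ht); rewrite ae exprMn -rhoE lerDr.
    by rewrite mulr_ge0.
  - by rewrite ae sqrtr_sqr ger0_norm ?mulr_ge0 ?(ltW b0)// mulrA.
set Z := phi _ - phi p - _; set W := n%:R * _ + 2 * K * b.
have sZ s : `|s| = 1 -> s * rho * Z <= rho ^+ 2 * W.
  move=> s1; have := sume s n s1 n_N.
  have := app s n s1 n_N; have := app s 0%N s1 isT.
  rewrite {2 3}/epath /= => h1 h2 h3.
  have h4 : s * rho * ((mean p (s * b ^+ 2 * rho ^+ 2) - phi p)
      - (mean (epath rho p n) (s * b ^+ 2 * rho ^+ 2) - phi (epath rho p n))) <=
      `|rho| * (2 * K * b * `|rho|).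
    apply: (le_trans (ler_norm _)); rewrite !normrM s1 mul1r ler_pM2l//.
    by apply: le_trans (ler_normB _ _) _; move: h1 h2; forget=> *; lra.
  have -> : rho ^+ 2 * W = rho ^+ 2 * (n%:R * (delta + cst_char ^+ 2 / (2 * b ^+ 2)))
     + `|rho| * (2 * K * b * `|rho|) by rewrite /W [in LHS]mulrDr rhoE; ring.
  by rewrite /Z; move: h3 h4; forget=> *; lra.
have Z1 := sZ 1 (normr1 R); have Z2 := sZ (-1) (normrN1 R).
rewrite -(ler_pM2l arho) mulrA -expr2 -rhoE -normrM ler_norml.
by move: Z1 Z2; forget=> *; apply/andP; split; lra.
Qed.

End euler.

(** * Differentiability at the good points *)

Lemma discrete_crossing (R : realType) (v : nat -> R) (c : R) n : 0 <= c ->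
  0 <= v 0%N -> v n <= 0 -> (forall k, (k < n)%N -> v k - c <= v k.+1) ->
  exists2 k, (k <= n)%N & 0 <= v k <= c.
Proof.
move=> c0 v0; elim: n => [|n IHn] vn step.
  by exists 0%N => //; rewrite v0 (le_trans vn).
have [h|h] := leP 0 (v n).
  by exists n; rewrite ?leqnSn// h /=; have := step n (ltnSn n); lra.
have [||k kn hk] := IHn; first exact: ltW.
  by move=> k kn; apply: step; exact: ltnW.
by exists k => //; exact: ltnW.
Qed.

Section differentiability.
Variable R : realType.
Variables (phi : R * R -> R) (K F r0 : R) (ctr : R * R).
Hypothesis cphi : continuous phi.
Hypothesis r0_gt0 : 0 < r0.
Hypothesis K0 : 0 < K.
Hypothesis phiF : forall p, `|phi p| <= F.
Hypothesis phiK : forall A B, box ctr (2 * r0) A -> box ctr (2 * r0) B ->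
  `|phi A - phi B| <= K * graph_dist phi A B.
Variable P : R * R.
Hypothesis boxP : box ctr r0 P.
Variable w : R.
Hypothesis limw : limit_ratio phi P w.

Local Notation C1 := (cst_char K).

Local Ltac forget := clear - cphi r0_gt0 K0 phiF phiK boxP limw.

(* Two Euler polygons started on the same vertical line, with slopes differing by more
   than eps * r / 2 all along, would have to cross within distance of order r / eps;
   but where they come close the intrinsic Lipschitz bound makes their slopes close. *)
Lemma vertical_estimate (eps Z : R) : 0 < eps -> 0 < Z ->
  exists2 r1 : R, 0 < r1 & forall r t, 0 < r -> r < r1 ->
    `|t - P.2| <= Z * r ^+ 2 -> `|phi (P.1, t) - phi P| <= eps * r.
Proof.
move=> eps0 Z0; have F0 : 0 <= F := bound_ge0 phiF.
have C10 : 0 <= C1 by exact: cst_char_ge0.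
(* A gap of Z r^2 closing at slope at least eps r / 2 is exhausted after a distance 2 Z r / eps; R0
   r bounds the length of N steps. *)
pose R0 := 2 * Z / eps + 1.
have R01 : 1 <= R0 by rewrite /R0 lerDr divr_ge0 ?mulr_ge0// ltW.
have R0p : 0 < R0 by lra.
pose delta := eps / (16 * R0).
have delta0 : 0 < delta by rewrite divr_gt0// mulr_gt0.
pose b := 1 + C1 + 8 * R0 * C1 / eps.
have b1 : 1 <= b.
  by rewrite /b -addrA lerDl addr_ge0// divr_ge0 ?mulr_ge0 ?(ltW R0p)// ltW.
have b0 : 0 < b by lra.
have hb : R0 * (C1 ^+ 2 / (2 * b ^+ 2)) <= eps / 16.
  rewrite mulrA ler_pdivrMr ?mulr_gt0 ?exprn_gt0//.
  have h1 : C1 <= b.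
    rewrite /b; have : 0 <= 8 * R0 * C1 / eps by rewrite divr_ge0 ?mulr_ge0 ?(ltW R0p)// ltW.
    lra.
  have h2 : 8 * R0 * C1 <= b * eps.
    rewrite /b [leRHS]mulrDl divfK ?gt_eqF// lerDr mulr_ge0 ?(ltW eps0)//; lra.
  have := ler_pM _ C10 h2 h1; rewrite !mulr_ge0 ?(ltW R0p)// => /(_ isT); lra.
(* Step length in units of r. The first quotient keeps the end error 2 K b kap below eps / 16; the
   second makes the bound |D| <= 6 K^2 kap r obtained at the crossing incompatible with |D| > eps
   r. *)
pose kap := Num.min 1 (Num.min (eps / (32 * K * b)) (eps / (12 * K ^+ 2))).
have Kb : 0 < 32 * K * b by rewrite !mulr_gt0.
have K2 : 0 < 12 * K ^+ 2 by rewrite mulr_gt0// exprn_gt0.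
have kap0 : 0 < kap by rewrite !lt_min ltr01 !divr_gt0.
have kap1 : kap <= 1 by rewrite ge_min lexx.
have kapb : kap * (32 * K * b) <= eps by rewrite -ler_pdivlMr// !ge_min lexx !orbT.
have kapK : kap * (12 * K ^+ 2) <= eps by rewrite -ler_pdivlMr// !ge_min lexx !orbT.
pose N := (Num.truncn (2 * Z / (eps * kap))).+1.
have ek : 0 < eps * kap by rewrite mulr_gt0.
have N1 : 2 * Z < N%:R * (eps * kap) by rewrite -ltr_pdivrMr//; exact: truncnS_gt.
have N2 : N%:R * kap <= R0.
  have : (Num.truncn (2 * Z / (eps * kap)))%:R <= 2 * Z / (eps * kap).
    by rewrite truncn_le// divr_ge0 ?mulr_ge0// ltW.
  move=> /(ler_wpM2r (ltW kap0)).
  have -> : 2 * Z / (eps * kap) * kap = 2 * Z / eps by field; rewrite !gt_eqF.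
  by rewrite /N /R0 -natr1; lra.
pose Y := Z / kap ^+ 2.
have kap2 : 0 < kap ^+ 2 by exact: exprn_gt0.
have Y0 : 0 <= Y by rewrite divr_ge0 ?(ltW kap2)// ltW.
have [d d0 Hd] := euler_path cphi r0_gt0 K0 phiF phiK boxP b1 limw N (lexx 0) Y0 delta0.
exists (d / kap); first by rewrite divr_gt0.
move=> r t r_gt0 rd ht; rewrite leNgt; apply/negP => hD.
pose B := (P.1, t); pose D := phi B - phi P; pose D0 := t - P.2.
have nD : eps * r < `|D| by [].
pose tau : R := if 0 <= D then 1 else -1.
have tauD : tau * D = `|D|.
  by rewrite /tau; case: (leP 0 D) => h; [rewrite mul1r ger0_norm|rewrite mulN1r ltr0_norm].
have tau1 : `|tau| = 1 by rewrite /tau; case: ifP; rewrite ?normrN normr1.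
have tautau : tau * tau = 1 by rewrite /tau; case: ifP => _; ring.
pose c : R := if 0 <= D0 then 1 else -1.
have cD0 : c * D0 = `|D0|.
  by rewrite /c; case: (leP 0 D0) => h; [rewrite mul1r ger0_norm|rewrite mulN1r ltr0_norm].
have c1 : `|c| = 1 by rewrite /c; case: ifP; rewrite ?normrN normr1.
have cc : c * c = 1 by rewrite /c; case: ifP => _; ring.
(* The direction in which the polygons approach each other: backwards if the gap and the slope
   difference have the same sign. *)
pose rho := - (c * tau) * (kap * r).
have kr0 : 0 < kap * r by rewrite mulr_gt0.
have arho : `|rho| = kap * r by rewrite normrM normrN normrM c1 tau1 !mul1r gtr0_norm.
have rho0 : rho != 0 by rewrite -normr_gt0 arho.
have rhod : `|rho| < d by rewrite arho mulrC -ltr_pdivlMr.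
have rho2 : rho ^+ 2 = kap ^+ 2 * r ^+ 2 by rewrite -real_normK ?num_real// arho exprMn.
have HP := Hd rho P rho0 rhod; have HB := Hd rho B rho0 rhod.
rewrite !subrr normr0 mul0r lexx in HP HB.
have {}HP := HP isT _; have {}HB := HB isT _.
have dP : `|defect phi P P| <= Y * rho ^+ 2.
  by rewrite /defect !subrr mulr0 subr0 normr0 mulr_ge0// sqr_ge0.
have dB : `|defect phi P B| <= Y * rho ^+ 2.
  rewrite /defect /B /= subrr mulr0 subr0 distrC rho2 /Y mulrA divfK ?gt_eqF//.
have {}HP := HP dP; have {}HB := HB dB.
pose pP k := epath phi rho P k; pose pB k := epath phi rho B k.
(* The errors of the two polygons together are at most 2 E <= |D| / 2, so the slope difference keeps
   its sign and at least half of its size. *)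
pose E := eps * r / 4.
have hE n : (n <= N)%N -> `|rho| * (n%:R * (delta + C1 ^+ 2 / (2 * b ^+ 2)) + 2 * K * b) <= E.
  move=> nN; rewrite arho.
  have q0 : 0 <= delta + C1 ^+ 2 / (2 * b ^+ 2).
    by rewrite addr_ge0 ?(ltW delta0)// divr_ge0 ?sqr_ge0// mulr_ge0 ?sqr_ge0.
  have nk : n%:R * kap <= R0.
    by apply: le_trans N2; rewrite ler_wpM2r ?(ltW kap0)// ler_nat.
  have h1 := ler_wpM2r q0 nk.
  have h2 : R0 * delta = eps / 16 by rewrite /delta; field; rewrite gt_eqF.
  have -> : kap * r * (n%:R * (delta + C1 ^+ 2 / (2 * b ^+ 2)) + 2 * K * b) =
     r * (n%:R * kap * (delta + C1 ^+ 2 / (2 * b ^+ 2)) + kap * (2 * K * b)) by ring.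
  have -> : E = r * (eps / 4) by rewrite /E; ring.
  rewrite ler_pM2l//; move: h1 h2 hb kapb eps0; forget=> *; lra.
pose g k := tau * (phi (pB k) - phi (pP k)).
have hg k : (k <= N)%N -> `|D| / 2 <= g k <= 3 / 2 * `|D|.
  move=> kN; have [_ _ e1] := HP k kN; have [_ _ e2] := HB k kN.
  have := le_trans e1 (hE k kN); have := le_trans e2 (hE k kN).
  rewrite -/(pP k) -/(pB k) => h2 h1.
  have : `|g k - `|D| | <= 2 * E.
    have -> : g k - `|D| = tau * ((phi (pB k) - phi B - k%:R * rho * w)
                - (phi (pP k) - phi P - k%:R * rho * w)) by rewrite -tauD /g /D; ring.
    rewrite normrM tau1 mul1r; apply: le_trans (ler_normB _ _) _.
    by move: h1 h2; forget=> *; lra.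
  have : 2 * E <= `|D| / 2 by rewrite /E; move: nD; forget=> *; lra.
  by forget=> + /ler_normlP[]; move=> *; apply/andP; split; lra.
pose v k := c * ((pB k).2 - (pP k).2).
have vS k : v k.+1 = v k - kap * r * g k.
  rewrite /v /g (_ : pB k.+1 = estep phi rho (pB k))// (_ : pP k.+1 = estep phi rho (pP k))//.
  rewrite /estep /= /rho.
  transitivity (c * ((pB k).2 - (pP k).2) -
    c * c * tau * (kap * r) * (phi (pB k) - phi (pP k))); first by ring.
  by rewrite cc; ring.
have D00 : 0 <= `|D| by [].
have v0 : v 0%N = `|D0| by rewrite /v /pB /pP /epath /= -cD0.
have vbound k : (k <= N)%N -> v k <= v 0%N - k%:R * (kap * r * (`|D| / 2)).
  elim: k => [|k IHk] kN; first by rewrite mul0r subr0.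
  have /andP[h _] := hg k (ltnW kN).
  have := IHk (ltnW kN); have := ler_wpM2l (ltW kr0) h; rewrite vS -natr1; forget=> *; lra.
have vN : v N <= 0.
  apply: (le_trans (vbound N (leqnn N))); rewrite v0 subr_le0.
  apply: (le_trans ht).
  have -> : N%:R * (kap * r * (`|D| / 2)) = N%:R * kap * r * `|D| / 2 by field.
  have h : N%:R * kap * r * (eps * r) <= N%:R * kap * r * `|D|.
    by rewrite ler_wpM2l ?(ltW nD)// !mulr_ge0// ltW.
  by have := ler_wpM2r (sqr_ge0 r) (ltW N1); move: h; forget=> *; lra.
have cst0 : 0 <= kap * r * (3 / 2 * `|D|) by rewrite !mulr_ge0// ltW.
have [||k kN /andP[k1 k2]] := @discrete_crossing R v (kap * r * (3 / 2 * `|D|)) N cst0 _ vN.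
- by rewrite v0.
- move=> k kN; rewrite vS lerD2l lerN2 ler_wpM2l ?(ltW kr0)//.
  by have /andP[] := hg k (ltnW kN).
have [bxP _ _] := HP k kN; have [bxB _ _] := HB k kN.
have zz : 0 <= F * `|rho| + b ^+ 2 * rho ^+ 2 by apply: addr_ge0; apply: mulr_ge0; rewrite ?sqr_ge0.
have {}bxP : box ctr (2 * r0) (pP k) by apply: bxP; rewrite subrr normr0.
have {}bxB : box ctr (2 * r0) (pB k) by apply: bxB; rewrite subrr normr0.
have same : (pB k).1 = (pP k).1 by rewrite /pB /pP !epath1.
rewrite [pP k]surjective_pairing in bxP; rewrite [pB k]surjective_pairing same in bxB.
have := phi_vert phiK bxP bxB; rewrite -{1}same -!surjective_pairing => hk.
set X := `|_ - (pP k).2| in hk.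
have hX : X <= kap * r * (3 / 2 * `|D|).
  by apply: le_trans k2; rewrite -[leLHS]mul1r -c1 -normrM ger0_norm.
have /andP[g1 _] := hg k kN.
have g2 : g k <= K * Num.sqrt X.
  by apply: (le_trans (ler_norm _)); rewrite /g normrM tau1 mul1r.
have g3 : (`|D| / 2) ^+ 2 <= K ^+ 2 * X.
  have -> : K ^+ 2 * X = (K * Num.sqrt X) ^+ 2 by rewrite exprMn sqr_sqrtr ?normr_ge0.
  have q0 : 0 <= `|D| / 2 by rewrite divr_ge0.
  by rewrite !expr2; apply: ler_pM => //; exact: le_trans g2.
have g4 := ler_wpM2l (sqr_ge0 K) hX.
have Dp : 0 < `|D| by apply: le_lt_trans nD; rewrite mulr_ge0// ltW.
have g5 : `|D| <= 6 * K ^+ 2 * (kap * r).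
  by rewrite -(ler_pM2r Dp); move: g3 g4; forget=> *; lra.
by have := ler_wpM2r (ltW r_gt0) kapK; move: g5 nD Dp; forget=> *; lra.
Qed.

Lemma graph_estimate (eps : R) : 0 < eps ->
  exists2 r1 : R, 0 < r1 & forall B, box ctr (2 * r0) B ->
    0 < graph_dist phi P B -> graph_dist phi P B < r1 ->
    `|phi B - phi P - w * (B.1 - P.1)| <= eps * graph_dist phi P B.
Proof.
move=> eps0; have F0 : 0 <= F := bound_ge0 phiF.
have C10 : 0 <= C1 by exact: cst_char_ge0.
pose delta := eps / 16.
have delta0 : 0 < delta by rewrite divr_gt0.
pose b := 1 + C1 + 8 * C1 / eps.
have Ce : 0 <= 8 * C1 / eps by rewrite divr_ge0 ?mulr_ge0// ltW.
have b1 : 1 <= b by rewrite /b; lra.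
have b0 : 0 < b by lra.
have hb : C1 ^+ 2 / (2 * b ^+ 2) <= eps / 16.
  rewrite ler_pdivrMr ?mulr_gt0 ?exprn_gt0//.
  have h1 : C1 <= b by rewrite /b; lra.
  have h2 : 8 * C1 <= b * eps.
    rewrite /b [leRHS]mulrDl divfK ?gt_eqF// lerDr mulr_ge0 ?(ltW eps0)//; lra.
  have := ler_pM _ C10 h2 h1; rewrite mulr_ge0// => /(_ isT); lra.
(* The costs proportional to kap: the variation of [phi] on the last partial step, the means at both
   ends of the polygon, and w times the length of that last step. *)
pose G := C1 + 2 * K * b + `|w|.
have Kb : 0 < 2 * K * b by rewrite !mulr_gt0.
have G0 : 0 < G by rewrite /G; have := normr_ge0 w; lra.
pose kap := Num.min 1 (eps / (8 * G)).
have G8 : 0 < 8 * G by rewrite mulr_gt0.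
have kap0 : 0 < kap by rewrite !lt_min ltr01 divr_gt0.
have kap1 : kap <= 1 by rewrite ge_min lexx.
have kapG : kap * (8 * G) <= eps by rewrite -ler_pdivlMr// ge_min lexx orbT.
have kap2 : 0 < kap ^+ 2 by exact: exprn_gt0.
pose N := (Num.truncn kap^-1).+1.
have N1 : kap^-1 < N%:R by exact: truncnS_gt.
have N2 : N%:R * kap <= 2.
  have : (Num.truncn kap^-1)%:R <= kap^-1 by rewrite truncn_le// invr_ge0 ltW.
  by move=> /(ler_wpM2r (ltW kap0)); rewrite mulVf ?gt_eqF// /N -natr1; lra.
(* Up to sign, the defect at B differs from the quantity under the root in [graph_dist] by half of
   (phi P - phi B) times the horizontal offset, hence by at most K r^2 / 2. *)
pose X := kap^-1; pose Y := (1 + K / 2) / kap ^+ 2.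
have X0 : 0 <= X by rewrite invr_ge0 ltW.
have Y0 : 0 <= Y by rewrite divr_ge0 ?(ltW kap2)//; have := K0; lra.
have [d d0 Hd] := euler_path cphi r0_gt0 K0 phiF phiK boxP b1 limw N X0 Y0 delta0.
have cXN : 0 <= C1 * (X + N%:R) by rewrite mulr_ge0// addr_ge0.
pose Z := (Y + N%:R * (C1 * (X + N%:R))) * kap ^+ 2 + 1.
have Z0 : 0 < Z by rewrite /Z ltr_wpDl// mulr_ge0 ?(ltW kap2)// addr_ge0// mulr_ge0.
have [r2 r20 Hr2] := @vertical_estimate (eps / 4) Z ltac:(lra) Z0.
exists (Num.min r2 (d / kap)); first by rewrite lt_min r20 divr_gt0.
move=> B boxB; have boxP2 : box ctr (2 * r0) P.
  by apply: (box_near boxP); rewrite subrr normr0 ltW.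
have := phiK boxP2 boxB; have : graph_dist phi P B = graph_dist phi P B by [].
rewrite {1}/graph_dist; set r := graph_dist phi P B.
set S := Num.sqrt _ => rE hK r_gt0; rewrite lt_min => /andP[rr2 rd].
have S0 : 0 <= S by exact: sqrtr_ge0.
have y_r : `|P.1 - B.1| <= r by rewrite -rE lerDl.
have Sr : S <= r by rewrite -rE lerDr.
have S2 : `|B.2 - P.2 - 2^-1 * (phi P + phi B) * (B.1 - P.1)| <= r ^+ 2.
  have := sqr_sqrtr (normr_ge0 (B.2 - P.2 - 2^-1 * (phi P + phi B) * (B.1 - P.1))).
  by rewrite -/S => <-; rewrite !expr2 ler_pM.
pose al := P.1 - B.1.
pose s : R := if 0 <= al then 1 else -1.
have sal : s * `|al| = al.
  by rewrite /s; case: (leP 0 al) => h; [rewrite mul1r ger0_norm|rewrite mulN1r ltr0_norm// opprK].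
have s1 : `|s| = 1 by rewrite /s; case: ifP; rewrite ?normrN normr1.
have kr0 : 0 < kap * r by rewrite mulr_gt0.
pose rho := s * (kap * r).
have arho : `|rho| = kap * r by rewrite normrM s1 mul1r gtr0_norm.
have rho0 : rho != 0 by rewrite -normr_gt0 arho.
have rhod : `|rho| < d by rewrite arho mulrC -ltr_pdivlMr.
have rho2 : rho ^+ 2 = kap ^+ 2 * r ^+ 2 by rewrite -real_normK ?num_real// arho exprMn.
pose n := Num.truncn (`|al| / (kap * r)).
have n1 : n%:R * (kap * r) <= `|al|.
  by rewrite -ler_pdivlMr// truncn_le// divr_ge0// ltW.
have n2 : `|al| < n.+1%:R * (kap * r) by rewrite -ltr_pdivrMr//; exact: truncnS_gt.
have nN : (n <= N)%N.
  rewrite ltnW// -(ltr_nat R); apply: le_lt_trans N1.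
  rewrite -(ler_pM2r kr0) [leRHS]mulrA mulVf ?gt_eqF// mul1r.
  exact: le_trans y_r.
have hX : `|P.1 - B.1| <= X * `|rho| by rewrite arho mulrA mulVf ?mul1r// gt_eqF.
have hY : `|defect phi P B| <= Y * rho ^+ 2.
  rewrite rho2 /Y mulrA divfK ?gt_eqF// /defect.
  have -> : P.2 - B.2 - phi B * (P.1 - B.1) =
     - (B.2 - P.2 - 2^-1 * (phi P + phi B) * (B.1 - P.1)) + (phi P - phi B) * (P.1 - B.1) / 2.
    by field.
  apply: le_trans (ler_normD _ _) _; rewrite normrN [(1 + _) * _]mulrDl mul1r lerD//.
  have := ler_pM (normr_ge0 _) (normr_ge0 _) hK y_r; rewrite -normrM.
  by forget=> hh; rewrite normrM [`|2^-1|]ger0_norm//; lra.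
have [ibox hdef hphi] := Hd rho B rho0 rhod hX hY n nN.
set B' := epath phi rho B n in ibox hdef hphi.
pose al' := P.1 - B'.1.
have al'E : al' = al - n%:R * rho by rewrite /al' /B' epath1 /al; ring.
have al'r : `|al'| <= kap * r.
  have -> : al' = s * (`|al| - n%:R * (kap * r)) by rewrite al'E -{1}sal /rho; ring.
  rewrite normrM s1 mul1r ger0_norm; last by rewrite subr_ge0.
  by move: n2; rewrite -natr1; forget=> *; lra.
(* One last step of length at most kap r lands exactly on the vertical line of P; it leaves the
   defect unchanged, and there the defect is the vertical distance to P. *)
pose B'' := estep phi al' B'.
have B''1 : B''.1 = P.1 by rewrite /B'' /estep /al' /=; ring.
have zz : 0 <= b ^+ 2 * rho ^+ 2 by rewrite mulr_ge0// sqr_ge0.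
have Fr : 0 <= F * `|rho| by rewrite mulr_ge0.
have bB' : box ctr (2 * r0) B' by apply: ibox; rewrite subrr normr0// addr_ge0.
have bB'' : box ctr (2 * r0) B''.
  apply: ibox; rewrite /B'' /estep /=.
    by rewrite addrAC subrr add0r arho.
  rewrite addrAC subrr add0r normrM -[leLHS]addr0 lerD// ler_pM// arho//.
have h1 : `|phi B'' - phi B'| <= C1 * (kap * r).
  have e : B'' = (B'.1 + al', B'.2 + phi B' * (B'.1 + al' - B'.1)).
    by rewrite /B'' /estep; congr (_, _ + _ * _); ring.
  rewrite e; apply: (phi_char K0 phiK) => //; first by rewrite -e.
  by rewrite addrAC subrr add0r.
have hd : defect phi P B'' = P.2 - B''.2 by rewrite /defect B''1 subrr mulr0 subr0.
have hd' : defect phi P B'' = defect phi P B'.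
  by rewrite defect_estep -/B'' B''1 subrr mulr0 subr0.
have h2 : `|B''.2 - P.2| <= Z * r ^+ 2.
  rewrite distrC -hd hd'; apply: (le_trans hdef); rewrite rho2 (mulrA _ (kap ^+ 2)).
  rewrite ler_wpM2r ?sqr_ge0// /Z.
  have : (Y + n%:R * (C1 * (X + N%:R))) * kap ^+ 2 <= (Y + N%:R * (C1 * (X + N%:R))) * kap ^+ 2.
    by rewrite ler_wpM2r ?(ltW kap2)// lerD2l ler_wpM2r// ler_nat.
  by forget=> *; lra.
have h3 := Hr2 r B''.2 r_gt0 rr2 h2.
rewrite -B''1 -surjective_pairing in h3.
have -> : phi B - phi P - w * (B.1 - P.1) = (phi B'' - phi P) - (phi B'' - phi B')
   - (phi B' - phi B - n%:R * rho * w) + w * al' by rewrite al'E /al; ring.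
apply: le_trans (ler_normD _ _) _; rewrite [`|w * _|]normrM.
apply: le_trans (lerD (ler_normB _ _) (ler_wpM2l (normr_ge0 w) al'r)) _.
apply: le_trans (lerD (lerD (ler_normB _ _) hphi) (lexx _)) _.
apply: le_trans (lerD (lerD (lerD h3 h1) (lexx _)) (lexx _)) _.
rewrite arho.
have q0 : 0 <= delta + C1 ^+ 2 / (2 * b ^+ 2).
  by rewrite addr_ge0 ?(ltW delta0)// divr_ge0 ?sqr_ge0// mulr_ge0 ?sqr_ge0.
have nk : n%:R * kap <= 2.
  by apply: le_trans N2; rewrite ler_wpM2r ?(ltW kap0)// ler_nat.
have h4 := ler_wpM2r q0 nk.
have -> : eps / 4 * r + C1 * (kap * r)
   + kap * r * (n%:R * (delta + C1 ^+ 2 / (2 * b ^+ 2)) + 2 * K * b) + `|w| * (kap * r) =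
   (eps / 4 + kap * G + n%:R * kap * (delta + C1 ^+ 2 / (2 * b ^+ 2))) * r by rewrite /G; ring.
by rewrite ler_pM2r//; move: h4 hb kapG eps0; rewrite /delta; forget=> *; lra.
Qed.

End differentiability.

(** * Localization *)

Section clamp.
Variable R : realType.

Definition clamp (a r x : R) : R := Num.max (a - r) (Num.min x (a + r)).

Lemma clamp_id (a r x : R) : `|x - a| <= r -> clamp a r x = x.
Proof.
rewrite ler_norml /clamp => /andP[h1 h2].
have h3 : x <= a + r by lra.
have h4 : a - r <= x by lra.
by rewrite (min_idPl h3) (max_idPr h4).
Qed.

Lemma clamp_le (a r x : R) : 0 <= r -> `|clamp a r x - a| <= r.
Proof.
move=> r0; rewrite /clamp ler_norml.
by case: (leP x (a + r)) => h; [case: (leP (a - r) x)|case: (leP (a - r) (a + r))] => h';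
  apply/andP; split; lra.
Qed.

Lemma clamp_lipschitz (a r x y : R) : 0 <= r ->
  `|clamp a r x - clamp a r y| <= `|x - y|.
Proof.
move=> r0; rewrite /clamp ler_norml.
have := ler_norm (x - y); have := ler_norm (- (x - y)); rewrite normrN.
have e : a - r <= a + r by lra.
case: (leP x (a + r)) => h; case: (leP y (a + r)) => h'; rewrite ?(max_idPr e);
  case: (leP (a - r) x) => h''; case: (leP (a - r) y) => h''' ? ?; apply/andP; split; lra.
Qed.

Definition clamp2 (c : R * R) (r : R) (p : R * R) : R * R :=
  (clamp c.1 r p.1, clamp c.2 r p.2).

Lemma clamp2_box c r p : 0 <= r -> box c r (clamp2 c r p).
Proof. by move=> r0; split; exact: clamp_le. Qed.

Lemma clamp2_id c r p : box c r p -> clamp2 c r p = p.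
Proof. by case: p => y t [h1 h2]; rewrite /clamp2 !clamp_id. Qed.

Lemma near_squareP (A : R * R) (Q : R * R -> Prop) :
  (exists2 e : R, 0 < e & forall B, `|B.1 - A.1| < e -> `|B.2 - A.2| < e -> Q B) ->
  \forall B \near A, Q B.
Proof.
move=> [e e0 H]; apply/nbhs_ballP; exists e => //= B [h1 h2].
by apply: H; rewrite distrC.
Qed.

End clamp.

Section local.
Variable R : realType.
Variables (phi : R * R -> R) (K r0 : R) (ctr : R * R).
Hypothesis r0_gt0 : 0 < r0.
Hypothesis K0 : 0 < K.
Hypothesis phiK : forall A B, box ctr (2 * r0) A -> box ctr (2 * r0) B ->
  `|phi A - phi B| <= K * graph_dist phi A B.

Local Notation plane := (measurableTypeR R * measurableTypeR R)%type.
Local Notation plane_measure := (@lebesgue_measure R \x @lebesgue_measure R)%E.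

(** The flux requires a continuous bounded function on the whole plane, while [phi] is controlled
    only on a square; projecting onto the square supplies one. The intrinsic Lipschitz bound is kept
    on the square only, which is where the preceding sections assume it. *)
Definition clamped (p : R * R) : R := phi (clamp2 ctr (2 * r0) p).

Let r2 : 0 <= 2 * r0.
Proof. by have := r0_gt0; lra. Qed.

Lemma continuous_clamped : continuous clamped.
Proof.
move=> A; apply/cvgrPdist_le => e e0.
set C := clamp2 ctr (2 * r0) A.
have boxC : box ctr (2 * r0) C by exact: clamp2_box.
have k0 : 0 < 2 * K + K ^+ 2 + 1.
  by have := sqr_ge0 K; have := K0; lra.
pose r := e / (2 * K + K ^+ 2 + 1).
have r_gt0 : 0 < r by rewrite divr_gt0.
have r2_gt0 : 0 < r ^+ 2 by exact: exprn_gt0.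
have f0 : 0 < 1 + `|phi C| by rewrite ltr_pwDl.
apply: near_squareP; exists (Num.min r (r ^+ 2 / (1 + `|phi C|))).
  by rewrite lt_min r_gt0 divr_gt0.
move=> B; rewrite !lt_min => /andP[y1 y2] /andP[_ t2].
rewrite distrC /clamped -/C; set D := clamp2 _ _ B.
have boxD : box ctr (2 * r0) D by exact: clamp2_box.
have h1 : `|D.1 - C.1| <= `|B.1 - A.1| by exact: clamp_lipschitz.
have h2 : `|D.2 - C.2| <= `|B.2 - A.2| by exact: clamp_lipschitz.
have -> : e = (2 * K + K ^+ 2 + 1) * r by rewrite /r mulrC divfK// gt_eqF.
apply: (phi_near K0 phiK boxC boxD r_gt0) => //.
  exact: le_trans h1 (ltW y1).
rewrite mul1r; apply: le_trans (ler_normB _ _) _; rewrite normrM.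
have h3 := ltW (le_lt_trans h1 y2); have h4 := ltW (le_lt_trans h2 t2).
have : r ^+ 2 / (1 + `|phi C|) * (1 + `|phi C|) = r ^+ 2 by rewrite divfK// gt_eqF.
have := ler_wpM2l (normr_ge0 (phi C)) h3; lra.
Qed.

Lemma clamped_bounded : exists F, forall p, `|clamped p| <= F.
Proof.
pose r := 2 * r0; have r_gt0 : 0 < r by rewrite mulr_gt0.
have boxc : box ctr (2 * r0) ctr by rewrite /box/= !subrr normr0.
pose a := (1 + `|phi ctr|) * r / r ^+ 2.
have a0 : 0 <= a by rewrite divr_ge0 ?sqr_ge0// mulr_ge0 ?(ltW r_gt0)// addr_ge0.
exists (`|phi ctr| + (2 * K + K ^+ 2 + a) * r) => p.
have [h1 h2] := clamp2_box ctr p r2.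
have := phi_near K0 phiK boxc (clamp2_box ctr p r2) r_gt0 a0 h1.
rewrite /clamped => /(_ _) h.
rewrite -[phi (clamp2 _ _ _)](subrK (phi ctr)) addrC.
apply: le_trans (ler_normD _ _) _; rewrite lerD2l; apply: h.
have -> : a * r ^+ 2 = r + `|phi ctr| * r by rewrite /a; field; rewrite gt_eqF.
apply: le_trans (ler_normB _ _) _; rewrite lerD// normrM ler_wpM2l//.
Qed.

Lemma clamped_id p : box ctr (2 * r0) p -> clamped p = phi p.
Proof. by move=> h; rewrite /clamped clamp2_id. Qed.

Lemma graph_dist_clamped A B : box ctr (2 * r0) A -> box ctr (2 * r0) B ->
  graph_dist clamped A B = graph_dist phi A B.
Proof. by move=> hA hB; rewrite /graph_dist !clamped_id. Qed.

Lemma clamped_lipschitz A B : box ctr (2 * r0) A -> box ctr (2 * r0) B ->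
  `|clamped A - clamped B| <= K * graph_dist clamped A B.
Proof. by move=> hA hB; rewrite graph_dist_clamped// !clamped_id//; exact: phiK. Qed.

Lemma graph_dist_gt0 (f : R * R -> R) (A B : R * R) : A != B -> 0 < graph_dist f A B.
Proof.
move=> AB; rewrite /graph_dist; set S := Num.sqrt _.
have S0 : 0 <= S by exact: sqrtr_ge0.
have [e|ne] := eqVneq A.1 B.1; last first.
  by rewrite ltr_pwDl// normr_gt0 subr_eq0.
rewrite ltr_wpDl// sqrtr_gt0 normr_gt0 e subrr mulr0 subr0 subr_eq0.
apply: contra AB => /eqP e2; apply/eqP.
by rewrite [A]surjective_pairing [B]surjective_pairing e e2.
Qed.

Lemma graph_dist_near (f : R * R -> R) F (A : R * R) (e : R) : 0 < e ->
  (forall p, `|f p| <= F) -> \forall B \near A, graph_dist f A B < e.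
Proof.
move=> e0 fF; have F0 : 0 <= F := bound_ge0 fF.
have f1 : 0 < 1 + F by rewrite ltr_pwDl.
have e2 : 0 < (e / 2) ^+ 2 by rewrite exprn_gt0// divr_gt0.
apply: near_squareP; exists (Num.min (e / 2) ((e / 2) ^+ 2 / (1 + F))).
  by rewrite lt_min !divr_gt0.
move=> B; rewrite !lt_min => /andP[y1 y2] /andP[_ t2].
rewrite /graph_dist distrC.
suff : Num.sqrt `|B.2 - A.2 - 2^-1 * (f A + f B) * (B.1 - A.1)| <= e / 2 by lra.
rewrite -[e / 2]ger0_norm; last by lra.
rewrite -[leRHS]sqrtr_sqr ler_wsqrtr//; apply: le_trans (ler_normB _ _) _.
have h : `|2^-1 * (f A + f B)| <= F.
  have := fF A; have := fF B; rewrite !ler_norml => /andP[? ?] /andP[? ?].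
  by apply/andP; split; lra.
have h2 := ler_pM (normr_ge0 _) (normr_ge0 _) h (ltW y2); rewrite -normrM in h2.
apply: le_trans (lerD (ltW t2) h2) _.
have : (e / 2) ^+ 2 / (1 + F) * (1 + F) = (e / 2) ^+ 2 by rewrite divfK// gt_eqF.
by lra.
Qed.

Variable omega : set (R * R).

Lemma limit_ratio_differentiable (P : R * R) (w : R) :
  `|P.1 - ctr.1| < r0 -> `|P.2 - ctr.2| < r0 -> limit_ratio clamped P w ->
  graph_differentiable omega phi phi P.
Proof.
move=> P1 P2 limw.
have [F clampedF] := clamped_bounded.
have boxP : box ctr r0 P by split; exact: ltW.
have boxP2 : box ctr (2 * r0) P.
  by apply: (box_near boxP); rewrite subrr normr0 ltW.
exists (fun A => w * A.1); first split=> [A B|r A _].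
- by rewrite /= mulrDr.
- by rewrite /= mulrCA.
have nbox : \forall B \near P, box ctr (2 * r0) B.
  apply: near_squareP; exists r0 => // B b1 b2.
  by apply: (box_near boxP); exact: ltW.
apply/cvgrPdist_le => e e0.
have [r1 r10 Hr1] := graph_estimate continuous_clamped r0_gt0 K0 clampedF clamped_lipschitz boxP limw e0.
have ndist := graph_dist_near P r10 clampedF.
rewrite near_withinE /dnbhs near_withinE.
have /= H : \forall B \near P, box ctr (2 * r0) B /\ graph_dist clamped P B < r1.
  by near do split.
apply: filterS H => B [boxB dB] BP _.
have PB : P != B by rewrite eq_sym; exact: BP.
have d0 := graph_dist_gt0 clamped PB.
have := Hr1 B boxB d0 dB.
rewrite !clamped_id// graph_dist_clamped// => h.
rewrite graph_dist_clamped// in d0.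
rewrite sub0r normrN normrM normfV (ger0_norm (ltW d0)) ler_pdivrMr//.
Unshelve. all: by end_near. Qed.

(** By [exists_limit_ratio] it suffices to discard countably many exceptional sets, with M = k + 1
    and delta = 1 / (k + 1). *)
Lemma local_negligible : plane_measure.-negligible
  [set A : plane | `|A.1 - ctr.1| < r0 /\ `|A.2 - ctr.2| < r0 /\
     ~ graph_differentiable omega phi phi A].
Proof.
have [F clampedF] := clamped_bounded.
apply: (@negligibleS _ _ _ _ (\bigcup_k [set A : plane | `|A.1 - ctr.1| < r0 /\
    `|A.2 - ctr.2| < r0 /\ ~ good_at clamped k.+1%:R k.+1%:R^-1 A])).
  move=> A [A1 [A2 nd]]; apply: contrapT => H; apply: nd.
  have boxA : box ctr r0 A by split; exact: ltW.
  have [|w lw] := @exists_limit_ratio R clamped A; last exact: limit_ratio_differentiable lw.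
  by move=> k; apply: contrapT => ng; apply: H; exists k.
apply: negligible_bigcup => k.
apply: (bad_negligible continuous_clamped r0_gt0 K0 clampedF clamped_lipschitz).
- by rewrite ler1n.
- by rewrite invr_gt0 ltr0n.
Qed.

End local.

Theorem theorem5p5 (R : realType) (omega : set (R * R)) (phi : R * R -> R) :
  open omega ->
  intrinsic_lipschitz omega phi ->
  {ae (@lebesgue_measure R \x @lebesgue_measure R)%E,
    forall A : R * R, omega A -> graph_differentiable omega phi phi A}.
Proof.
move=> oomega [K K0 phiK].
(* Countably many rational squares exhaust [omega]; the doubled square must lie in [omega], since
   the local result uses the Lipschitz bound there. *)
pose c (q : rat * rat * rat) : R * R := (ratr q.1.1, ratr q.1.2).
pose r (q : rat * rat * rat) : R := ratr q.2.
pose Bad q : set (measurableTypeR R * measurableTypeR R) :=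
  [set A | 0 < r q /\ box (c q) (2 * r q) `<=` omega /\
     `|A.1 - (c q).1| < r q /\ `|A.2 - (c q).2| < r q /\
     ~ graph_differentiable omega phi phi A].
have negBad q : (@lebesgue_measure R \x @lebesgue_measure R)%E.-negligible (Bad q).
  have [[rq bq]|n] := pselect (0 < r q /\ box (c q) (2 * r q) `<=` omega).
    have phiK' A B : box (c q) (2 * r q) A -> box (c q) (2 * r q) B ->
        `|phi A - phi B| <= K * graph_dist phi A B.
      by move=> /bq ? /bq ?; exact: phiK.
    have h := local_negligible rq K0 phiK' omega.
    apply: (@negligibleS _ _ _ _ _ _ _ h).
    by move=> A [_ [_ hA]].
  apply: (@negligibleS _ _ _ _ set0); last exact: negligible_set0.
  by move=> A [h1 [h2 _]]; apply: n.
apply: (@negligibleS _ _ _ _ (\bigcup_n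
   (if unpickle n is Some q then Bad q else set0))); last first.
  apply: negligible_bigcup => n; case: (unpickle n) => [q|]; first exact: negBad.
  exact: negligible_set0.
move=> A /= /not_implyP[oA nd].
have /nbhs_ballP[e /= e0 He] := open_nbhs_nbhs (conj oomega oA).
(* The centre will be within [w] of A in each coordinate, so the doubled square stays within 3 w < e
   of A. *)
have [w] := @rat_in_itvoo R 0 (e / 4) ltac:(lra).
rewrite in_itv/= => /andP[w0 we].
have [u] := @rat_in_itvoo R (A.1 - ratr w) (A.1 + ratr w) ltac:(lra).
have [v] := @rat_in_itvoo R (A.2 - ratr w) (A.2 + ratr w) ltac:(lra).
rewrite !in_itv/= => /andP[v1 v2] /andP[u1 u2].
exists (pickle (u, v, w)); first exact: I.
rewrite pickleK; split; first exact: w0.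
split; last first.
  split; first by rewrite ltr_norml; apply/andP; split; lra.
  split; last exact: nd.
  by rewrite ltr_norml; apply/andP; split; lra.
move=> B [/=]; rewrite !ler_norml => /andP[? ?] /andP[? ?].
by apply: He; split; rewrite /ball/= ltr_norml; apply/andP; split; lra.
Qed.
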